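(* Let $n,k\ge 2$ be two integers with $n\ge k+1$, let $X\in \mathrm{DL}_{n-k,k}$, and let $Y$ be a graph of order $n$. Then: (i) if $n=k+1$ and $X\cong \mathrm{Dand}_{1,n-1}$, then $\mathrm{FS}(X,Y)$ is connected if and only if $Y$ is a $2$-connected non-bipartite graph and $Y\notin\{C_n,\theta_0\}$; (ii) if $n=k+1$, $X\not\cong\mathrm{Dand}_{1,n-1}$ and $Y\notin\{C_n,\theta_0\}$, then $\mathrm{FS}(X,Y)$ is connected if and only if $Y$ is $2$-connected; (iii) if $k+2\le n\le 2k-2$ and $X\cong\mathrm{Dand}_{n-k,k}$, then $\mathrm{FS}(X,Y)$ is connected if and only if $Y$ is non-bipartite and $(n-k+1)$-connected; (iv) if $k+2\le n\le 2k-2$ and $X\not\cong\mathrm{Dand}_{n-k,k}$, then $\mathrm{FS}(X,Y)$ is connected if and only if $Y$ is $(n-k+1)$-connected; (v) if $n\ge 2k-1$ and $n\ne k+1$, then $\mathrm{FS}(X,Y)$ is connected if and only if $Y$ is $(n-k+1)$-connected; (vi) $\mathrm{FS}(X,Y)$ is connected if and only if $\mathrm{FS}(X,Y)$ is $2$-connected. (Membership $Y\in\{C_n,\theta_0\}$ is understood up to isomorphism.)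
   Context: All graphs are simple; the order of a graph is its number of vertices. For two graphs $X,Y$ of the same order $n$, the friends-and-strangers graph $\mathrm{FS}(X,Y)$ has as vertices all bijections $\sigma:V(X)\to V(Y)$; two bijections $\sigma,\sigma'$ are adjacent if and only if there are distinct $a,b\in V(X)$ with $ab\in E(X)$, $\sigma(a)\sigma(b)\in E(Y)$, $\sigma(a)=\sigma'(b)$, $\sigma(b)=\sigma'(a)$, and $\sigma(c)=\sigma'(c)$ for all $c\in V(X)\setminus\{a,b\}$. A graph $G$ is $s$-connected if the graph resulting from removing any $s-1$ vertices of $G$ is still connected (with the convention that the complete graph $K_n$ has vertex connectivity $n-1$, i.e. is $s$-connected exactly for $s\le n-1$). $P_m$, $C_m$, $K_m$, $S_m$ denote the path, cycle, complete graph and star of order $m$. $\theta_0$ is the graph of order $7$ obtained from a $6$-cycle by adding one new vertex adjacent to exactly two opposite (distance $3$) vertices of the cycle. The lollipop graph $\mathrm{Lollipop}_{n-k,k}$ of order $n$ is obtained by identifying one end of $P_{n-k+1}$ with a vertex of $K_k$. The dandelion graph $\mathrm{Dand}_{n-k,k}$ of order $n$ is obtained by identifying one end of $P_{n-k+1}$ with the center vertex of $S_k$. $\mathrm{DL}_{n-k,k}$ is the set of graphs $G$ such that $G$ is a spanning subgraph of $\mathrm{Lollipop}_{n-k,k}$ and $\mathrm{Dand}_{n-k,k}$ is a spanning subgraph of $G$.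
   Formalization: The exclusion of C_n in (i) and (ii) is applied only for n ≥ 4: for n = 3, k = 2, X = P_3, Y = K_3 = C_3 the graph FS(X,Y) is a 6-cycle, hence connected, so (i) as literally stated fails there. *)

(* Defs.v *)
From mathcomp Require Import all_boot.

Set Implicit Arguments.
Unset Strict Implicit.
Unset Printing Implicit Defensive.

Record sgraph := SGraph {
  vertex :> finType;
  edge : rel vertex;
  edge_sym : symmetric edge;
  edge_irrefl : irreflexive edge }.
Arguments edge {s}.

(* The simple graph whose edges are the pairs {x, y}, x != y, related by r in
   at least one direction. *)
Section GraphOfRel.
Variables (T : finType) (r : rel T).

Definition rel_edge : rel T := [rel x y | (x != y) && (r x y || r y x)].

Lemma rel_edge_sym : symmetric rel_edge.
Proof. by move=> x y; rewrite /rel_edge /= eq_sym orbC. Qed.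

Lemma rel_edge_irrefl : irreflexive rel_edge.
Proof. by move=> x; rewrite /rel_edge /= eqxx. Qed.

Definition graph_of_rel : sgraph := SGraph rel_edge_sym rel_edge_irrefl.
End GraphOfRel.

Definition iso (G H : sgraph) : Prop :=
  exists f : G -> H, bijective f /\ forall x y, edge (f x) (f y) = edge x y.

(* Up to isomorphism: G is isomorphic to a spanning subgraph of H. *)
Definition spanning_subgraph (G H : sgraph) : Prop :=
  exists f : G -> H, bijective f /\ forall x y, edge x y -> edge (f x) (f y).

Definition bipartite (G : sgraph) : Prop :=
  exists c : G -> bool, forall x y, edge x y -> c x != c y.

Definition connected (G : sgraph) : Prop := forall x y : G, connect edge x y.

Section Deletion.
Variables (G : sgraph) (S : {set G}).

Definition del_edge : rel {x : G | x \notin S} :=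
  [rel x y | edge (val x) (val y)].

Lemma del_edge_sym : symmetric del_edge.
Proof. by move=> x y; exact: edge_sym. Qed.

Lemma del_edge_irrefl : irreflexive del_edge.
Proof. by move=> x; exact: edge_irrefl. Qed.

Definition del_vertices : sgraph := SGraph del_edge_sym del_edge_irrefl.
End Deletion.

(* The clause s < #|G| is the convention that K_n is s-connected exactly for
   s <= n - 1; without it every graph of order s would be s-connected. *)
Definition s_connected (s : nat) (G : sgraph) : Prop :=
  s < #|G| /\
  forall S : {set G}, #|S|.+1 = s -> connected (del_vertices S).

Definition cycle_graph (n : nat) : sgraph :=
  graph_of_rel [rel i j : 'I_n | j == i.+1 %% n :> nat].

(* The 6-cycle is 0, ..., 5; vertex 6 is joined to 0 and 3. *)
Definition theta0 : sgraph :=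
  graph_of_rel [rel i j : 'I_7 |
    [&& i < 6, j < 6 & j == i.+1 %% 6 :> nat] ||
    ((i == 6 :> nat) && ((j == 0 :> nat) || (j == 3 :> nat)))].

(* In both graphs the path of order m + 1 is 0, ..., m, and the K_k, resp. the
   star S_k, has vertices m, ..., m + k - 1: vertex m is the identified one
   (the center of the star in the second case). *)
Definition lollipop (m k : nat) : sgraph :=
  graph_of_rel [rel i j : 'I_(m + k) |
    ((j <= m) && (j == i.+1 :> nat)) || ((m <= i) && (m <= j))].

Definition dandelion (m k : nat) : sgraph :=
  graph_of_rel [rel i j : 'I_(m + k) |
    ((j <= m) && (j == i.+1 :> nat)) || ((i == m :> nat) && (m < j))].

Definition DL (m k : nat) (G : sgraph) : Prop :=
  spanning_subgraph G (lollipop m k) /\ spanning_subgraph (dandelion m k) G.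

Section FriendsAndStrangers.
Variables X Y : sgraph.

Definition bijections : finType :=
  {s : {ffun X -> Y} | injectiveb s && [forall y, y \in codom s]}.

Definition FS_edge : rel bijections := [rel s t : bijections |
  [exists a : X, [exists b : X,
    [&& a != b, edge a b, edge (val s a) (val s b),
        val s a == val t b, val s b == val t a
      & [forall c : X, (c \notin [set a; b]) ==> (val s c == val t c)]]]]].

Lemma FS_edge_sym : symmetric FS_edge.
Proof.
suff sub s t : FS_edge s t -> FS_edge t s by move=> s t; apply/idP/idP; apply: sub.
rewrite /FS_edge /= => /existsP[a] /existsP[b] /and5P[ab Xab Yab /eqP ea].
case/andP=> /eqP eb /forallP ec; apply/existsP; exists a; apply/existsP; exists b.
rewrite ab Xab -ea -eb edge_sym Yab !eqxx /=.
by apply/forallP=> c; rewrite eq_sym; apply: ec.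
Qed.

Lemma FS_edge_irrefl : irreflexive FS_edge.
Proof.
move=> s; apply/negbTE/negP; rewrite /FS_edge /= => /existsP[a] /existsP[b].
case/and5P=> _ _ Yab /eqP ea _.
by rewrite -ea edge_irrefl in Yab.
Qed.

Definition FS : sgraph := SGraph FS_edge_sym FS_edge_irrefl.
End FriendsAndStrangers.

(* Y \in {C_n, theta_0} for Y of order n, with Wilson's convention that C_n is
   exceptional only for n >= 4: the triangle C_3 = K_3 is not an exception,
   since FS(P_3, K_3) is a 6-cycle, hence connected. *)
Definition exceptional (n : nat) (Y : sgraph) : Prop :=
  (4 <= n /\ iso Y (cycle_graph n)) \/ iso Y theta0.

(* Main.v *)
From Stdlib Require Import Classical_Prop.
Require Import Defs.
From mathcomp Require Import all_boot all_fingroup.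
From mathcomp Require Import zify.

(** Put the people [V(X)] as tokens on the vertices of [Y]: two tokens on adjacent vertices may be
    exchanged if they are adjacent in [X]. Configurations then become permutations of [Y]
    ([FS_connected]). After relabelling ([DL_labelling]), [X] contains the dandelion and is
    contained in the lollipop, with [m = n - k] edges on the path: the token [m] is the centre, the
    tokens [0, ..., m - 1] form the path and the tokens after [m] are the leaves.

    Necessity. If deleting [m] vertices separates [A] from the rest of [Y], a token 0 placed in [A]
    stays confined to [A] and the deleted set ([conn_in_of_reach]); hence [Y] is
    [(m + 1)]-connected. If [X] is the dandelion and [Y] is bipartite, the sign of the configuration
    together with the two colourings gives an invariant ([parity_move]). For a star [X], the
    cyclic order of the tokens on a cycle, and a 1-factorization of the complete graph on six
    vertices for [theta0], are invariants as well ([cycle_not_reach], [theta0_not_reach]).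

    Sufficiency for a star is Wilson's theorem on sliding a blank, the centre, around a 2-connected
    graph. The closed walks of the blank form a permutation group. If the graph is not a cycle it
    contains two vertices joined by three disjoint paths, and unless these have 1, 2 and 2 inner
    vertices the commutators of the rotations around its cycles yield a 3-cycle
    ([theta_has_3cycle]); in the remaining case any further edge or ear gives another such
    subgraph ([theta0_ear]) or the graph is [theta0]. A maximal set on which the group contains
    the alternating group is a block ([maximal_alt_block]), and there is no proper block with more
    than one point ([block_full]): a rotation through an ear would move the block to another one
    meeting it. So all even permutations are reached ([wilson_even]), and all permutations if
    there is an odd closed walk ([wilson_all]).

    For a longer path, the tokens [0, 1, ...] are parked one after the other ([bring_token],
    [equivalence_by_levels]) until the star of the centre remains. A token is parked on a vertex
    whose deletion leaves a graph that is not exceptional, and not bipartite if it was not before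
    ([good_vertex]). In general this leaves at most two classes of configurations,
    exchanged by swapping two leaves ([two_classes_reach]), and any edge of [X] outside the
    dandelion joins two leaves and merges the classes ([reach_extra_edge]). If [n >= 2k - 1], an
    [(m + 1)]-connected graph cannot be bipartite ([nonbipartite_of_s_connected]).

    For the last item it is enough that all neighbours of a configuration remain connected when it
    is deleted ([conn_in_without_vertex], [neighbours_connected]): exchanges of disjoint pairs
    commute, and two steps of the centre are joined by turning it around a cycle of [Y]. *)

Set Implicit Arguments.
Unset Strict Implicit.
Unset Printing Implicit Defensive.

(** * Connectivity inside a set of vertices *)

Section Restriction.
Variables (T : finType) (r : rel T).
Implicit Types (A B D S K : {set T}) (u v w x : T).

Definition restr A : rel T := [rel u v | [&& u \in A, v \in A & r u v]].

Definition conn_in A := forall u v, u \in A -> v \in A -> connect (restr A) u v.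

Definition biconn_in A := conn_in A /\ forall x, conn_in (A :\ x).

Lemma restr_sub A B : A \subset B -> subrel (restr A) (restr B).
Proof. by move=> /subsetP sAB u v /and3P[/sAB uB /sAB vB ruv]; apply/and3P. Qed.

Lemma restr_sym A : symmetric r -> symmetric (restr A).
Proof. by move=> rs u v; rewrite /restr /= rs andbCA. Qed.

Lemma connect_restr_sub A B u v :
  A \subset B -> connect (restr A) u v -> connect (restr B) u v.
Proof. by move=> sAB; apply: connect_sub => x y /(restr_sub sAB); apply: connect1. Qed.

Lemma connect_restr_in A u v : connect (restr A) u v -> u \in A -> v \in A.
Proof.
case/connectP=> p; elim: p u => [|w p IH] u /=; first by move=> _ ->.
by case/andP=> /and3P[_ wA _] pp lv _; apply: IH pp lv wA.
Qed.

Lemma path_restr_in A u p : path (restr A) u p -> {subset p <= A}.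
Proof.
elim: p u => [|w p IH] u //= /andP[/and3P[_ wA _] pp] z.
by rewrite inE => /predU1P[->|/(IH _ pp)].
Qed.

Lemma connect_exit (s : rel T) K u v :
  connect s u v -> u \in K -> v \notin K ->
  exists a b, [/\ a \in K, b \notin K & s a b].
Proof.
case/connectP=> p; elim: p u => [|w p IH] u /=.
  by move=> _ -> ->.
case/andP=> suw pp lv uK vK; case: (boolP (w \in K)) => wK.
  by apply: IH pp lv wK vK.
by exists u, w.
Qed.

Lemma first_hit (s : rel T) K v z :
  connect s v z -> v \notin K -> z \in K ->
  exists E w, [/\ path s v (rcons E w), uniq (v :: E), w \in K
    & {in v :: E, forall y, y \notin K}].
Proof.
case/connectP=> p0 pp0 lz vK; case/shortenP: pp0 lz => p pp up _ lz zK.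
have hp : has (mem K) p.
  apply/hasP; exists z => //; case: p lz {pp up} => [|y p] lz; last first.
    by rewrite lz /= mem_last.
  by move: zK; rewrite lz (negbTE vK).
case/split_find: hp pp up {lz} => w E s2 /= wK /hasPn EK.
rewrite cat_path => /andP[pE _] /andP[vE]; rewrite cat_uniq => /andP[uE _].
exists E, w; split=> //.
  move: uE vE; rewrite /= rcons_uniq mem_cat mem_rcons !inE.
  by case/andP=> _ ->; rewrite !negb_or => /andP[/andP[_ ->]].
by move=> y; rewrite inE => /predU1P[->|/EK].
Qed.

(** An ear of [K]: leave [K] along any edge, from a vertex [u], and come back to [K] inside
    [D :\ u], which is still connected; this gives a second attachment vertex. *)
Lemma ear D K : symmetric r -> biconn_in D -> K \subset D -> K != D -> 1 < #|K| ->
  exists u w E, [/\ u \in K, w \in K, u != w & E != [::]] /\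
  [/\ uniq E, {in E, forall y, y \in D :\: K} & path (restr D) u (rcons E w)].
Proof.
move=> rs [Dc Dx] sKD nKD K2.
have [k kK] : exists k, k \in K by apply/card_gt0P; lia.
have [d dD dK] : exists2 d, d \in D & d \notin K.
  by apply/subsetPn; apply: contra nKD => sDK; rewrite eqEsubset sKD.
have kD := subsetP sKD _ kK.
have [u [v [uK vK /and3P[uD vD ruv]]]] := connect_exit (Dc _ _ kD dD) kK dK.
have [z zK zu] : exists2 z, z \in K & z != u.
  have : 0 < #|K :\ u| by rewrite (cardsD1 u K) uK in K2.
  by case/card_gt0P=> z; rewrite !inE => /andP[zu zK]; exists z.
have vu : v != u by apply: contraNneq vK => ->.
have vD' : v \in D :\ u by rewrite !inE vu.
have zD' : z \in D :\ u by rewrite !inE zu (subsetP sKD).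
have [E [w [pE uE wK EK]]] := first_hit (Dx u _ _ vD' zD') vK zK.
have wu : w != u.
  have : w \in D :\ u by apply: (path_restr_in pE); rewrite mem_rcons mem_head.
  by rewrite !inE => /andP[].
have sE : {subset v :: E <= D}.
  move=> y; rewrite inE => /predU1P[-> //|yE].
  have : y \in D :\ u by apply: (path_restr_in pE); rewrite mem_rcons inE yE orbT.
  by rewrite inE => /andP[].
exists u, w, (v :: E); split; first by split=> //; rewrite eq_sym.
split=> // [y yE|]; first by rewrite inE EK ?sE.
rewrite /= {1}/restr /= uD vD ruv /=.
by apply: sub_path pE; apply: restr_sub; apply: subsetDl.
Qed.

End Restriction.

(** * The cyclic permutation along a list *)

Section Cycles.
Local Open Scope group_scope.
Variable T : finType.
Implicit Types (s : seq T) (g h : {perm T}).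

(** The permutation sending each entry of a list without repetition to the next one, cyclically.
    Written as a product of transpositions, it can be conjugated and extended by rewriting. *)
Fixpoint cyc s : {perm T} :=
  if s is x :: s' then cyc s' * tperm x (head x s') else 1.

Lemma cyc_out s x : x \notin s -> cyc s x = x.
Proof.
elim: s => [|y s IH] /=; first by rewrite perm1.
rewrite inE negb_or permM => /andP[xy xs]; rewrite IH //.
rewrite tpermD 1?eq_sym //.
by case: s xs {IH} => [|z s] //=; rewrite inE negb_or => /andP[].
Qed.

Lemma cyc_last x s : uniq (x :: s) -> cyc (x :: s) (last x s) = x.
Proof.
elim: s x => [|y s IH] x; first by rewrite /= mul1g tpermL.
move=> /andP[xs us]; rewrite [cyc _]/= permM [last _ _]/=.
by have /= -> := IH _ us; rewrite tpermR.
Qed.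

Lemma cycJ s g : cyc s ^ g = cyc (map g s).
Proof.
elim: s => [|x s IH] /=; first by rewrite conj1g.
by rewrite conjMg IH tpermJ; case: s {IH}.
Qed.

Lemma cyc_rcons x s : uniq (x :: s) -> cyc (rcons s x) = cyc (x :: s).
Proof.
case: s => [|y s] //; rewrite cons_uniq => /andP[xs us].
have E : forall z s', cyc (rcons (z :: s') x) = tperm (last z s') x * cyc (z :: s').
  move=> z s'; elim: s' z => [|w s' IH] z.
    by rewrite /= !mul1g !tperm1 mul1g mulg1 tpermC.
  have -> : cyc (rcons [:: z, w & s'] x) = cyc (rcons (w :: s') x) * tperm z w by [].
  by rewrite IH -mulgA.
rewrite E -[cyc (x :: _)]/(cyc (y :: s) * tperm x y).
apply: (mulgI (cyc (y :: s))^-1); rewrite mulKg -conjgE tpermJ.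
by rewrite cyc_last // cyc_out // tpermC.
Qed.

Lemma cyc_catC s1 s2 : uniq (s1 ++ s2) -> cyc (s2 ++ s1) = cyc (s1 ++ s2).
Proof.
elim: s1 s2 => [|x s1 IH] s2; first by rewrite cats0.
move=> u; have u' : uniq (s1 ++ rcons s2 x) by rewrite -rcons_cat rcons_uniq -cons_uniq.
by rewrite -cat_rcons IH // -rcons_cat cyc_rcons.
Qed.

Lemma cyc_next s1 s2 x y : uniq (s1 ++ [:: x, y & s2]) -> cyc (s1 ++ [:: x, y & s2]) x = y.
Proof.
move=> u; have u' : uniq (x :: y :: s2 ++ s1) by rewrite -!cat_cons uniq_catC.
rewrite -cyc_catC // -[_ ++ _]/([:: x, y & s2 ++ s1]).
rewrite [cyc _]/= permM; move/andP: u' => [xs _].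
by have /= -> := cyc_out xs; rewrite tpermL.
Qed.

Lemma cyc_rev s : uniq s -> cyc (rev s) = (cyc s)^-1.
Proof.
elim: s => [|x s IH]; first by rewrite /= invg1.
move=> u; have /andP[xs us] := u.
rewrite rev_cons cyc_rcons; last by rewrite /= mem_rev rev_uniq.
case: s xs us u IH => [|y s] xs us u IH.
  by rewrite /= !mul1g tperm1 invg1.
have -> : cyc (x :: rev (y :: s)) = cyc (rev (y :: s)) * tperm x (last y s).
  by rewrite [LHS]/= lastI rev_rcons.
have -> : cyc [:: x, y & s] = cyc (y :: s) * tperm x y by [].
rewrite IH //; move: (cyc_last us) (cyc_out xs).
move: (cyc (y :: s)) (last y s) => C z Cz Cx.
rewrite invMg tpermV; apply: (mulgI C); rewrite mulKVg.
have -> : tperm x y = tperm x z ^ C by rewrite tpermJ Cz Cx.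
by rewrite conjgE -!mulgA mulKVg mulgV mulg1.
Qed.

End Cycles.

Arguments cyc : simpl never.

(** * Three-cycles from two cycles with a common arc *)

Lemma uniq_count_le (T : eqType) (t s : seq T) :
  uniq s -> (forall z, count_mem z t <= count_mem z s) -> uniq t.
Proof.
move=> us H; apply/count_mem_uniq => z; have := H z; rewrite (count_uniq_mem _ us).
have := has_count (pred1 z) t; rewrite has_pred1.
by case: (z \in t); case: (z \in s) => /=; lia.
Qed.

Lemma count_rcons (T : Type) (a : pred T) s x : count a (rcons s x) = count a s + a x.
Proof. by rewrite -cats1 count_cat /= addn0. Qed.

(** Absence of repetitions passes to every list with smaller multiplicities; this is linear
    arithmetic on the multiplicities of one element. *)
Ltac uniq_by u := apply: (uniq_count_le u) => ?;
  repeat (progress rewrite /= ?count_cat ?count_rev ?count_rcons);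
  repeat match goal with |- context [nat_of_bool ?b] => move: (nat_of_bool b) => ? end;
  clear; lia.

Section ThreeCycles.
Local Open Scope group_scope.
Variable T : finType.
Implicit Types (s c x y : seq T) (g h : {perm T}).

(** Conjugating a cycle by another one that shares an arc with it amounts to mapping its list; on
    the arc, this map is a shift. *)
Lemma cyc_shift s1 p a s2 : uniq (s1 ++ p ++ a :: s2) ->
  map (cyc (s1 ++ p ++ a :: s2)) p = behead (rcons p a).
Proof.
elim: p s1 => [|b p IH] s1 //= u.
have := IH (rcons s1 b); rewrite !cat_rcons => /(_ u) ->.
by case: p u {IH} => [|d p] u /=; rewrite cyc_next.
Qed.

Lemma map_cyc_out s p : {in p, forall a, a \notin s} -> map (cyc s) p = p.
Proof. by move=> H; rewrite -[RHS]map_id; apply/eq_in_map => a /H /cyc_out. Qed.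

Lemma tperm_disjC (a b d e : T) : uniq [:: a; b; d; e] ->
  tperm a b * tperm d e = tperm d e * tperm a b.
Proof.
move=> u; apply/commgP/conjg_fixP; rewrite tpermJ.
by move: u; rewrite /= !inE !negb_or => /and3P[/and3P[_ ? ?] /andP[? ?] _];
   rewrite !tpermD // eq_sym.
Qed.

Lemma tperm2J (a b d e : T) g :
  (tperm a b * tperm d e) ^ g = tperm (g a) (g b) * tperm (g d) (g e).
Proof. by rewrite conjMg !tpermJ. Qed.

Lemma double_tperm_mul (a b d e f : T) : uniq [:: a; b; d; e; f] ->
  (tperm a b * tperm d e) * (tperm b a * tperm d f) = tperm d e * tperm d f.
Proof.
move=> u; rewrite tperm_disjC; last first.
  by move: u; rewrite /= !inE !negb_or => /and5P[/and4P[-> -> -> _] /and3P[-> -> _] /andP[-> _]].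
by rewrite -mulgA [tperm b a]tpermC mulgA -mulgA tpermKg.
Qed.

(** For cycles sharing a common arc and nothing else, [b] shifts the arc by one and fixes the
    rest of [a], so that [a] and its conjugate by [b] nearly cancel. *)
Lemma commutator_cyc (c1 x1 y1 : T) Z x y :
  let a := cyc (c1 :: Z ++ x1 :: x) in let b := cyc (c1 :: Z ++ y1 :: y) in
  uniq (c1 :: Z ++ (x1 :: x) ++ (y1 :: y)) ->
  a^-1 * a ^ b = tperm c1 (head x1 Z) * tperm y1 x1.
Proof.
move=> a b u.
have ub : uniq (c1 :: Z ++ y1 :: y).
  by uniq_by u.
have ua : uniq (Z ++ x1 :: x).
  by uniq_by u.
have xb : {in x1 :: x, forall z, z \notin c1 :: Z ++ y1 :: y}.
  move=> z zx; apply/negP=> zb.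
  move: u; rewrite -cat_cons uniq_catCA cat_uniq => /and3P[_ /hasPn H _].
  by move: (H z); rewrite cat_cons => /(_ zb); rewrite /= zx.
have -> : a ^ b = cyc (Z ++ y1 :: x1 :: x).
  rewrite /a cycJ -cat_cons map_cat (map_cyc_out xb).
  by rewrite (@cyc_shift [::] (c1 :: Z) y1 y ub) [behead _]/= cat_rcons.
have uy : uniq (Z ++ y1 :: x1 :: x).
  by uniq_by u.
have -> : cyc (Z ++ y1 :: x1 :: x) = cyc (Z ++ x1 :: x) * tperm y1 x1.
  by rewrite -cyc_catC // -[cyc (Z ++ _ :: x)]cyc_catC.
have -> : a = cyc (Z ++ x1 :: x) * tperm c1 (head x1 Z).
  by rewrite /a [LHS]/cyc -/cyc; case: (Z).
by rewrite invMg tpermV -mulgA mulKg.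
Qed.

Variable H : {group {perm T}}.

(** The product is the cyclic permutation of [a], [b] and [d]. *)
Definition has_3cycle := exists a b d, uniq [:: a; b; d] /\ tperm a b * tperm a d \in H.

Lemma commutator_cyc_in (c1 x1 y1 : T) Z x y :
  cyc (c1 :: Z ++ x1 :: x) \in H -> cyc (c1 :: Z ++ y1 :: y) \in H ->
  uniq (c1 :: Z ++ (x1 :: x) ++ (y1 :: y)) ->
  tperm c1 (head x1 Z) * tperm y1 x1 \in H.
Proof. by move=> aH bH u; rewrite -(commutator_cyc u) groupM ?groupV ?groupJ. Qed.

Lemma cyc_rev_in s : uniq s -> cyc s \in H -> cyc (rev s) \in H.
Proof. by move=> us sH; rewrite cyc_rev ?groupV. Qed.

Lemma has_3cycle_share1 (c1 x1 y1 : T) x y :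
  cyc (c1 :: x1 :: x) \in H -> cyc (c1 :: y1 :: y) \in H ->
  uniq (c1 :: (x1 :: x) ++ (y1 :: y)) -> has_3cycle.
Proof.
move=> aH bH u; exists x1, c1, y1; split; first by uniq_by u.
by have := @commutator_cyc_in c1 x1 y1 [::] x y aH bH u; rewrite /= tpermC [tperm y1 _]tpermC.
Qed.

(** The commutator and the commutator of the reversed cycles are products of two transpositions.
    Conjugated so as to share the transposition of [c2] and [c3], their other transpositions meet
    in [x1] only, because [y2] and [yl] differ. *)
Lemma has_3cycle_share3_1 (c1 c2 c3 x1 y1 y2 yl : T) y :
  cyc [:: c1; c2; c3; x1] \in H -> cyc [:: c1, c2, c3, y1, y2 & rcons y yl] \in H ->
  uniq ([:: c1; c2; c3; x1] ++ [:: y1, y2 & rcons y yl]) -> has_3cycle.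
Proof.
set s := [:: c1, c2, c3, y1 & _] => aH bH u.
have us : uniq s by uniq_by u.
have ua : uniq [:: c1; c2; c3; x1] by uniq_by u.
have t1 := @commutator_cyc_in c1 x1 y1 [:: c2; c3] [::] _ aH bH u.
have t2 : tperm c3 c2 * tperm yl x1 \in H.
  apply: (@commutator_cyc_in c3 x1 yl [:: c2; c1] [::] (rev [:: y1, y2 & y])).
  - have u3 : uniq ([:: c3; c2; c1] ++ [:: x1]) by uniq_by u.
    by have := cyc_rev_in ua aH; rewrite -(cyc_catC u3).
  - have u3 : uniq ([:: c3; c2; c1] ++ yl :: rev [:: y1, y2 & y]) by uniq_by u.
    have := cyc_rev_in us bH; rewrite -(cyc_catC u3).
    suff -> : (yl :: rev [:: y1, y2 & y]) ++ [:: c3; c2; c1] = rev s by [].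
    by rewrite -[s]/([:: c1; c2; c3] ++ _) rev_cat !rev_cons rev_rcons.
  - by uniq_by u.
have t1b := groupJ t1 bH.
have e1 : cyc s c1 = c2 := @cyc_next _ [::] _ _ _ us.
have e2 : cyc s c2 = c3 := @cyc_next _ [:: c1] _ _ _ us.
have e3 : cyc s y1 = y2 := @cyc_next _ [:: c1; c2; c3] _ _ _ us.
have e4 : cyc s x1 = x1.
  by apply: cyc_out; have /andP[] : uniq (x1 :: s) by uniq_by u.
move: t1b; rewrite [head _ _]/= tperm2J e1 e2 e3 e4 => t1b.
exists x1, yl, y2; split; first by uniq_by u.
have := groupM t2 t1b; rewrite [tperm yl _]tpermC [tperm y2 _]tpermC double_tperm_mul //.
by uniq_by u.
Qed.

(** As above, conjugating by the other cycle: the remaining transpositions meet in [x2] only. *)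
Lemma has_3cycle_share3_2 (c1 c2 c3 x1 x2 y1 yl : T) y :
  cyc [:: c1; c2; c3; x1; x2] \in H -> cyc [:: c1, c2, c3, y1 & rcons y yl] \in H ->
  uniq ([:: c1; c2; c3; x1; x2] ++ [:: y1 & rcons y yl]) -> has_3cycle.
Proof.
set s := [:: c1, c2, c3, y1 & _]; set r := [:: _; _; _; _; _] => aH bH u.
have us : uniq s by uniq_by u.
have ua : uniq r by uniq_by u.
have t1 := @commutator_cyc_in c1 x1 y1 [:: c2; c3] _ _ aH bH u.
have t2 : tperm c3 c2 * tperm yl x2 \in H.
  apply: (@commutator_cyc_in c3 x2 yl [:: c2; c1] [:: x1] (rev [:: y1 & y])).
  - have u3 : uniq ([:: c3; c2; c1] ++ [:: x2; x1]) by uniq_by u.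
    by have := cyc_rev_in ua aH; rewrite -(cyc_catC u3).
  - have u3 : uniq ([:: c3; c2; c1] ++ yl :: rev [:: y1 & y]) by uniq_by u.
    have := cyc_rev_in us bH; rewrite -(cyc_catC u3).
    suff -> : (yl :: rev [:: y1 & y]) ++ [:: c3; c2; c1] = rev s by [].
    by rewrite -[s]/([:: c1; c2; c3] ++ _) rev_cat !rev_cons rev_rcons.
  - by uniq_by u.
have t1a := groupJ t1 aH.
have e1 : cyc r c1 = c2 := @cyc_next _ [::] _ _ _ ua.
have e2 : cyc r c2 = c3 := @cyc_next _ [:: c1] _ _ _ ua.
have e3 : cyc r x1 = x2 := @cyc_next _ [:: c1; c2; c3] _ _ _ ua.
have e4 : cyc r y1 = y1.
  by apply: cyc_out; have /andP[] : uniq (y1 :: r) by uniq_by u.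
move: t1a; rewrite [head _ _]/= tperm2J e1 e2 e3 e4 => t1a.
exists x2, yl, y1; split; first by uniq_by u.
have := groupM t2 t1a; rewrite [tperm yl _]tpermC [tperm y1 _]tpermC double_tperm_mul //.
by uniq_by u.
Qed.

(** With a long arc, two conjugates of the same commutator are the products of the transposition of
    [c2] and [c3] with those of [x3] with [x1] and with [cm]. *)
Lemma has_3cycle_share4 (c1 c2 c3 cm x1 x2 x3 y1 : T) c x y :
  let C := [:: c1, c2, c3 & rcons c cm] in
  cyc (C ++ [:: x1, x2, x3 & x]) \in H -> cyc (C ++ y1 :: y) \in H ->
  uniq (C ++ [:: x1, x2, x3 & x] ++ y1 :: y) -> has_3cycle.
Proof.
move=> C; set r := C ++ _; set s := C ++ _ => aH bH u.
have us : uniq s by uniq_by u.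
have ua : uniq r by uniq_by u.
have t1 := @commutator_cyc_in c1 x1 y1 (behead C) _ _ aH bH u.
rewrite [head _ _]/= in t1.
have a1 : cyc r c1 = c2 := @cyc_next _ [::] _ _ _ ua.
have a2 : cyc r c2 = c3 := @cyc_next _ [:: c1] _ _ _ ua.
have a3 : cyc r x1 = x2 := @cyc_next _ C _ _ _ ua.
have a4 : cyc r x2 = x3.
  by rewrite /r -cat_rcons; apply: cyc_next; rewrite cat_rcons.
have a5 : cyc r cm = x1.
  by rewrite /r /C -rcons_cons -!rcons_cons cat_rcons; apply: cyc_next; rewrite -cat_rcons.
have a6 : cyc r y1 = y1.
  by apply: cyc_out; have /andP[] : uniq (y1 :: r) by uniq_by u.
have b1 : cyc s c1 = c2 := @cyc_next _ [::] _ _ _ us.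
have b2 : cyc s c2 = c3 := @cyc_next _ [:: c1] _ _ _ us.
have b3 : cyc s c3 = cyc r c3.
  move: (us) (ua); rewrite /r /s /C; case: (c) => [|c4 c'] us' ua'.
    by rewrite (@cyc_next _ [:: c1; c2] _ c3 cm us') (@cyc_next _ [:: c1; c2] _ c3 cm ua').
  by rewrite (@cyc_next _ [:: c1; c2] _ c3 c4 us') (@cyc_next _ [:: c1; c2] _ c3 c4 ua').
have b4 : cyc s cm = y1.
  by rewrite /s /C -!rcons_cons cat_rcons; apply: cyc_next; rewrite -cat_rcons.
have b5 : cyc s x2 = x2.
  by apply: cyc_out; have /andP[] : uniq (x2 :: s) by uniq_by u.
have b6 : cyc s x3 = x3.
  by apply: cyc_out; have /andP[] : uniq (x3 :: s) by uniq_by u.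
move: aH bH t1 a1 a2 a3 a4 a5 a6 b1 b2 b3 b4 b5 b6.
move: (cyc r) (cyc s) => A B aH bH t1 a1 a2 a3 a4 a5 a6 b1 b2 b3 b4 b5 b6.
have inv z w : B z = w -> B^-1 w = z by move=> <-; rewrite permK.
have tA := groupJ (groupJ (groupJ t1 aH) (groupVr bH)) aH.
have tB := groupJ (groupJ (groupJ t1 aH) aH) (groupVr bH).
move: tA tB; rewrite !tperm2J a1 a2 a3 a4 a6.
rewrite (inv _ _ b1) (inv _ _ b2) (inv _ _ b3) !a6 (inv _ _ b4).
rewrite (inv _ _ b5) (inv _ _ b6) a1 a2 a4 a5 => tA tB.
exists x3, x1, cm; split; first by uniq_by u.
have := groupM tA tB; rewrite [tperm x1 _]tpermC [tperm cm _]tpermC [X in _ * (X * _)]tpermC.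
by rewrite double_tperm_mul //; uniq_by u.
Qed.

End ThreeCycles.

(** * Walks of a blank and theta graphs *)

Section Walks.
Local Open Scope group_scope.
Variables (T : finType) (e : rel T).
Hypothesis e_sym : symmetric e.
Implicit Types (A B : {set T}) (s t p q x : T) (g h w : {perm T}) (L P Q R : seq T).

(** A blank starts on [p] and walks in [A], each step exchanging it with the token it meets. The
    current displacement of all tokens is the permutation [g], so the blank is on [g p]. *)
Definition bstep A p : rel {perm T} :=
  [rel g h : {perm T} | restr e A (g p) (h p) && (h == g * tperm (g p) (h p))].

Definition walk A p g := connect (bstep A p) 1 g.

Lemma bstepP A p g q : restr e A (g p) q -> bstep A p g (g * tperm (g p) q).
Proof. by rewrite /bstep /= permM tpermL eqxx andbT. Qed.

Lemma bstep_sym A p : symmetric (bstep A p).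
Proof.
suff H g h : bstep A p g h -> bstep A p h g by move=> g h; apply/idP/idP; apply: H.
rewrite /bstep /= (restr_sym _ e_sym) => /andP[-> /eqP E] /=.
by rewrite {1}E -mulgA [X in _ * (_ * X)]tpermC tperm2 mulg1.
Qed.

Lemma bstepM A p w g h : bstep A (w p) g h = bstep A p (w * g) (w * h).
Proof. by rewrite /bstep /= !permM -mulgA (inj_eq (mulgI w)). Qed.

Lemma connect_bstepM A p w g h :
  connect (bstep A (w p)) g h -> connect (bstep A p) (w * g) (w * h).
Proof.
case/connectP=> s pgs ->; elim: s g pgs => [|k s IH] g /=; first by rewrite connect0.
by rewrite bstepM => /andP[/connect1 gk /IH]; apply: connect_trans.
Qed.

Lemma walk1 A p : walk A p 1. Proof. exact: connect0. Qed.

Lemma walkM A p g h : walk A p g -> walk A (g p) h -> walk A p (g * h).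
Proof.
move=> pg ph; apply: connect_trans pg _.
by rewrite -{1}[g]mulg1; apply: connect_bstepM.
Qed.

Lemma walk_edge A p q : restr e A p q -> walk A p (tperm p q).
Proof.
by move=> pq; have := @bstepP A p 1 q; rewrite perm1 mul1g => /(_ pq); apply: connect1.
Qed.

Lemma walkV A p g : walk A p g -> walk A (g p) g^-1.
Proof.
rewrite /walk (sym_connect_sym (bstep_sym A p)) => gp.
rewrite -[X in connect _ X](mulVg g) -{2}[g^-1]mulg1; apply: connect_bstepM.
by rewrite permK.
Qed.

Lemma walk_ind A p (F : {perm T} -> Prop) :
    F 1 -> (forall g q, walk A p g -> F g -> restr e A (g p) q -> F (g * tperm (g p) q)) ->
  forall g, walk A p g -> F g.
Proof.
move=> F1 FS g /connectP[s ps ->]; move: F1 (walk1 A p) ps.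
elim: s 1 => [|h s IH] k //= Fk wk /andP[kh ps].
have wh : walk A p h by apply: connect_trans wk (connect1 kh).
by case/andP: kh => r /eqP E; apply: (IH h) => //; rewrite E; apply: FS.
Qed.

Lemma walk_sub A B p g : A \subset B -> walk A p g -> walk B p g.
Proof.
move=> sAB wg; elim/walk_ind: wg => [|k q _ wk r]; first exact: walk1.
by apply: walkM wk (walk_edge _); apply: (restr_sub sAB).
Qed.

Lemma walk_out A p g x : walk A p g -> x \notin A -> g x = x.
Proof.
move=> wg xA; elim/walk_ind: wg => [|k q _ wk /and3P[kA qA _]]; first by rewrite perm1.
by rewrite permM wk tpermD //; apply: contraNneq xA => <-.
Qed.

Lemma walk_stable A p g x : walk A p g -> (g x \in A) = (x \in A).
Proof.
move=> wg; apply/idP/idP => xA; last first.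
  apply: contraTT xA => gx; rewrite -(permK g x).
  by have /walk_out -> := walkV wg.
by apply: contraTT xA => nx; rewrite (walk_out wg).
Qed.

Lemma walk_connect A p q : connect (restr e A) p q -> exists2 g, walk A p g & g p = q.
Proof.
case/connectP=> s; elim: s p => [|x s IH] p /=.
  by move=> _ ->; exists 1; [exact: walk1 | rewrite perm1].
case/andP=> px ps E; have [g wg gq] := IH x ps E.
exists (tperm p x * g); last by rewrite permM tpermL.
by apply: walkM (walk_edge px) _; rewrite tpermL.
Qed.

Definition loops A p := [set g | walk A p g && (g p == p)].

Lemma loopsP A p g : reflect (walk A p g /\ g p = p) (g \in loops A p).
Proof. by rewrite inE; apply: (iffP andP) => -[-> /eqP]. Qed.

Lemma loops_group_set A p : group_set (loops A p).
Proof.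
apply/group_setP; split; first by apply/loopsP; split; [exact: walk1 | rewrite perm1].
move=> g h /loopsP[wg gp] /loopsP[wh hp]; apply/loopsP; rewrite permM gp hp; split=> //.
by apply: walkM wg _; rewrite gp.
Qed.

Canonical loops_group A p := Group (loops_group_set A p).

Lemma loops_out A p g x : g \in loops A p -> x \notin A :\ p -> g x = x.
Proof.
case/loopsP=> wg gp; rewrite !inE negb_and negbK => /orP[/eqP->//|].
exact: walk_out wg.
Qed.

Lemma loops_conj A p w h : walk A p w -> h \in loops A (w p) -> w * h * w^-1 \in loops A p.
Proof.
move=> wp /loopsP[wh hp]; apply/loopsP; rewrite !permM hp permK; split=> //.
by rewrite -mulgA; apply: walkM => //; apply: walkM => //; rewrite hp; apply: walkV.
Qed.

(** The tokens move against the blank, hence the inverse. *)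
Lemma walk_path A p L : path (restr e A) p L -> walk A p (cyc (p :: L))^-1.
Proof.
elim: L p => [|x L IH] p /=.
  by rewrite /cyc /= mul1g tperm1 invg1 walk1.
case/andP=> px /IH wx.
have -> : cyc (p :: x :: L) = cyc (x :: L) * tperm p x by [].
by rewrite invMg tpermV; apply: walkM (walk_edge px) _; rewrite tpermL.
Qed.

Lemma loops_cycle A s L : L != [::] -> uniq (s :: L) -> path (restr e A) s (rcons L s) ->
  cyc L \in loops A s.
Proof.
move=> nL us pL; rewrite -groupV.
have sL : s \notin L by case/andP: us.
suff E : cyc L = cyc (s :: rcons L s).
  apply/loopsP; split; first by rewrite E; apply: walk_path.
  by apply: (canLR (permK _)); rewrite cyc_out.
have -> : cyc (s :: rcons L s) = cyc (rcons L s) * tperm s (head s L) by case: (L) nL.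
rewrite cyc_rcons // -[cyc (s :: L)]/(cyc L * tperm s (head s L)).
by rewrite -mulgA tperm2 mulg1.
Qed.

(** Three internally disjoint paths from [s] to [t]; the size conditions exclude a repeated
    edge [s t]. *)
Definition theta A s t P Q R :=
  [/\ uniq (s :: t :: P ++ Q ++ R),
      [/\ path (restr e A) s (rcons P t), path (restr e A) s (rcons Q t)
        & path (restr e A) s (rcons R t)]
    & [/\ 0 < size P + size Q, 0 < size P + size R & 0 < size Q + size R]].

Lemma thetaC A s t P Q R : theta A s t P Q R -> theta A s t Q P R.
Proof. by case=> u [pP pQ pR] [a b d]; split; [uniq_by u | | rewrite addnC]. Qed.

Lemma thetaC' A s t P Q R : theta A s t P Q R -> theta A s t P R Q.
Proof.
by case=> u [pP pQ pR] [a b d]; split; [uniq_by u | | split=> //; rewrite addnC].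
Qed.

(** The blank on [s] walks around the cycle formed by [P] and [Q]. *)
Lemma theta_cycle A s t P Q R : theta A s t P Q R ->
  cyc (rcons P t ++ rev Q) \in loops A s.
Proof.
case=> u [pP pQ _] _; apply: loops_cycle.
- by case: (P).
- by uniq_by u.
rewrite rcons_cat cat_path pP last_rcons.
have := rev_path (restr e A) s (rcons Q t); rewrite last_rcons belast_rcons rev_cons => ->.
by rewrite (eq_path (e' := restr e A)) // => x y; rewrite restr_sym.
Qed.

(** In turn: with [R] empty the two cycles through [R] share one token; two paths with one inner
    vertex form a 4-cycle, which rotates three tokens; in the other cases the two cycles through
    [R] share the vertices of [R] and [t]. *)
Lemma theta_has_3cycle_core A s t P Q R : theta A s t P Q R ->
  [\/ size R = 0%N, size P = 1%N /\ size Q = 1%N,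
      [/\ size R = 2, size P = 1%N & 2 < size Q]
      \/ [/\ size R = 2, size P = 2 & (1 < size Q)%N]
    | [/\ 2 < size R, 2 < size P & 0 < size Q]]%N -> has_3cycle (loops_group A s).
Proof.
move=> th; have thP := theta_cycle (thetaC (thetaC' th)).
have thQ := theta_cycle (thetaC (thetaC' (thetaC th))).
have thPQ := theta_cycle th.
case: (th) => u _ [sPQ sPR sQR]; case=> [r0|[p1 q1]|[[r2 p1 q3]|[r2 p2 q2]]|[r3 p3 q1]].
- have R0 := size0nil r0; rewrite R0 in thP thQ u sPR sQR.
  case: (lastP P) thP u sPR => [|P' x1] // thP u _.
  case: (lastP Q) thQ u sQR => [|Q' y1] // thQ u _.
  rewrite !rev_rcons /= in thP thQ.
  by apply: (has_3cycle_share1 thP thQ); uniq_by u.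
- case: P Q p1 q1 thPQ u {th thP thQ sPQ sPR sQR} => [|a [|]] // [|b [|]] // _ _ + u.
  rewrite /rev /cyc /= mul1g tperm1 mul1g [tperm a t]tpermC => th.
  by exists t, b, a; split=> //; uniq_by u.
- move: thP thQ; rewrite -(size_rev Q) in q3.
  have {}u : uniq (rcons R t ++ rev P ++ rev Q) by uniq_by u.
  case: R r2 u {th thPQ sPR sQR} => [|c1 [|c2 [|]]] // _.
  case: P p1 {sPQ} => [|x1 [|]] // _; case: (rev Q) q3 => [|y1 [|y2 y]] //.
  case: (lastP y) => [|{}y yl] // _ u thP thQ.
  by apply: (has_3cycle_share3_1 thP thQ); uniq_by u.
- move: thP thQ; rewrite -(size_rev Q) in q2; rewrite -(size_rev P) in p2.
  have {}u : uniq (rcons R t ++ rev P ++ rev Q) by uniq_by u.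
  case: R r2 u {th thPQ sPR sQR} => [|c1 [|c2 [|]]] // _.
  case: (rev P) p2 => [|x1 [|x2 [|]]] // _; case: (rev Q) q2 => [|y1 y] //.
  case: (lastP y) => [|{}y yl] // _ u thP thQ.
  by apply: (has_3cycle_share3_2 thP thQ); uniq_by u.
- move: thP thQ; rewrite -(size_rev Q) in q1; rewrite -(size_rev P) in p3.
  have {}u : uniq (rcons R t ++ rev P ++ rev Q) by uniq_by u.
  case: R r3 u {th thPQ sPR sQR} => [|c1 [|c2 [|c3 c]]] // _.
  case: (rev P) p3 => [|x1 [|x2 [|x3 x]]] // _; case: (rev Q) q1 => [|y1 y] // _ u thP thQ.
  by apply: (has_3cycle_share4 thP thQ); uniq_by u.
Qed.

(** The sizes for which the theta graph is [theta0]. *)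
Definition sizes122 P Q R :=
  [|| [&& size P == 1%N, size Q == 2 & size R == 2],
      [&& size P == 2, size Q == 1%N & size R == 2]
    | [&& size P == 2, size Q == 2 & size R == 1%N]].

Ltac or4_by := first [by apply: Or41 | by apply: Or42 | by apply: Or43; left
                    | by apply: Or43; right | by apply: Or44].

(** Whatever the sizes, some assignment of the roles to the three paths falls under one of the
    cases above. *)
Lemma theta_has_3cycle A s t P Q R :
  theta A s t P Q R -> ~~ sizes122 P Q R -> has_3cycle (loops_group A s).
Proof.
move=> th; have thPRQ := thetaC' th; have thQPR := thetaC th.
have thQRP := thetaC' thQPR; have thRPQ := thetaC thPRQ; have thRQP := thetaC' thRPQ.
have := theta_has_3cycle_core th; have := theta_has_3cycle_core thPRQ.
have := theta_has_3cycle_core thQPR; have := theta_has_3cycle_core thQRP.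
have := theta_has_3cycle_core thRPQ; have := theta_has_3cycle_core thRQP.
rewrite /sizes122; move: (size P) (size Q) (size R) (has_3cycle _) => a b d H h1 h2 h3 h4 h5 h6.
case: a b d h1 h2 h3 h4 h5 h6 => [|[|[|a]]] [|[|[|b]]] [|[|[|d]]] h1 h2 h3 h4 h5 h6 //= _;
  first [by apply: h1; or4_by | by apply: h2; or4_by | by apply: h3; or4_by
        | by apply: h4; or4_by | by apply: h5; or4_by | by apply: h6; or4_by].
Qed.

End Walks.

(** * Alternating groups and blocks *)

Section Alternating.
Local Open Scope group_scope.
Variables (T : finType) (H : {group {perm T}}).
Implicit Types (A B C : {set T}) (g h : {perm T}).

(** All transpositions inside [B] lie in one coset of [H]. *)
Definition alt_on B := [forall a in B, forall b in B, forall c in B, forall d in B,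
  (a != b) ==> (c != d) ==> (tperm a b * tperm c d \in H)].

Lemma alt_onP B : reflect (forall a b c d, a \in B -> b \in B -> c \in B -> d \in B ->
  a != b -> c != d -> tperm a b * tperm c d \in H) (alt_on B).
Proof.
apply: (iffP idP) => [h a b c d aB bB cB dB ab cd | h].
  have habc := forall_inP (forall_inP (forall_inP h _ aB) _ bB) _ cB.
  by have /implyP/(_ ab)/implyP/(_ cd) := forall_inP habc _ dB.
do 4!(apply/forall_inP=> ? ?); apply/implyP=> ?; apply/implyP=> ?; exact: h.
Qed.

(** A block of imprimitivity, for a group that fixes other points. *)
Definition block B := forall h x, h \in H -> x \in B -> h x \in B -> forall y, y \in B -> h y \in B.

Let same (g h : {perm T}) := g * h^-1 \in H.

Let same_sym g h : same g h -> same h g.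
Proof. by rewrite /same -groupV invMg invgK. Qed.

Let same_trans g h k : same g h -> same h k -> same g k.
Proof. by move=> gh hk; have := groupM gh hk; rewrite mulgA mulgKV. Qed.

Lemma alt_on_conj B h : h \in H -> alt_on B -> alt_on (h @: B).
Proof.
move=> hH /alt_onP aB; apply/alt_onP => _ _ _ _ /imsetP[a aA ->] /imsetP[b bA ->]
  /imsetP[c cA ->] /imsetP[d dA ->]; rewrite !(inj_eq perm_inj) => ab cd.
by rewrite -tperm2J groupJ ?aB.
Qed.

Let pick2 B z : z \in B -> 2 < #|B| -> exists a b, [/\ a \in B, b \in B & uniq [:: z; a; b]].
Proof.
move=> zB B3; have : 1 < #|B :\ z| by move: B3; rewrite (cardsD1 z) zB.
case/card_gt1P=> a [b [aB bB ab]]; exists a, b.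
move: aB bB; rewrite !inE => /andP[az aB] /andP[bz bB]; split=> //.
by rewrite /= !inE negb_or ![z == _]eq_sym az bz ab.
Qed.

(** Two alternating groups whose supports share a point generate the alternating group of the
    union; when they share a single point, this is because two 3-cycles through one point
    generate the alternating group of degree 5. *)
Lemma alt_onU B C z : z \in B -> z \in C -> 2 < #|B| -> 2 < #|C| ->
  alt_on B -> alt_on C -> alt_on (B :|: C).
Proof.
move=> zB zC B3 C3 /alt_onP aB /alt_onP aC.
have sB a b c d : a \in B -> b \in B -> c \in B -> d \in B -> a != b -> c != d ->
  same (tperm a b) (tperm c d) by move=> *; rewrite /same tpermV aB.
have sC a b c d : a \in C -> b \in C -> c \in C -> d \in C -> a != b -> c != d ->
  same (tperm a b) (tperm c d) by move=> *; rewrite /same tpermV aC.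
have [a0 [a1 [a0B a1B ua]]] := pick2 zB B3; have [c0 [c1 [c0C c1C uc]]] := pick2 zC C3.
move: (ua) (uc); rewrite /= !inE !negb_or !andbT.
move=> /andP[/andP[za0 za1] a01] /andP[/andP[zc0 zc1] c01].
have zac : same (tperm z a0) (tperm z c0).
  case: (boolP [exists w, (w \in B) && (w \in C) && (w != z)]) => [/existsP[w]|].
    case/andP=> /andP[wB wC]; rewrite eq_sym => zw.
    by apply: (@same_trans _ (tperm z w)); [apply: sB | apply: sC].
  rewrite negb_exists => /forallP nw.
  have dBC x y : x \in B -> y \in C -> z != x -> x != y.
    move=> xB yC zx; apply: contraNneq (nw x) => xy; rewrite {2}xy xB yC /=.
    by rewrite eq_sym.
  have t1 := aB z a1 z a0 zB a1B zB a0B za1 za0.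
  have u1 := aC z c0 z c1 zC c0C zC c1C zc0 zc1.
  have [d00 d01 d10 d11] := And4 (dBC _ _ a0B c0C za0) (dBC _ _ a0B c1C za0)
    (dBC _ _ a1B c0C za1) (dBC _ _ a1B c1C za1).
  have e1 := groupJ (aC c0 c1 z c0 c0C c1C zC c0C c01 zc0) t1.
  have e2 := groupJ (aB a0 a1 z a1 a0B a1B zB a1B a01 za1) u1.
  have tz : (tperm z a1 * tperm z a0) z = a1 by rewrite permM tpermL tpermD.
  have uz : (tperm z c0 * tperm z c1) z = c0 by rewrite permM tpermL tpermD // eq_sym.
  have [tc0 tc1] : (tperm z a1 * tperm z a0) c0 = c0 /\ (tperm z a1 * tperm z a0) c1 = c1.
    by rewrite !permM !(tpermD zc0) ?(tpermD zc1).
  have [ta0 ta1] : (tperm z c0 * tperm z c1) a0 = a0 /\ (tperm z c0 * tperm z c1) a1 = a1.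
    by rewrite !permM !(tpermD za0) ?(tpermD za1) // eq_sym.
  move: e1 e2; rewrite !tperm2J tz uz tc0 tc1 ta0 ta1 => e1 e2.
  apply: (@same_trans _ (tperm a0 a1)); first by apply: sB.
  apply: (@same_trans _ (tperm c0 a1)); first by rewrite /same tpermV.
  apply: (@same_trans _ (tperm c0 c1)); last by apply: sC.
  by apply: same_sym; rewrite /same tpermV [tperm c0 a1]tpermC.
have base a b : a \in B :|: C -> b \in B :|: C -> a != b -> same (tperm a b) (tperm z a0).
  have base' x y : x \in B -> y \in C -> x != y -> same (tperm x y) (tperm z a0).
    move=> xB yC xy; have [zx|zx] := eqVneq z x.
      by rewrite -zx in xy *; apply: same_trans (same_sym zac); apply: sC.
    have [zy|zy] := eqVneq z y; first by rewrite -zy in xy *; apply: sB.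
    apply: (@same_trans _ (tperm x z)); last by apply: sB => //; rewrite eq_sym.
    have : same (tperm x z) (tperm z y).
      apply: (@same_trans _ (tperm z a0)); first by apply: sB => //; rewrite eq_sym.
      by apply: same_trans zac _; apply: sC.
    rewrite /same !tpermV; suff -> : tperm x y * tperm x z = tperm x z * tperm z y by [].
    by rewrite [LHS]conjgC tpermJ tpermL tpermD // eq_sym.
  rewrite !inE => /orP[aB'|aC'] /orP[bB'|bC'] ab.
  - by apply: sB.
  - exact: base'.
  - by rewrite tpermC; apply: base' => //; rewrite eq_sym.
  - by apply: same_trans (same_sym zac); apply: sC.
apply/alt_onP => a b c d aU bU cU dU ab cd.
by have := same_trans (base a b aU bU ab) (same_sym (base c d cU dU cd)); rewrite /same tpermV.
Qed.

(** Otherwise an element of [H] carries [B] to a different set meeting it, and [H] contains the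
    alternating group of the union. *)
Lemma maximal_alt_block A B : maxset (fun C : {set T} => alt_on C && (C \subset A)) B -> 2 < #|B| ->
  (forall h x, h \in H -> (h x \in A) = (x \in A)) -> block B.
Proof.
move=> mB B3 HA h x hH xB hxB y yB.
have /andP[aB sBA] := maxsetp mB.
have aU : alt_on (B :|: h @: B).
  apply: (alt_onU hxB) => //; first exact: imset_f.
    by rewrite card_imset //; apply: perm_inj.
  exact: alt_on_conj.
suff <- : B :|: h @: B = B by rewrite inE imset_f ?orbT.
apply: (maxsetsup mB); last exact: subsetUl.
rewrite aU subUset sBA; apply/subsetP=> _ /imsetP[z zB ->].
by rewrite HA // (subsetP sBA).
Qed.

Lemma alt_on_has_3cycle : has_3cycle H -> exists2 B, alt_on B & 2 < #|B|.
Proof.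
case=> a [b [c [u abc]]].
move: (u); rewrite /= !inE !negb_or !andbT => /andP[/andP[ab ac] bc].
exists [set x | x \in [:: a; b; c]]; last by rewrite cardsE (card_uniqP u).
have sab : same (tperm a b) (tperm a c) by rewrite /same tpermV.
have sbc : same (tperm a b) (tperm b c).
  rewrite /same tpermV; rewrite -groupV invMg !tpermV.
  suff -> : tperm b c * tperm a b = tperm a b * tperm a c by [].
  by rewrite [LHS]conjgC tpermJ tpermR tpermD.
have srefl g : same g g by rewrite /same mulgV.
have base x y : x \in [:: a; b; c] -> y \in [:: a; b; c] -> x != y -> same (tperm a b) (tperm x y).
  rewrite !inE => /or3P[]/eqP-> /or3P[]/eqP->; rewrite ?eqxx // => _ //.
  - by rewrite tpermC.
  - by rewrite [tperm c a]tpermC.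
  - by rewrite [tperm c b]tpermC.
apply/alt_onP => x y z w; rewrite !in_set => xU yU zU wU xy zw.
by have := same_trans (same_sym (base x y xU yU xy)) (base z w zU wU zw); rewrite /same tpermV.
Qed.

End Alternating.

(** * Primitivity of the group of closed walks *)

Section Primitivity.
Local Open Scope group_scope.
Variables (T : finType) (e : rel T).
Hypothesis e_sym : symmetric e.
Implicit Types (A B D : {set T}) (s t p q x y : T) (g h w : {perm T}) (L P Q R : seq T).

(** To move a token along the edge from [x] to [z], the blank first walks to [z] avoiding [x], then
    steps to [x], and returns to [p] avoiding [z]. *)
Lemma loops_transitive D p x y : biconn_in e D -> p \in D -> x \in D :\ p -> y \in D :\ p ->
  exists2 h, h \in loops e D p & h x = y.
Proof.
move=> [_ Dx] pD xDp yDp; have /connectP[L pL ->] := Dx p _ _ xDp yDp.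
elim: L x {y yDp} xDp pL => [|z L IH] x xDp /=.
  by move=> _; exists 1; rewrite ?perm1 ?group1.
case/andP=> /and3P[_ zDp exz] /(IH z zDp)[h hl hz].
have [zp zD] : z != p /\ z \in D by apply/andP; rewrite !inE in zDp.
have [xp xD] : x != p /\ x \in D by apply/andP; rewrite !inE in xDp.
suff [k kl kx] : exists2 k, k \in loops e D p & k x = z.
  by exists (k * h); rewrite ?groupM // permM kx.
have [->|xz] := eqVneq x z; first by exists 1; rewrite ?perm1 ?group1.
have [g1 w1 g1p] : exists2 g, walk e (D :\ x) p g & g p = z.
  by apply/walk_connect/Dx; rewrite !inE ?pD ?zD ?andbT // eq_sym.
have [g2 w2 g2x] : exists2 g, walk e (D :\ z) x g & g x = p.
  by apply/walk_connect/Dx; rewrite !inE ?pD ?xD ?andbT // eq_sym.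
exists (g1 * tperm z x * g2).
  apply/loopsP; split; last by rewrite !permM g1p tpermL g2x.
  apply: walkM; last first.
    by rewrite permM g1p tpermL; apply: walk_sub w2; apply: subsetDl.
  apply: walkM; first by apply: walk_sub w1; apply: subsetDl.
  by rewrite g1p; apply: walk_edge; rewrite /restr /= zD xD e_sym.
rewrite !permM (walk_out w1) ?inE ?eqxx // tpermR.
by rewrite (walk_out w2) // !inE eqxx.
Qed.

Lemma block_walk D p w B :
  walk e D p w -> block (loops_group e D p) B -> block (loops_group e D (w p)) (w @: B).
Proof.
move=> wp bB h _ hl /imsetP[x xB ->] /imsetP[x' x'B hx'] _ /imsetP[y yB ->].
have kl := loops_conj e_sym wp hl.
have kx : (w * h * w^-1) x \in B by rewrite !permM hx' permK.
have := bB _ x kl xB kx y yB; rewrite !permM => yB'.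
by rewrite -[h (w y)](permKV w) imset_f.
Qed.

Lemma path_restr_sub D B s L :
  path (restr e D) s L -> {subset s :: L <= B} -> path (restr e B) s L.
Proof.
elim: L s => [|x L IH] s //= /andP[/and3P[_ _ esx] pL] sub.
rewrite IH // ?andbT; last by move=> z zL; apply: sub; rewrite inE zL orbT.
by rewrite /restr /= !sub ?inE ?eqxx ?orbT.
Qed.

(** A cyclic permutation has a single orbit on its list. *)
Lemma cyc_stable_sub L B x : uniq L -> (forall z, z \in B -> cyc L z \in B) ->
  x \in L -> x \in B -> {subset L <= B}.
Proof.
move=> uL stable xL xB.
have [s1 [s2 EL]] : exists s1 s2 : seq T, L = s1 ++ x :: s2.
  exists (take (index x L) L), (drop (index x L).+1 L).
  by rewrite -drop_index // cat_take_drop.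
rewrite EL in uL stable *.
have uL' : uniq (x :: s2 ++ s1) by rewrite -cat_cons uniq_catC.
have {}stable z : z \in B -> cyc (x :: s2 ++ s1) z \in B.
  by move=> /stable; have /= <- := cyc_catC uL.
suff H : forall post pre a, x :: s2 ++ s1 = pre ++ a :: post -> a \in B -> {subset post <= B}.
  have {}H := H _ [::] x erefl xB => z.
  rewrite mem_cat inE => /or3P[zs|/eqP->//|zs]; apply: H; rewrite mem_cat zs ?orbT //.
elim=> [|b post IH] pre a E aB z //.
have bB : b \in B.
  by have := stable a aB; rewrite E cyc_next // -E.
rewrite inE => /predU1P[->//|]; apply: (IH (rcons pre a) b) => //.
by rewrite cat_rcons.
Qed.

(** For each of the three cycles of the theta graph, a block containing the far branch vertex [t]
    either is inside the cycle or contains it, apart from [s]: a vertex outside the cycle is fixed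
    by its rotation. It cannot be inside all three, as these only have [s] and [t] in common. *)
Lemma block_theta D s t P Q R B : theta e D s t P Q R -> block (loops_group e D s) B ->
  t \in B -> 1 < #|B| ->
  exists P' Q' R', theta e D s t P' Q' R' /\ {subset t :: P' ++ Q' <= B}.
Proof.
move=> th bB tB B1.
have dich P' Q' R' : theta e D s t P' Q' R' ->
  {subset B <= t :: P' ++ Q'} \/ {subset t :: P' ++ Q' <= B}.
  move=> th'; have cl := theta_cycle e_sym th'.
  have u : uniq (rcons P' t ++ rev Q') by case: th' => u _ _; uniq_by u.
  have Em z : (z \in t :: P' ++ Q') = (z \in rcons P' t ++ rev Q').
    by rewrite !(mem_cat, inE, mem_rcons, mem_rev) orbA.
  case: (boolP [exists z, (z \in B) && (z \notin t :: P' ++ Q')]) => [/existsP[z]|nz].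
    rewrite Em => /andP[zB zL]; right => y; rewrite Em; move: y.
    apply: (@cyc_stable_sub _ _ t) => //; last by rewrite -Em mem_head.
    by move=> x xB; apply: (bB _ z cl zB) => //; rewrite cyc_out.
  left=> z zB; move: nz; rewrite negb_exists => /forallP/(_ z).
  by rewrite zB negbK.
have th2 := thetaC' th; have th3 := thetaC' (thetaC th).
case: (dich _ _ _ th) => [sPQ|sPQ]; last by exists P, Q, R.
case: (dich _ _ _ th2) => [sPR|sPR]; last by exists P, R, Q.
case: (dich _ _ _ th3) => [sQR|sQR]; last by exists Q, R, P.
have [x xB xt] : exists2 x, x \in B & x != t.
  have : 0 < #|B :\ t| by move: B1; rewrite (cardsD1 t) tB.
  by case/card_gt0P=> x; rewrite !inE => /andP[]; exists x.
exfalso; case: th => u _ _.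
have {u}: uniq (P ++ Q ++ R) by uniq_by u.
have := sPQ _ xB; have := sPR _ xB; have := sQR _ xB.
rewrite !inE (negbTE xt) !mem_cat /= !cat_uniq => a b c /and3P[_ /hasPn H1 /and3P[_ /hasPn H2 _]].
move: (H1 x) (H2 x); rewrite mem_cat /=; move: a b c.
by case: (x \in P); case: (x \in Q); case: (x \in R) => //= _ _ _; do ?[move=> /(_ isT)//];
   move=> _ /(_ isT).
Qed.

(** Let [K] be the component of [s] in the graph on [B] and [s]; it has at least three vertices
    since the block contains one of the three cycles up to [s]. If [K] is not everything, take an
    ear of [K] from [u] to [w], walk the blank inside [K] to [u], and rotate the cycle formed by
    the ear and a path of [K]. This moves the token on [w] out of the block, onto the ear, but
    keeps another one in it: the neighbour of [u] on the path if there are further vertices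
    before [w], a third vertex of [K] outside the cycle otherwise. *)
Lemma block_full_core D s t P Q R B : biconn_in e D -> theta e D s t P Q R ->
  B \subset D :\ s -> 1 < #|B| -> t \in B -> block (loops_group e D s) B -> B = D :\ s.
Proof.
move=> bD th sBD B1 tB bB.
have sD : s \in D.
  have [_ [+ _ _] _] := th.
  by case: (P) => [|z P'] /= /andP[/and3P[]].
have [P' [Q' [R' [th' sPQ]]]] := block_theta th bB tB B1.
pose U := s |: B; pose K := [set x | connect (restr e U) s x].
have sU : s \in U by rewrite setU11.
have sUD : U \subset D by rewrite subUset sub1set sD (subset_trans sBD) ?subsetDl.
have sKU : K \subset U by apply/subsetP=> x; rewrite inE => /connect_restr_in; apply.
have sK : s \in K by rewrite inE connect0.
have K3 : 2 < #|K|.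
  have [u [pP pQ _] [sz _ _]] := th'.
  have inK L : path (restr e D) s (rcons L t) -> {subset L <= t :: P' ++ Q'} ->
      {subset t :: L <= K}.
    move=> pL sL x xL; rewrite inE.
    have pU : path (restr e U) s (rcons L t).
      apply: path_restr_sub pL _ => z; rewrite inE mem_rcons => /predU1P[->//|zL].
      rewrite inE; apply/orP; right; apply: sPQ.
      by move: zL; rewrite inE => /predU1P[->|/sL//]; rewrite mem_head.
    by apply: (path_connect pU); rewrite inE mem_rcons xL orbT.
  have kP := inK P' pP _; have kQ := inK Q' pQ _.
  have [z [zK zs zt]] : exists z, [/\ z \in K, z != s & z != t].
    have sub1 : {subset P' <= t :: P' ++ Q'} by move=> z zP; rewrite inE mem_cat zP orbT.
    have sub2 : {subset Q' <= t :: P' ++ Q'} by move=> z zQ; rewrite inE mem_cat zQ !orbT.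
    have := kP sub1; have := kQ sub2 => {kP kQ} kQ kP.
    have [z zPQ] : exists z, z \in P' ++ Q'.
      by case: (P') sz => [|z ?]; [case: (Q') => [|z ?] // _|move=> _]; exists z; rewrite mem_head.
    have zK : z \in K.
      by move: zPQ; rewrite mem_cat => /orP[zP|zQ]; [apply: kP | apply: kQ];
        rewrite inE ?zP ?zQ orbT.
    have {}u : uniq (s :: t :: P' ++ Q') by uniq_by u.
    exists z; split=> //; apply: contraTneq zPQ => ->; move: u; rewrite /= inE negb_or.
      by case/and3P=> /andP[_ ->].
    by case/and3P.
  have tK : t \in K by apply: (kP _ t (mem_head _ _)) => y yP; rewrite inE mem_cat yP orbT.
  have st : s != t by case/andP: u; rewrite inE negb_or => /andP[].
  have : #|[set s; t; z]| <= #|K|.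
    by apply/subset_leq_card/subsetP=> x; rewrite in_setU in_set2 in_set1 => /orP[/orP[]|] /eqP->.
  by rewrite setUC cardsU1 cards2 !inE st negb_or zs zt.
have [KD|nKD] := eqVneq K D.
  apply/eqP; rewrite eqEsubset sBD /=; apply/subsetP=> x; rewrite !inE => /andP[xs].
  by rewrite -KD => /(subsetP sKU); rewrite !inE (negbTE xs).
exfalso.
have sKD := subset_trans sKU sUD.
have [u [w [E [[uK wK uw nE] [uE EK pE]]]]] := ear e_sym bD sKD nKD (ltnW K3).
have [g1 wg1 g1s] : exists2 g, walk e U s g & g s = u by apply: walk_connect; rewrite inE in uK.
pose C := g1 @: B.
have memC x : (x \in C) = (x \in U :\ u).
  rewrite -[x](permKV g1) mem_imset; last exact: perm_inj.
  move: (g1^-1 x) => y; rewrite !inE -g1s (inj_eq perm_inj).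
  have := walk_stable e_sym y wg1; rewrite !inE => ->.
  have [->|//] := eqVneq y s; apply/negbTE; apply/negP=> /(subsetP sBD).
  by rewrite !inE eqxx.
have bC : block (loops_group e D u) C.
  by rewrite -g1s; apply: block_walk bB; apply: walk_sub wg1.
have symU := sym_connect_sym (restr_sym U e_sym).
have [L pL [uL lw]] : exists2 L, path (restr e U) u L & uniq (u :: L) /\ w = last u L.
  have : connect (restr e U) u w by move: uK wK; rewrite !inE symU; apply: connect_trans.
  by case/connectP=> L0 pL0 ->; case/shortenP: pL0 => L pL uL _; exists L.
have {}LK : {subset u :: L <= K}.
  move=> x xL; rewrite inE; rewrite inE in uK; apply: connect_trans uK _.
  exact: (path_connect pL).
have [E' [e1 EE]] : exists E' e1, E = rcons E' e1.
  by case: (lastP E) nE => [|E' e1] // _; exists E', e1.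
have [L' EL] : exists L', L = rcons L' w.
  case: (lastP L) lw uw => [-> |L' z]; first by rewrite eqxx.
  by rewrite last_rcons => -> _; exists L'.
have uC : uniq (u :: L ++ rev E).
  rewrite -cat_cons cat_uniq uL rev_uniq uE andbT; apply/hasPn => z; rewrite mem_rev => /EK.
  by rewrite inE => /andP[zK _]; apply: contra zK => /LK.
have cl : cyc (L ++ rev E) \in loops e D u.
  apply: loops_cycle => //; first by rewrite EL; case: (L').
  rewrite rcons_cat cat_path (sub_path (restr_sub sUD) pL) -lw.
  have := rev_path (restr e D) u (rcons E w); rewrite last_rcons belast_rcons rev_cons => ->.
  by rewrite (eq_path (e' := restr e D)) // => x y; rewrite restr_sym.
have cw : cyc (L ++ rev E) w = e1.
  rewrite EL EE rev_rcons cat_rcons; apply: cyc_next.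
  by move: uC; rewrite EL EE rev_rcons cat_rcons => /andP[].
have e1K : e1 \notin K.
  by have := EK e1; rewrite EE mem_rcons mem_head inE => /(_ isT)/andP[].
have e1U : e1 \notin U.
  apply: contra e1K => e1U; have := wK; rewrite !inE => /connect_trans; apply.
  apply: connect1; rewrite /restr /= e1U (subsetP sKU) //=.
  move: pE; rewrite EE rcons_path last_rcons => /andP[_ /and3P[_ _]].
  by rewrite e_sym.
have wC : w \in C by rewrite memC in_setD1 eq_sym uw (subsetP sKU).
suff [x xC cxC] : exists2 x, x \in C & cyc (L ++ rev E) x \in C.
  have := bC _ x cl xC cxC w wC; rewrite cw memC in_setD1 (negbTE e1U) andbF //.
case: (L) EL uL uC LK {pL cl cw lw} => [|y1 [|y2 L2]] EL uL uC LK; first by case: (L') EL.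
  have [x xK [xu xw]] : exists2 x, x \in K & x != u /\ x != w.
    have : 0 < #|K :\ u :\ w|.
      by move: K3; rewrite (cardsD1 u) uK (cardsD1 w (K :\ u)) in_setD1 eq_sym uw wK !add1n.
    by case/card_gt0P=> x; rewrite !in_setD1 => /and3P[xw xu xK]; exists x.
  have xC : x \in C by rewrite memC in_setD1 xu (subsetP sKU).
  exists x => //; rewrite cyc_out // mem_cat mem_rev negb_or.
  have -> : y1 = w by case: (L') EL => [[]//|? [|]].
  rewrite inE xw /=; apply/negP=> /EK; rewrite inE => /andP[/negP]; by [].
have y1K : y1 \in K by apply: LK; rewrite !inE eqxx orbT.
have y2K : y2 \in K by apply: LK; rewrite !inE eqxx !orbT.
move: (uL); rewrite /= !inE !negb_or => /and3P[/and3P[uy1 uy2 _] _ _].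
exists y1; first by rewrite memC in_setD1 eq_sym uy1 (subsetP sKU).
rewrite (@cyc_next _ [::]); first by rewrite memC in_setD1 eq_sym uy2 (subsetP sKU).
by case/andP: uC.
Qed.

(** Walk the blank to [s] and bring a point of the block to [t]. *)
Lemma block_full D p s t P Q R B : biconn_in e D -> theta e D s t P Q R -> p \in D ->
  B \subset D :\ p -> 1 < #|B| -> block (loops_group e D p) B -> B = D :\ p.
Proof.
move=> bD th pD sBD B1 bB.
have [sD tD] : s \in D /\ t \in D.
  have [_ [+ _ _] _] := th.
  move=> pP; split; last by apply: (path_restr_in pP); rewrite mem_rcons mem_head.
  by case: (P) pP => [|z P'] /= /andP[/and3P[]].
have st : t != s by case: th => /andP[]; rewrite inE negb_or eq_sym => /andP[].
have [w wp ws] := walk_connect (bD.1 _ _ pD sD).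
have [b bBB] : exists b, b \in B by apply/card_gt0P; lia.
have wbD : w b \in D :\ s.
  have := subsetP sBD _ bBB; rewrite !inE => /andP[bp bD']; rewrite -ws (inj_eq perm_inj) bp.
  by rewrite (walk_stable e_sym _ wp).
have [|h hl hb] := loops_transitive bD sD wbD (y := t); first by rewrite !inE st.
have /loopsP[wh hs] := hl.
have wwh : walk e D p (w * h) by apply: walkM => //; rewrite ws.
have whp : (w * h) p = s by rewrite permM ws.
have im : (w * h) @: B = D :\ s.
  apply: (block_full_core bD th).
  - apply/subsetP=> _ /imsetP[x /(subsetP sBD) + ->]; rewrite !inE => /andP[xp xD].
    by rewrite -whp (inj_eq perm_inj) xp (walk_stable e_sym _ wwh).
  - by rewrite card_imset //; apply: perm_inj.
  - by rewrite -hb -permM imset_f.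
  - by rewrite -whp; apply: block_walk.
apply/eqP; rewrite eqEcard sBD.
have := cardsD1 p D; have := cardsD1 s D; rewrite -im card_imset ?pD ?sD; last exact: perm_inj.
by lia.
Qed.

End Primitivity.

(** * Theta subgraphs of a 2-connected graph *)

Ltac theta_by s t P Q R uE edges pE :=
  exists s, t, P, Q, R; split;
  [split; [uniq_by uE | by rewrite /= ?edges ?pE | split; rewrite /= ?addn0 ?addn_gt0 ?orbT]
  | rewrite /sizes122 /= ?andbF].

Section Thetas.
Variables (T : finType) (e : rel T).
Hypotheses (e_sym : symmetric e) (e_irr : irreflexive e).
Implicit Types (D K : {set T}) (s t u w x y : T) (c P Q R E : seq T).

Definition good_theta D := exists s t P Q R, theta e D s t P Q R /\ ~~ sizes122 P Q R.

(** An isomorphism of [G] with the induced subgraph on [D]. *)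
Definition is_copy (G : sgraph) D := exists f : G -> T,
  [/\ injective f, forall y, y \in D <-> exists x : G, f x = y
    & forall x y : G, e (f x) (f y) = edge x y].

Definition exceptional_on D :=
  (3 < #|D| /\ is_copy (cycle_graph #|D|) D) \/ is_copy theta0 D.

Lemma restr_revpath D u w E :
  path (restr e D) u (rcons E w) -> path (restr e D) w (rcons (rev E) u).
Proof.
have := rev_path (restr e D) u (rcons E w); rewrite last_rcons belast_rcons rev_cons => ->.
by rewrite (eq_path (e' := restr e D)) // => x y; rewrite restr_sym.
Qed.

(** Up to the symmetries there are eight pairs of ends. Except for [s] and [t], one theta graph
    serves for every length of [E]: either it consists of a cycle and an ear with adjacent ends, so
    that one of its paths is empty, or the ends split the 6-cycle into arcs with 1 and 3 inner
    vertices. *)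
Lemma theta0_ear D (s t a b1 b2 c1 c2 u w : T) E :
    theta e D s t [:: a] [:: b1; b2] [:: c1; c2] ->
    let K := [:: s; t; a; b1; b2; c1; c2] in
    u \in K -> w \in K -> u != w -> uniq E -> {in E, forall y, y \notin K} ->
    path (restr e D) u (rcons E w) ->
    (E = [::] -> ((u, w) \notin
      [:: (s, a); (a, t); (s, b1); (b1, b2); (b2, t); (s, c1); (c1, c2); (c2, t)]) &&
      ((w, u) \notin
      [:: (s, a); (a, t); (s, b1); (b1, b2); (b2, t); (s, c1); (c1, c2); (c2, t)])) ->
  good_theta D.
Proof.
case=> u7 [pa pb pc] _ K.
have {}u7 : uniq K by uniq_by u7.
move: pa pb pc; rewrite /= !andbT => /andP[sa at_] /and3P[sb bb bt] /and3P[sc cc ct].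
have rs x y : restr e D x y -> restr e D y x by rewrite restr_sym.
have [as_ ta bs bb' tb] := And5 (rs _ _ sa) (rs _ _ at_) (rs _ _ sb) (rs _ _ bb) (rs _ _ bt).
have [cs cc' tc] := And3 (rs _ _ sc) (rs _ _ cc) (rs _ _ ct).
pose edges := [:: (s, a); (a, t); (s, b1); (b1, b2); (b2, t); (s, c1); (c1, c2); (c2, t)].
pose good u w := forall E, uniq E -> {in E, forall y, y \notin K} ->
    path (restr e D) u (rcons E w) -> (E = [::] -> ((u, w) \notin edges) && ((w, u) \notin edges)) ->
  good_theta D.
have good_sym x y : good x y -> good y x.
  move=> gxy E0 uE EK pE nE; apply: (gxy (rev E0)).
  - by rewrite rev_uniq.
  - by move=> z; rewrite mem_rev; apply: EK.
  - exact: restr_revpath.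
  - by move=> /(congr1 rev); rewrite revK => /nE; rewrite andbC.
have goodI x y : (forall E, uniq (K ++ E) -> path (restr e D) x (rcons E y) ->
    (0 < size E) || ((x, y) \notin edges) && ((y, x) \notin edges) -> good_theta D) -> good x y.
  move=> H E0 uE EK pE nE; apply: (H E0) => //.
    by rewrite cat_uniq u7 uE andbT; apply/hasPn=> z /EK.
  by case: (E0) nE => [|//] /(_ erefl).
have edge_path := (sa, at_, sb, bb, bt, sc, cc, ct, as_, ta, bs, bb', tb, cs, cc', tc).
have gst : good s t.
  apply: goodI => F uE pE _; have [E1|E1] := eqVneq (size F) 1.
    by theta_by s t [:: a] F [:: b1; b2] uE edge_path pE; rewrite ?E1.
  by theta_by s t [:: b1; b2] [:: c1; c2] F uE edge_path pE.
have gsa : good s a.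
  apply: goodI => F uE pE; rewrite !inE !eqxx ?orbT /= ?andbF orbF => E0.
  by theta_by s a (@nil T) F [:: b1; b2; t] uE edge_path pE.
have gat : good a t.
  apply: goodI => F uE pE; rewrite !inE !eqxx ?orbT /= ?andbF orbF => E0.
  by theta_by a t (@nil T) F [:: s; b1; b2] uE edge_path pE.
have gsb1 : good s b1.
  apply: goodI => F uE pE; rewrite !inE !eqxx ?orbT /= ?andbF orbF => E0.
  by theta_by s b1 (@nil T) F [:: a; t; b2] uE edge_path pE.
have gsc1 : good s c1.
  apply: goodI => F uE pE; rewrite !inE !eqxx ?orbT /= ?andbF orbF => E0.
  by theta_by s c1 (@nil T) F [:: a; t; c2] uE edge_path pE.
have gb2t : good b2 t.
  apply: goodI => F uE pE; rewrite !inE !eqxx ?orbT /= ?andbF orbF => E0.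
  by theta_by b2 t (@nil T) F [:: b1; s; a] uE edge_path pE.
have gc2t : good c2 t.
  apply: goodI => F uE pE; rewrite !inE !eqxx ?orbT /= ?andbF orbF => E0.
  by theta_by c2 t (@nil T) F [:: c1; s; a] uE edge_path pE.
have gb1b2 : good b1 b2.
  apply: goodI => F uE pE; rewrite !inE !eqxx ?orbT /= ?andbF orbF => E0.
  by theta_by b1 b2 (@nil T) F [:: s; a; t] uE edge_path pE.
have gc1c2 : good c1 c2.
  apply: goodI => F uE pE; rewrite !inE !eqxx ?orbT /= ?andbF orbF => E0.
  by theta_by c1 c2 (@nil T) F [:: s; a; t] uE edge_path pE.
have gsb2 : good s b2.
  by apply: goodI => F uE pE _; theta_by s b2 [:: b1] [:: c1; c2; t] F uE edge_path pE.
have gsc2 : good s c2.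
  by apply: goodI => F uE pE _; theta_by s c2 [:: c1] [:: b1; b2; t] F uE edge_path pE.
have gtb1 : good t b1.
  by apply: goodI => F uE pE _; theta_by t b1 [:: b2] [:: c2; c1; s] F uE edge_path pE.
have gtc1 : good t c1.
  by apply: goodI => F uE pE _; theta_by t c1 [:: c2] [:: b2; b1; s] F uE edge_path pE.
have gab1 : good a b1.
  by apply: goodI => F uE pE _; theta_by s b1 (@nil T) (a :: F) [:: c1; c2; t; b2] uE edge_path pE.
have gac1 : good a c1.
  by apply: goodI => F uE pE _; theta_by s c1 (@nil T) (a :: F) [:: b1; b2; t; c2] uE edge_path pE.
have gab2 : good a b2.
  by apply: goodI => F uE pE _; theta_by t b2 (@nil T) (a :: F) [:: c2; c1; s; b1] uE edge_path pE.
have gac2 : good a c2.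
  by apply: goodI => F uE pE _; theta_by t c2 (@nil T) (a :: F) [:: b2; b1; s; c1] uE edge_path pE.
have gb1c1 : good b1 c1.
  by apply: goodI => F uE pE _; theta_by b1 c1 [:: s] [:: b2; t; c2] F uE edge_path pE.
have gb2c2 : good b2 c2.
  by apply: goodI => F uE pE _; theta_by b2 c2 [:: t] [:: b1; s; c1] F uE edge_path pE.
have gc2b1 : good c2 b1.
  apply: goodI => F uE pE _.
  by theta_by s b1 (@nil T) [:: c1, c2 & F] [:: a; t; b2] uE edge_path pE.
have gc1b2 : good c1 b2.
  apply: goodI => F uE pE _.
  by theta_by t b2 (@nil T) [:: c2, c1 & F] [:: a; s; b1] uE edge_path pE.
move=> uK wK uw uE EK pE nE; suff H : good u w by apply: (H E).
move: uK wK uw; rewrite !inE.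
do 6?[case/orP]; move=> /eqP-> ; do 6?[case/orP]; move=> /eqP->; rewrite ?eqxx //= => _;
  first [assumption | by apply: good_sym].
Qed.

Lemma next_nth_mod (x0 : T) c i : uniq c -> i < size c ->
  next c (nth x0 c i) = nth x0 c (i.+1 %% size c).
Proof.
move=> uc ic; rewrite next_nth mem_nth // index_uniq //.
case: c uc ic => [|y c] //= uc ic; move: (ic); rewrite ltnS leq_eqVlt => /predU1P[->|ilt].
  by rewrite modnn nth_default.
by rewrite modn_small //= (set_nth_default x0).
Qed.

(** An ear [R] of a cycle, or a chord if [R] is empty, gives a theta graph. *)
Lemma cycle_theta D c u w R : uniq c -> path.cycle (restr e D) c -> 2 < size c ->
    u \in c -> w \in c -> u != w -> uniq R -> {in R, forall y, y \notin c} ->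
    path (restr e D) u (rcons R w) -> (R = [::] -> next c u != w /\ next c w != u) ->
  exists P Q, theta e D u w P Q R.
Proof.
move=> uc cc c3 uc' wc uw uR Rc pR nR; have [i c' Ec] := rot_to uc'.
have uc2 : uniq (u :: c') by rewrite -Ec rot_uniq.
have wc2 : w \in c'.
  by have := wc; rewrite -(mem_rot i) Ec inE eq_sym (negbTE uw).
have sc : size c = (size c').+1 by rewrite -(size_rot i) Ec.
have cc2 : path.cycle (restr e D) (u :: c') by rewrite -Ec rot_cycle.
have nc : next (u :: c') =1 next c by move=> x; rewrite -Ec next_rot.
have Rc2 : {in R, forall y, y \notin u :: c'} by move=> y /Rc; rewrite -Ec mem_rot.
case/splitPr: wc2 uc2 sc cc2 nc Rc2 {Ec} => P Q uc2 sc cc2 nc Rc2.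
have uK : uniq ((u :: P ++ w :: Q) ++ R).
  by rewrite cat_uniq uc2 uR andbT; apply/hasPn => z /Rc2.
exists P, (rev Q); split; first by uniq_by uK.
  move: cc2; rewrite /= rcons_cat -cat_rcons cat_path last_rcons => /andP[-> pQ].
  by rewrite pR restr_revpath.
rewrite size_cat /= in sc; rewrite size_rev; split; first by lia.
  case: (posnP (size P + size R)) => // /eqP; rewrite addn_eq0 !size_eq0 => /andP[/eqP P0 /eqP R0].
  by have [] := nR R0; rewrite -nc P0 /= eqxx eqxx.
case: (posnP (size Q + size R)) => // /eqP; rewrite addn_eq0 !size_eq0 => /andP[/eqP Q0 /eqP R0].
have [_] := nR R0; rewrite -nc Q0 cats1 -rcons_cons -(next_rotr 1); last first.
  by rewrite rcons_cons -cats1 -Q0.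
by rewrite rotr1_rcons /= eqxx eqxx.
Qed.

Lemma exists_cycle D : biconn_in e D -> 2 < #|D| ->
  exists c, [/\ uniq c, path.cycle (restr e D) c & 2 < size c].
Proof.
move=> bD D3.
have [x xD] : exists x, x \in D by apply/card_gt0P; lia.
have [z zD xz] : exists2 z, z \in D & z \notin [set x].
  by apply/subsetPn; apply: contraTN D3 => /subset_leq_card; rewrite cards1; lia.
have [u [w [ux wx uw]]] := connect_exit (bD.1 _ _ xD zD) (set11 x) xz.
have uw' : u != w by apply: contraNneq wx => <-.
have Ksub : [set u; w] \subset D.
  by case/and3P: uw => uD wD _; rewrite subUset !sub1set uD.
have Kcard : #|[set u; w]| = 2 by rewrite cards2 uw'.
have Kn : [set u; w] != D by apply: contraTneq D3 => <-; rewrite Kcard.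
have K2 : 1 < #|[set u; w]| by rewrite Kcard.
have [u1 [w1 [E [[u1K w1K uw1 nE] [uE EK pE]]]]] := ear e_sym bD Ksub Kn K2.
have w1u1 : restr e D w1 u1.
  move: u1K w1K uw1; rewrite !inE => /orP[]/eqP-> /orP[]/eqP->; rewrite ?eqxx // => _.
  by rewrite restr_sym.
exists (u1 :: rcons E w1); split.
- rewrite cons_uniq rcons_uniq uE andbT mem_rcons inE negb_or uw1 /=.
  apply/andP; split; apply/negP=> /EK.
    by rewrite inE u1K.
  by rewrite inE w1K.
- by rewrite /= rcons_path pE last_rcons.
- by rewrite /= size_rcons; case: (E) nE.
Qed.

Lemma hamiltonian_copy D c : uniq c -> path.cycle (restr e D) c -> c =i D ->
    {in D &, forall x y, e x y -> (next c x == y) || (next c y == x)} ->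
  is_copy (cycle_graph #|D|) D.
Proof.
move=> uc cc cD nochord.
have sc : size c = #|D| by rewrite -(card_uniqP uc); apply: eq_card.
have [x0 _|c0] := pickP (mem c); last first.
  have D0 : #|D| = 0 by apply: eq_card0 => x; rewrite -cD -[LHS]/(mem c x) c0.
  have no (i : 'I_#|D|) : False by have := ltn_ord i; rewrite {2}D0.
  exists (fun i : 'I_#|D| => match no i with end).
  split=> [i|y|i]; try by case: (no i).
  by split=> [yD|[i]]; [have := c0 y; rewrite /= cD yD | case: (no i)].
have lt (i : 'I_#|D|) : i < size c by rewrite sc.
exists (fun i : 'I_#|D| => nth x0 c i); split.
- by move=> i j /eqP; rewrite nth_uniq // => /eqP/val_inj.
- move=> y; split=> [yD|[i <-]]; last by rewrite -cD mem_nth.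
  have yc : y \in c by rewrite cD.
  have il : index y c < #|D| by rewrite -sc index_mem.
  by exists (Ordinal il); rewrite /= nth_index.
move=> i j; rewrite /edge /= /rel_edge /=.
have nx (k : 'I_#|D|) : next c (nth x0 c k) = nth x0 c (k.+1 %% #|D|).
  by rewrite next_nth_mod ?sc.
have mlt k : k %% #|D| < size c by rewrite sc ltn_mod; apply: leq_ltn_trans (ltn_ord i).
apply/idP/idP => [eij|/andP[_]].
  have ij : i != j by apply: contraTneq eij => ->; rewrite e_irr.
  rewrite ij /=; have := nochord _ _ _ _ eij; rewrite -!cD !mem_nth // => /(_ isT isT).
  by rewrite !nx !nth_uniq // ![_ %% _ == _]eq_sym.
have H (k l : 'I_#|D|) : l == k.+1 %% #|D| :> nat -> e (nth x0 c k) (nth x0 c l).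
  move=> /eqP->; rewrite -nx; have /and3P[] // : restr e D (nth x0 c k) (next c (nth x0 c k)).
  by apply: next_cycle cc _; apply: mem_nth.
by case/orP=> /H //; rewrite e_sym.
Qed.

Lemma theta0_copy D (s t a b1 b2 c1 c2 : T) :
    theta e D s t [:: a] [:: b1; b2] [:: c1; c2] ->
    D =i [:: s; t; a; b1; b2; c1; c2] ->
    {in D &, forall x y, e x y ->
      ((x, y) \in [:: (s, a); (a, t); (s, b1); (b1, b2); (b2, t); (s, c1); (c1, c2); (c2, t)]) ||
      ((y, x) \in [:: (s, a); (a, t); (s, b1); (b1, b2); (b2, t); (s, c1); (c1, c2); (c2, t)])} ->
  is_copy theta0 D.
Proof.
case=> u7 [pa pb pc] _ DK noedge.
move: pa pb pc; rewrite /= !andbT => /andP[sa at_] /and3P[sb bb bt] /and3P[sc cc ct].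
pose K := [:: s; b1; b2; t; c2; c1; a].
have uK : uniq K by uniq_by u7.
have DK' : D =i K by move=> x; rewrite DK !inE; do 7!case: eqP => //=.
pose F i := nth s K i.
pose idx := [:: (0, 6); (6, 3); (0, 1); (1, 2); (2, 3); (0, 5); (5, 4); (4, 3)].
have Fidx i j : i < 7 -> j < 7 -> ((F i, F j) \in [seq (F p.1, F p.2) | p <- idx]) = ((i, j) \in idx).
  move=> i7 j7; apply/mapP/idP => [[[k l] kl /= [/eqP Ek /eqP El]]|ij]; last by exists (i, j).
  have [k7 l7] : k < 7 /\ l < 7.
    by have /allP/(_ _ kl)/andP := (isT : all (fun p => (p.1 < 7) && (p.2 < 7)) idx).
  by move: Ek El; rewrite /F !nth_uniq // => /eqP-> /eqP->.
have eidx i j : (i, j) \in idx -> e (F i) (F j).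
  move=> ij; suff: restr e D (F i) (F j) by case/and3P.
  by move: ij; rewrite !inE; do 7?[case/orP]; move=> /eqP[-> ->].
have edgeE (i j : 'I_7) : edge (i : theta0) j = ((val i, val j) \in idx) || ((val j, val i) \in idx).
  by case: i j => [[|[|[|[|[|[|[|i]]]]]]] // ?] [[|[|[|[|[|[|[|j]]]]]]] // ?].
exists (fun i : 'I_7 => F i); split.
- by move=> i j /eqP; rewrite nth_uniq // => /eqP/val_inj.
- move=> y; rewrite DK'; split=> [yK|[i <-]]; last exact: mem_nth.
  have il : index y K < 7 by rewrite index_mem.
  by exists (Ordinal il); rewrite /F /= nth_index.
move=> i j; rewrite edgeE; apply/idP/idP => [eij|/orP[/eidx//|/eidx]]; last by rewrite e_sym.
have lt7 (k : 'I_7) : val k < 7 by exact: ltn_ord.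
rewrite -!Fidx ?lt7 //.
by apply: noedge => //; rewrite DK'; apply: mem_nth; apply: lt7.
Qed.

End Thetas.

Section ThetaExistence.
Variables (T : finType) (e : rel T).
Hypotheses (e_sym : symmetric e) (e_irr : irreflexive e).
Implicit Types (D K : {set T}) (s t u w x y : T) (c P Q R E : seq T).

(** A cycle with an ear or a chord is a theta graph. If it is [theta0], then so is the whole graph,
    unless there is a further ear or edge. *)
Lemma theta_or_exceptional D : biconn_in e D -> 3 < #|D| -> good_theta e D \/ exceptional_on e D.
Proof.
move=> bD D4; have [c [uc cc c3]] := exists_cycle e_sym bD (ltnW D4).
have cD : {subset c <= D} by move=> x /(next_cycle cc)/and3P[].
suff : (exists s t P Q R, theta e D s t P Q R) \/ exceptional_on e D.
  case=> [[s [t [P [Q [R th]]]]]|]; last by right.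
  case: (boolP (sizes122 P Q R)) => [s122|ns]; last by left; exists s, t, P, Q, R.
  have [a [b1 [b2 [c1 [c2 {}th]]]]] : exists a b1 b2 c1 c2 : T,
      theta e D s t [:: a] [:: b1; b2] [:: c1; c2].
    have H A B C : theta e D s t A B C -> [&& size A == 1, size B == 2 & size C == 2] ->
        exists a b1 b2 c1 c2 : T, theta e D s t [:: a] [:: b1; b2] [:: c1; c2].
      case: A B C => [|a [|]] // [|b1 [|b2 [|]]] // [|c1 [|c2 [|]]] // th' _.
      by exists a, b1, b2, c1, c2.
    case/or3P: s122 => [|/and3P[P2 Q1 R2]|/and3P[P2 Q2 R1]]; first exact: H.
      by apply: H (thetaC th) _; rewrite P2 Q1 R2.
    by apply: H (thetaC (thetaC' th)) _; rewrite P2 Q2 R1.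
  pose K := [:: s; t; a; b1; b2; c1; c2].
  have sK : {subset K <= D}.
    have [_ [pa pb pc] _] := th.
    move: pa pb pc; rewrite /= => /and3P[/and3P[sD aD _] /and3P[_ tD _] _].
    case/and4P=> /and3P[_ b1D _] /and3P[_ b2D _] _ _ /and4P[/and3P[_ c1D _] /and3P[_ c2D _] _ _].
    by move=> x; rewrite !inE; do 6?[case/orP]; move=> /eqP->.
  have uK : uniq K by case: th => u _ _; uniq_by u.
  pose KS := [set x in K].
  have KSD : KS \subset D by apply/subsetP=> x; rewrite inE => /sK.
  have [KD|nKD] := eqVneq KS D.
    pose edges := [:: (s, a); (a, t); (s, b1); (b1, b2); (b2, t); (s, c1); (c1, c2); (c2, t)].
    case: (boolP [exists x in D, exists y in D,
      [&& e x y, (x, y) \notin edges & (y, x) \notin edges]]).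
      case/exists_inP=> x xD /exists_inP[y yD /and3P[exy n1 n2]]; left.
      have xy : x != y by apply: contraTneq exy => ->; rewrite e_irr.
      have [xK yK] : x \in K /\ y \in K by rewrite -KD !inE in xD yD *.
      apply: (theta0_ear e_sym th xK yK xy (E := [::])) => //; last by rewrite n1 n2.
      by rewrite /= /restr /= xD yD exy.
    move=> ne; right; right; apply: (theta0_copy e_sym th).
      by move=> x; rewrite -KD inE.
    move=> x y xD yD exy; apply: contraR ne; rewrite negb_or => /andP[n1 n2].
    by apply/exists_inP; exists x => //; apply/exists_inP; exists y => //; rewrite exy n1.
  left; have KS2 : 1 < #|KS| by rewrite cardsE (card_uniqP uK).
  have [u [w [E [[uK' wK uw nE] [uE EK pE]]]]] := ear e_sym bD KSD nKD KS2.
  apply: (theta0_ear e_sym th (u := u) (w := w) (E := E)) => //.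
  - by rewrite inE in uK'.
  - by rewrite inE in wK.
  - by move=> y /EK; rewrite !inE => /andP[].
  - by move=> E0; rewrite E0 in nE.
pose CS := [set x in c].
have CSD : CS \subset D by apply/subsetP=> x; rewrite inE => /cD.
have [CD|nCD] := eqVneq CS D.
  have memc x : (x \in c) = (x \in D) by rewrite -CD inE.
  case: (boolP [exists x in D, exists y in D, [&& e x y, next c x != y & next c y != x]]).
    case/exists_inP=> x xD /exists_inP[y yD /and3P[exy n1 n2]]; left.
    have xy : x != y by apply: contraTneq exy => ->; rewrite e_irr.
    have [P [Q th]] : exists P Q, theta e D x y P Q [::].
      apply: (cycle_theta e_sym uc cc c3) => //; rewrite ?memc //.
      by rewrite /= /restr /= xD yD exy.
    by exists x, y, P, Q, [::].
  move=> ne; right; left; split=> //; apply: (hamiltonian_copy e_sym e_irr uc cc memc).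
  move=> x y xD yD exy; apply: contraR ne; rewrite negb_or => /andP[n1 n2].
  by apply/exists_inP; exists x => //; apply/exists_inP; exists y => //; rewrite exy n1.
left; have CS2 : 1 < #|CS| by rewrite cardsE (card_uniqP uc) ltnW.
have [u [w [E [[uC wC uw nE] [uE EC pE]]]]] := ear e_sym bD CSD nCD CS2.
rewrite !inE in uC wC.
have [P [Q th]] : exists P Q, theta e D u w P Q E.
  apply: (cycle_theta e_sym uc cc c3) => // [y /EC|E0]; last by rewrite E0 in nE.
  by rewrite !inE => /andP[].
by exists u, w, P, Q, E.
Qed.

End ThetaExistence.

(** * Wilson's theorem *)

Section EvenPermutations.
Local Open Scope group_scope.
Variables (T : finType) (H : {group {perm T}}) (A : {set T}).
Hypothesis altA : alt_on H A.
Implicit Types (g h : {perm T}).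

(** Induction on the support: composing with a transposition fixes one more point, and all
    transpositions lie in one coset of [H]. *)
Lemma alt_on_index2 a b g : a \in A -> b \in A -> a != b -> perm_on A g ->
  if odd_perm g then g * tperm a b \in H else g \in H.
Proof.
move=> aA bA ab; have aH := elimT (alt_onP _ _) altA.
have [n] := ubnP #|[set x | g x != x]|; elim: n g => // n IH g ltn gA.
case: (boolP [exists x, g x != x]) => [/existsP[x gx]|]; last first.
  rewrite negb_exists => /forallP g1; suff -> : g = 1 by rewrite odd_perm1 group1.
  by apply/permP=> x; rewrite perm1; apply/eqP; have := g1 x; rewrite negbK.
have xA : x \in A by apply: contraNT gx => xA; apply/eqP; exact: out_perm gA xA.
have gxA : g x \in A by rewrite (perm_closed _ gA).
pose k := g * tperm x (g x).
have kA : perm_on A k.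
  by apply/subsetP=> y; rewrite !inE; apply: contraR => yA; rewrite permM (out_perm gA yA)
     tpermD //; apply: contraNneq yA => <-.
have ek : g = k * tperm x (g x) by rewrite -mulgA tperm2 mulg1.
have := IH k _ kA; rewrite odd_permM odd_tperm eq_sym gx addbT.
have lt : #|[set y | k y != y]| < n.
  rewrite -ltnS; apply: leq_trans ltn; rewrite ltnS; apply: proper_card.
  apply/properP; split; last by exists x; rewrite !inE // permM tpermR eqxx.
  apply/subsetP=> y; rewrite !inE; apply: contraNneq => gy.
  rewrite permM gy tpermD //; last first.
    by apply: contraNneq gx => gxy; apply/eqP/(@perm_inj _ g); rewrite gxy gy.
  by apply: contraNneq gx => ->; rewrite gy.
move=> /(_ lt); rewrite {3 4}ek; case: (odd_perm g) => /= kH.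
  by rewrite -mulgA groupM // aH // eq_sym.
have -> : k * tperm x (g x) = (k * tperm a b) * (tperm a b * tperm x (g x)).
  by rewrite mulgA -[k * _ * _]mulgA tperm2 mulg1.
by rewrite groupM // aH // eq_sym.
Qed.

Lemma alt_on_even g : perm_on A g -> ~~ odd_perm g -> g \in H.
Proof.
move=> gA og; have [x gx|g1] := pickP (fun x => g x != x); last first.
  suff -> : g = 1 by rewrite group1.
  by apply/permP=> x; rewrite perm1; apply/eqP; have := g1 x; move/negbFE.
have xA : x \in A by apply: contraNT gx => xA; apply/eqP; exact: out_perm gA xA.
have gxA : g x \in A by rewrite (perm_closed _ gA).
by have := alt_on_index2 gxA xA gx gA; rewrite (negbTE og).
Qed.

End EvenPermutations.

Section Wilson.
Local Open Scope group_scope.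
Variables (T : finType) (e : rel T).
Hypotheses (e_sym : symmetric e) (e_irr : irreflexive e).
Implicit Types (A B D : {set T}) (s t p q x y : T) (g h w : {perm T}).

Definition bipartite_on D :=
  exists c : T -> bool, forall x y, x \in D -> y \in D -> e x y -> c x != c y.

(** The theta graph provides a 3-cycle; a maximal set on which the group contains the alternating
    group is a block, hence everything. With at most three vertices the alternating group is
    trivial. *)
Lemma wilson_alt D p : biconn_in e D -> ~ exceptional_on e D -> p \in D ->
  alt_on (loops_group e D p) (D :\ p).
Proof.
move=> bD nexc pD.
have [D3|D4] := leqP #|D| 3.
  apply/alt_onP => a b c d aA bA cA dA ab cd.
  have EA : D :\ p = [set a; b].
    apply/esym/eqP; rewrite eqEcard subUset !sub1set aA bA cards2 ab /=.
    by rewrite (cardsD1 p) pD in D3.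
  rewrite EA !inE in cA dA.
  case/orP: cA cd => /eqP->; case/orP: dA => /eqP->; rewrite ?eqxx // => _.
    by rewrite tperm2 group1.
  by rewrite [tperm b a]tpermC tperm2 group1.
have [[s [t [P [Q [R [th ns]]]]]]|//] := theta_or_exceptional e_sym e_irr bD D4.
have sD : s \in D by have [_ [+ _ _] _] := th; case: (P) => [|z P'] /= /andP[/and3P[]].
have [B aB B3] := alt_on_has_3cycle (theta_has_3cycle e_sym th ns).
have sub C : alt_on (loops_group e D s) C -> 2 < #|C| -> C \subset D :\ s.
  move=> /alt_onP aC C3; apply/subsetP=> x xC; apply/negPn/negP => xD.
  have : 1 < #|C :\ x| by move: C3; rewrite (cardsD1 x) xC.
  case/card_gt1P=> y [z [+ + yz]]; rewrite !inE => /andP[yx yC] /andP[zx zC].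
  have := aC x y x z xC yC xC zC; rewrite ![x == _]eq_sym => /(_ yx zx) hl.
  have := loops_out hl xD; rewrite permM tpermL tpermD 1?eq_sym // => /eqP.
  by rewrite (negbTE yx).
pose F := fun C : {set T} => alt_on (loops_group e D s) C && (C \subset D :\ s).
have FB : F B by rewrite /F aB sub.
have [C mC sBC] := maxset_exists FB.
have C3 : 2 < #|C| := leq_trans B3 (subset_leq_card sBC).
have /andP[aC sCD] := maxsetp mC.
have bC : block (loops_group e D s) C.
  apply: (maximal_alt_block mC C3) => h x /loopsP[wh hs].
  by rewrite !inE -{1}hs (inj_eq perm_inj) (walk_stable e_sym _ wh).
have EC := block_full e_sym bD th sD sCD (ltnW C3) bC.
have [w wp ws] := walk_connect (bD.1 _ _ pD sD).
have wA x : x \in D :\ p -> w x \in C.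
  by rewrite EC !inE -ws (inj_eq perm_inj) (walk_stable e_sym _ wp).
apply/alt_onP => a b c d /wA aA /wA bA /wA cA /wA dA ab cd.
have := elimT (alt_onP _ _) aC _ _ _ _ aA bA cA dA.
rewrite !(inj_eq perm_inj) -ws => /(_ ab cd) /(loops_conj e_sym wp).
have conjwV k : w * k * w^-1 = k ^ w^-1 by rewrite conjgE invgK mulgA.
by rewrite conjwV tperm2J !permK.
Qed.

Lemma wilson_even D p g : biconn_in e D -> ~ exceptional_on e D -> p \in D ->
  perm_on (D :\ p) g -> ~~ odd_perm g -> g \in loops e D p.
Proof. by move=> bD nexc pD; apply: alt_on_even; apply: wilson_alt. Qed.

(** Each step of the blank is a transposition, so the sign of a walk is the parity of its length. If
    all closed walks are even, the parity of the walks from [p] is a 2-colouring. *)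
Lemma odd_loop D p : conn_in e D -> p \in D -> ~ bipartite_on D ->
  exists2 h, h \in loops e D p & odd_perm h.
Proof.
move=> cD pD nbip; case: (boolP [exists h in loops e D p, odd_perm h]).
  by case/exists_inP=> h; exists h.
rewrite negb_exists_in => /forall_inP even; case: nbip.
exists (fun x => [exists g, [&& walk e D p g, g p == x & odd_perm g]]).
have par x : x \in D -> exists g, [/\ walk e D p g, g p = x &
    odd_perm g = [exists g, [&& walk e D p g, g p == x & odd_perm g]]].
  move=> xD; case: (boolP [exists g, _]) => [/existsP[g /and3P[wg /eqP gx og]]|].
    by exists g.
  rewrite negb_exists => /forallP none; have [g wg gx] := walk_connect (cD _ _ pD xD).
  exists g; split=> //; apply: negbTE; have := none g.
  by rewrite wg gx eqxx.
move=> x y xD yD exy.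
have [g [wg gx <-]] := par x xD; have [h [wh hy <-]] := par y yD.
have xy : x != y by apply: contraTneq exy => ->; rewrite e_irr.
have : g * tperm x y * h^-1 \in loops e D p.
  apply/loopsP; split; last by rewrite !permM gx tpermL -hy permK.
  apply: walkM; last by rewrite permM gx tpermL -hy; apply: walkV.
  by apply: walkM wg _; rewrite gx; apply: walk_edge; rewrite /restr /= xD yD.
move/even; rewrite !odd_permM odd_permV odd_tperm xy.
by case: (odd_perm g); case: (odd_perm h).
Qed.

Lemma wilson_all D p g : biconn_in e D -> ~ exceptional_on e D -> ~ bipartite_on D -> p \in D ->
  perm_on (D :\ p) g -> g \in loops e D p.
Proof.
move=> bD nexc nbip pD gA; have [h hl oh] := odd_loop bD.1 pD nbip.
have hA : perm_on (D :\ p) h.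
  by apply/subsetP=> x; rewrite inE; apply: contraR => /(loops_out hl) ->.
have ev := wilson_even bD nexc pD.
case: (boolP (odd_perm g)) => og; last exact: ev.
have -> : g = g * h^-1 * h by rewrite mulgKV.
rewrite groupM //; apply: ev.
  by apply: perm_onM => //; apply: perm_onV.
by rewrite odd_permM odd_permV og oh.
Qed.

End Wilson.

(** * Deleting a vertex of a 3-connected graph *)

Section Exceptional.
Variables (T : finType) (e : rel T).
Implicit Types (D S : {set T}).

Lemma copy_no_triangle (G : sgraph) D : is_copy e G D ->
  (forall x y z : G, edge x y -> edge y z -> edge x z -> False) ->
  forall a b c, a \in D -> b \in D -> c \in D -> e a b -> e b c -> e a c -> False.
Proof.
case=> f [_ Df ef] H a b c /Df[x <-] /Df[y <-] /Df[z <-]; rewrite !ef.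
exact: H.
Qed.

Lemma cycle_edgeE n (i j : 'I_n) : edge (i : cycle_graph n) j =
  (i != j :> nat) && ((j == i.+1 %% n :> nat) || (i == j.+1 %% n :> nat)).
Proof. by []. Qed.

Lemma modS n i : i < n -> i.+1 %% n = if i.+1 == n then 0 else i.+1.
Proof.
move=> i_lt; case: eqP => [->|/eqP ne]; first by rewrite modnn.
by rewrite modn_small // ltn_neqAle ne.
Qed.

Lemma cycle_graph_no_triangle n (x y z : cycle_graph n) :
  3 < n -> edge x y -> edge y z -> edge x z -> False.
Proof.
move=> n4; case: x y z => [x xn] [y yn] [z zn]; rewrite !cycle_edgeE /=.
rewrite !modS //; do 3!case: ifP; lia.
Qed.

Lemma theta0_no_triangle (x y z : theta0) : edge x y -> edge y z -> edge x z -> False.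
Proof.
case: x y z => [[|[|[|[|[|[|[|x]]]]]]] // ?] [[|[|[|[|[|[|[|y]]]]]]] // ?];
  case=> [[|[|[|[|[|[|[|z]]]]]]] // ?] //.
Qed.

Lemma exceptional_no_triangle D a b c : exceptional_on e D ->
  a \in D -> b \in D -> c \in D -> e a b -> e b c -> e a c -> False.
Proof.
case=> [[D4 cp]|cp]; apply: copy_no_triangle cp _ _ _ _.
  by move=> x y z; apply: cycle_graph_no_triangle.
exact: theta0_no_triangle.
Qed.

Lemma copy_degree2_edge (G : sgraph) D (x y x1 x2 y1 y2 : G) : is_copy e G D -> edge x y ->
  (forall z, edge x z -> z = x1 \/ z = x2) -> (forall z, edge y z -> z = y1 \/ z = y2) ->
  exists u v, [/\ u \in D, v \in D & e u v] /\
    exists S1 S2, [/\ #|S1| <= 2, #|S2| <= 2,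
      {in D, forall z, e u z -> z \in S1} & {in D, forall z, e v z -> z \in S2}].
Proof.
case=> f [_ Df ef] xy Nx Ny; exists (f x), (f y); split.
  by split; [apply/Df; exists x | apply/Df; exists y | rewrite ef].
exists [set f x1; f x2], [set f y1; f y2]; rewrite !cards2; split; try by case: eqP.
  by move=> _ /Df[z <-]; rewrite ef => /Nx[]->; rewrite !inE eqxx ?orbT.
by move=> _ /Df[z <-]; rewrite ef => /Ny[]->; rewrite !inE eqxx ?orbT.
Qed.

Lemma exceptional_degree2_edge D : exceptional_on e D ->
  exists u v, [/\ u \in D, v \in D & e u v] /\
    exists S1 S2, [/\ #|S1| <= 2, #|S2| <= 2,
      {in D, forall z, e u z -> z \in S1} & {in D, forall z, e v z -> z \in S2}].
Proof.
case=> [[D4]|]; last first.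
  move=> cp; pose o i (h : i < 7) : theta0 := Ordinal h.
  apply: (@copy_degree2_edge _ _ (o 1 isT) (o 2 isT) (o 0 isT) (o 2 isT) (o 1 isT) (o 3 isT) cp) => //.
    by case=> [[|[|[|[|[|[|[|z]]]]]]] // ?] // _; [left|right]; apply: val_inj.
  by case=> [[|[|[|[|[|[|[|z]]]]]]] // ?] // _; [left|right]; apply: val_inj.
move: #|D| D4 => n n4 cp.
have h0 : 0 < n by lia. have h1 : 1 < n by lia. have h2 : 2 < n by lia. have h3 : n.-1 < n by lia.
pose o i (h : i < n) : cycle_graph n := Ordinal h.
apply: (@copy_degree2_edge _ _ (o _ h0) (o _ h1) (o _ h1) (o _ h3) (o _ h0) (o _ h2) cp).
- by rewrite cycle_edgeE /= modS //; case: ifP; lia.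
- case=> z zn; rewrite cycle_edgeE /= !modS // => H.
  have [E|E] : z = 1 \/ z = n.-1 by move: H; do 2?case: ifP; lia.
    by left; apply: val_inj.
  by right; apply: val_inj.
- case=> z zn; rewrite cycle_edgeE /= !modS // => H.
  have [E|E] : z = 0 \/ z = 2 by move: H; do 2?case: ifP; lia.
    by left; apply: val_inj.
  by right; apply: val_inj.
Qed.

End Exceptional.

Section GoodVertex.
Variables (T : finType) (e : rel T).
Hypotheses (e_sym : symmetric e) (e_irr : irreflexive e).
Variable D : {set T}.
Hypotheses (D4 : 3 < #|D|) (D3c : forall S : {set T}, #|S| <= 2 -> conn_in e (D :\: S)).

(** Otherwise deleting [S] isolates [u]. *)
Lemma neighbour_avoiding u (S : {set T}) : u \in D -> #|S| <= 2 ->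
  exists v, [/\ v \in D, v \notin S & e u v].
Proof.
move=> uD S2.
have [z zD zS] : exists2 z, z \in D & z \notin u |: S.
  apply/subsetPn; apply: contraTN D4 => /subset_leq_card.
  by have := cardsU1 u S; lia.
have S2' : #|S :\ u| <= 2 by apply: leq_trans S2; apply/subset_leq_card/subsetDl.
have uD' : u \in D :\: (S :\ u) by rewrite !inE eqxx uD.
move: zS; rewrite !inE negb_or => /andP[zu zS].
have zD' : z \in D :\: (S :\ u) by rewrite !inE zu zD (negbTE zS).
have zu' : z \notin [set u] by rewrite inE.
have [a [b [+ bu /and3P[_ bD ab]]]] := connect_exit (D3c S2' uD' zD') (set11 u) zu'.
rewrite inE => /eqP au; rewrite au in ab.
move: bD bu; rewrite !inE => /andP[+ bD] bu; rewrite bu /= => bS.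
by exists b.
Qed.

(** Along an edge both colourings change. *)
Lemma colourings_agree (A : {set T}) (c c' : T -> bool) :
  conn_in e A -> (forall x y, x \in A -> y \in A -> e x y -> c x != c y) ->
  (forall x y, x \in A -> y \in A -> e x y -> c' x != c' y) ->
  forall x y, x \in A -> y \in A -> (c x == c' x) = (c y == c' y).
Proof.
move=> cA pc pc' x y xA yA; have := cA x y xA yA; case/connectP=> p.
elim: p x {xA} => [|z p IH] x /=; first by move=> _ ->.
case/andP=> /and3P[xA zA exz] pz Ey; rewrite -(IH z pz Ey).
have := pc _ _ xA zA exz; have := pc' _ _ xA zA exz.
by case: (c x); case: (c z); case: (c' x); case: (c' z).
Qed.

(** Otherwise fix [y] and a 2-colouring of [D :\ y]. For any other [x], a 2-colouring of
    [D :\ x] extends the one of the connected set [D :\ x :\ y], so the neighbours of [y]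
    distinct from [x] have one colour; as [y] has three neighbours, all of them have one colour
    and [D] is bipartite. *)
Lemma nonbipartite_vertex : ~ bipartite_on e D -> exists2 y, y \in D & ~ bipartite_on e (D :\ y).
Proof.
move=> nb; apply: NNPP => none.
have bip y : y \in D -> bipartite_on e (D :\ y).
  by move=> yD; apply: NNPP => nby; apply: none; exists y.
have [y yD] : exists y, y \in D by apply/card_gt0P; lia.
have [c pc] := bip y yD.
have mono x v v' : x \in D -> x != y -> v \in D -> v' \in D -> v != x -> v' != x ->
    e y v -> e y v' -> c v = c v'.
  move=> xD xy vD v'D vx v'x yv yv'; have [c' pc'] := bip x xD.
  have A2 : #|[set x; y]| <= 2 by rewrite cards2; case: eqP.
  have vy : v != y by apply: contraTneq yv => ->; rewrite e_irr.
  have v'y : v' != y by apply: contraTneq yv' => ->; rewrite e_irr.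
  have sub a : a \in D :\: [set x; y] -> a \in D :\ y /\ a \in D :\ x.
    by rewrite !inE negb_or => /andP[/andP[-> ->] ->].
  have : (c v == c' v) = (c v' == c' v').
    apply: (colourings_agree (D3c A2)) => [a b /sub[aA _] /sub[bA _]|a b /sub[_ aA] /sub[_ bA]||].
    - exact: pc.
    - exact: pc'.
    - by rewrite !inE negb_or vx vy.
    - by rewrite !inE negb_or v'x v'y.
  have yA : y \in D :\ x by rewrite !inE eq_sym xy.
  have := pc' y v yA; have := pc' y v' yA; rewrite !inE vx v'x vD v'D.
  move=> /(_ isT yv') + /(_ isT yv).
  by case: (c' y); case: (c' v); case: (c' v'); case: (c v); case: (c v').
apply: nb.
case: (boolP [exists v in D, exists v' in D, [&& e y v, e y v' & c v != c v']]).
  case/exists_inP=> v vD /exists_inP[v' v'D /and3P[yv yv' cvv']].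
  have vv' : v != v' by apply: contraNneq cvv' => ->.
  have S2 : #|[set v; v']| <= 2 by rewrite cards2; case: eqP.
  have [z [zD zS yz]] := neighbour_avoiding yD S2.
  move: zS; rewrite !inE negb_or => /andP[zv zv'].
  have vy : v != y by apply: contraTneq yv => ->; rewrite e_irr.
  have v'y : v' != y by apply: contraTneq yv' => ->; rewrite e_irr.
  have E1 := mono v z v' vD vy zD v'D zv; have E2 := mono v' z v v'D v'y zD vD zv' vv'.
  by move: cvv'; rewrite -E1 ?E2 ?eqxx // eq_sym.
move=> same.
have same' v v' : v \in D -> v' \in D -> e y v -> e y v' -> c v = c v'.
  move=> vD v'D yv yv'; apply/eqP; apply: contraR same => cvv'.
  by apply/exists_inP; exists v => //; apply/exists_inP; exists v' => //; rewrite yv yv'.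
have [|v [vD _ yv]] := @neighbour_avoiding y set0 yD; first by rewrite cards0.
exists (fun x => if x == y then ~~ c v else c x) => a b aD bD eab.
have [ay|ay] := eqVneq a y; have [by_|by_] := eqVneq b y.
- by rewrite ay by_ e_irr in eab.
- by rewrite ay in eab; rewrite (same' v b) //; case: (c b).
- by rewrite by_ e_sym in eab; rewrite (same' v a) //; case: (c a).
- by apply: pc; rewrite ?inE ?ay ?by_.
Qed.

(** If deleting [y] leaves an exceptional graph, this graph has two adjacent vertices of degree 2;
    they have a third neighbour in [D], which must be [y], and form a triangle with it. The triangle
    survives in [D :\ w] as soon as [w] is not on it, and rules out both bipartite and exceptional
    graphs. *)
Lemma good_vertex : exists y, [/\ y \in D, ~ exceptional_on e (D :\ y) &
  ~ bipartite_on e D -> ~ bipartite_on e (D :\ y)].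
Proof.
have [y yD nby] : exists2 y, y \in D & ~ bipartite_on e D -> ~ bipartite_on e (D :\ y).
  have [nb|b] := classic (~ bipartite_on e D).
    by have [y yD nby] := nonbipartite_vertex nb; exists y.
  by have [y yD] : exists y, y \in D by [apply/card_gt0P; lia]; exists y.
have [ex|nex] := classic (exceptional_on e (D :\ y)); last by exists y.
have [u [v [[uD vD uv] [S1 [S2 [S1c S2c nu nv]]]]]] := exceptional_degree2_edge ex.
have yuv z (S : {set T}) : z \in D :\ y -> #|S| <= 2 ->
    {in D :\ y, forall x, e z x -> x \in S} -> e z y.
  rewrite inE => /andP[_ zD] Sc nz; have [x [xD xS zx]] := neighbour_avoiding zD Sc.
  have [<- //|xy] := eqVneq x y.
  by move: xS; rewrite nz // !inE xy.
have uy := yuv _ _ uD S1c nu; have vy := yuv _ _ vD S2c nv.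
have D5 : 3 < #|D :\ y|.
  case: ex => [[]//|[f [injf Df _]]]; have : #|f @: [set: theta0]| <= #|D :\ y|.
    by apply/subset_leq_card/subsetP => _ /imsetP[z _ ->]; apply/Df; exists z.
  by rewrite card_imset // cardsT card_ord; apply: leq_trans.
have [w wD wuv] : exists2 w, w \in D :\ y & w \notin [set u; v].
  apply/subsetPn; apply: contraTN D5 => /subset_leq_card; rewrite cards2.
  by case: eqP; lia.
move: uD vD wD wuv; rewrite !inE negb_or => /andP[u_y uD] /andP[v_y vD] /andP[w_y wD] /andP[wu wv].
have [uW vW yW] : [/\ u \in D :\ w, v \in D :\ w & y \in D :\ w].
  by rewrite !inE ![_ == w]eq_sym wu wv w_y.
exists w; split=> // [exw|_ [c pc]].
  exact: (exceptional_no_triangle exw uW vW yW).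
have := pc _ _ uW vW uv; have := pc _ _ uW yW uy; have := pc _ _ vW yW vy.
by case: (c u); case: (c v); case: (c y).
Qed.

End GoodVertex.

(** * Freezing the tokens of the path *)

Section Moves.
Local Open Scope group_scope.
Variables (T : finType) (x e : rel T).
Implicit Types (a b c : T) (g h : {perm T}).

(** A configuration [g] puts the token [a] on the vertex [g a]. *)
Definition move : rel {perm T} := [rel g h : {perm T} |
  [exists a, exists b, [&& x a b, e (g a) (g b) & h == tperm a b * g]]].

Lemma moveP g h :
  reflect (exists a b, [/\ x a b, e (g a) (g b) & h = tperm a b * g]) (move g h).
Proof.
apply: (iffP existsP) => [[a /existsP[b /and3P[xab eab /eqP->]]]|[a [b [xab eab ->]]]].
  by exists a, b.
by exists a; apply/existsP; exists b; rewrite xab eab eqxx.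
Qed.

Lemma moveI g a b : x a b -> e (g a) (g b) -> move g (tperm a b * g).
Proof. by move=> xab eab; apply/moveP; exists a, b. Qed.

Lemma move_sym : symmetric e -> symmetric move.
Proof.
move=> es; suff H g h : move g h -> move h g by move=> g h; apply/idP/idP; apply: H.
case/moveP=> a [b [xab eab ->]]; apply/moveP; exists a, b; split=> //.
  by rewrite !permM tpermL tpermR es.
by rewrite mulgA tperm2 mul1g.
Qed.

Lemma tperm_mulC a b g : tperm a b * g = g * tperm (g a) (g b).
Proof. by rewrite [LHS]conjgC tpermJ. Qed.

(** A token [c] that can be exchanged with all tokens on [A] is a blank on [A]; it stays on [A]
    on the way, which is what makes it possible to avoid a given configuration. *)
Lemma star_walk c g w (A : {set T}) : symmetric e -> irreflexive e ->
    (forall a, g a \in A -> a != c -> x c a) -> g c \in A -> walk e A (g c) w ->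
  connect (restr move [set h : {perm T} | h c \in A]) g (g * w).
Proof.
move=> e_sym e_irr xc cA; elim/walk_ind => [|k q wk IH /and3P[kA qA ekq]].
  by rewrite mulg1 connect0.
apply: connect_trans IH (connect1 _).
have [a qa] : exists a, q = (g * k) a by exists ((g * k)^-1 q); rewrite permKV.
have aA : g a \in A by rewrite -(walk_stable e_sym _ wk) -[k (g a)]permM -qa.
have ac : a != c.
  by apply: contraTneq ekq => ac; rewrite qa ac permM e_irr.
have -> : g * (k * tperm (k (g c)) q) = tperm c a * (g * k).
  by rewrite tperm_mulC -qa permM mulgA.
apply/and3P; rewrite !inE !permM tpermL kA; split=> //; first by rewrite -[k (g a)]permM -qa.
by apply: moveI; [exact: xc | rewrite -qa permM].
Qed.

(** Exchanging the names of two tokens with the same friends is a symmetry. *)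
Lemma reach_tperm a b g h : (forall u v, x (tperm a b u) (tperm a b v) = x u v) ->
  connect move g h -> connect move (tperm a b * g) (tperm a b * h).
Proof.
move=> xab; case/connectP=> p pp ->; elim: p g pp => [|w p IH] g //= /andP[mv /IH].
apply: connect_trans; apply: connect1; case/moveP: mv => u [v [xuv euv ->]].
have -> : tperm a b * (tperm u v * g) = tperm (tperm a b u) (tperm a b v) * (tperm a b * g).
  by rewrite !mulgA [X in _ = X * _]tperm_mulC !tpermK.
by apply: moveI; rewrite ?xab // !permM !tpermK.
Qed.

End Moves.

Lemma move_subrel (T : finType) (x0 x e : rel T) : subrel x0 x -> subrel (move x0 e) (move x e).
Proof. by move=> sx g h /moveP[a [b [/sx xab eab ->]]]; apply: moveI. Qed.

(** With the additional exchange of [a] and [b] the two classes are joined: up to this exchange,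
    [a] and [b] can be brought to the ends of an edge. *)
Lemma reach_extra_edge (T : finType) (x0 x e : rel T) (a b p q : T) (g h : {perm T}) :
    symmetric e -> subrel x0 x -> x a b -> a != b -> e p q -> p != q ->
    (forall u v, x0 (tperm a b u) (tperm a b v) = x0 u v) ->
    (forall g h : {perm T}, connect (move x0 e) g h \/ connect (move x0 e) (tperm a b * g)%g h) ->
  connect (move x e) g h.
Proof.
move=> e_sym sx xab ab epq pq xt two.
have sub g1 h1 : connect (move x0 e) g1 h1 -> connect (move x e) g1 h1.
  by apply: connect_sub => g2 h2 /(move_subrel sx); apply: connect1.
have csym := sym_connect_sym (move_sym x e_sym).
have [w [wa wb]] : exists w : {perm T}, w a = p /\ w b = q.
  exists (tperm a p * tperm (tperm a p b) q)%g; rewrite !permM tpermL tpermL; split=> //.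
  rewrite tpermD 1?eq_sym //; apply: contraNneq ab => Ep; apply/eqP.
  by rewrite -[b](tpermK a p) -Ep tpermR.
have swap : connect (move x e) w (tperm a b * w)%g.
  by apply/connect1/moveI; rewrite ?wa ?wb.
have gt g1 : connect (move x e) g1 (tperm a b * g1)%g.
  have inv g2 h2 := @reach_tperm _ x0 e a b g2 h2 xt.
  have tt (u : {perm T}) : (tperm a b * (tperm a b * u))%g = u by rewrite mulgA tperm2 mul1g.
  case: (two g1 w) => H.
    apply: connect_trans (sub _ _ H) _; apply: connect_trans swap _.
    by rewrite csym; apply: sub; apply: inv.
  have := inv _ _ H; rewrite tt => H'.
  apply: connect_trans (sub _ _ H') _; rewrite csym.
  by apply: connect_trans swap; apply: sub.
by case: (two g h) => [/sub//|/sub]; apply: connect_trans; apply: gt.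
Qed.

(** The tokens are labelled [0, ..., m + k - 1] as the vertices of the dandelion; the moves of
    the dandelion are possible, and [R] is any equivalence that identifies the two
    configurations of a move. *)
Section Levels.
Local Open Scope group_scope.
Variables (T : finType) (x e : rel T) (m k : nat) (lab : T -> nat).
Hypotheses (e_sym : symmetric e) (e_irr : irreflexive e) (x_sym : symmetric x).
Hypotheses (lab_inj : injective lab) (lab_onto : forall i, i < m + k -> exists a, lab a = i).
Hypotheses (cardT : #|T| = (m + k)%N) (m_gt0 : 0 < m) (k_gt1 : (1 < k)%N).
Hypothesis x_path : forall a b, (lab a).+1 = lab b -> lab b <= m -> x a b.
Hypothesis x_star : forall a b, lab a = m -> m < lab b -> x a b.
Hypothesis e_conn : forall S : {set T}, #|S| <= m -> conn_in e (~: S).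
Implicit Types (a b c y z : T) (g h w : {perm T}).

Variable R : {perm T} -> {perm T} -> Prop.
Hypotheses (R_refl : forall g, R g g) (R_sym : forall g h, R g h -> R h g).
Hypothesis R_trans : forall g h w, R g h -> R h w -> R g w.
Hypothesis R_move : forall g h, move x e g h -> R g h.

(** The part of the graph left to the other tokens when [0, ..., j - 1] are frozen. *)
Definition above g j := [set y | j <= lab (g^-1 y)].

Definition agree j g h := forall a, lab a < j -> g a = h a.

Lemma above_agree j g h : agree j g h -> above g j = above h j.
Proof.
suff H g' h' : agree j g' h' -> above g' j \subset above h' j.
  by move=> a; apply/eqP; rewrite eqEsubset !H // => b /a.
move=> agr; apply/subsetP=> y; rewrite !inE; apply: contraTT; rewrite -!ltnNge => lt.
by rewrite -(permKV h' y) -agr // permK.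
Qed.

Lemma mem_above g j a : (g a \in above g j) = (j <= lab a).
Proof. by rewrite inE permK. Qed.

Lemma card_above g j : #|~: above g j| <= j.
Proof.
have -> : ~: above g j = [set g a | a in [set a | lab a < j]].
  apply/setP=> y; rewrite -[y](permKV g) (mem_imset _ _ perm_inj) !inE permK.
  by rewrite -ltnNge.
rewrite card_imset; last exact: perm_inj.
rewrite cardE -(size_map lab) -[X in _ <= X](size_iota 0); apply: uniq_leq_size.
  by rewrite map_inj_uniq ?enum_uniq.
by move=> i /mapP[a]; rewrite mem_enum inE mem_iota => aj ->.
Qed.

Lemma conn_above g j (S : {set T}) : j + #|S| <= m -> conn_in e (above g j :\: S).
Proof.
move=> jS; have -> : above g j :\: S = ~: (~: above g j :|: S).
  by rewrite setCU setCK setDE.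
apply: e_conn; apply: leq_trans jS; apply: leq_trans (leq_card_setU _ _) _.
by rewrite leq_add2r card_above.
Qed.

Lemma conn_above0 g j : j <= m -> conn_in e (above g j).
Proof. by move=> jm; rewrite -[above g j]setD0; apply: conn_above; rewrite cards0 addn0. Qed.

Lemma above_gt g j : m + k - j <= #|above g j|.
Proof. by rewrite leq_subLR -cardT -(cardsC (above g j)) addnC leq_add2r card_above. Qed.

Lemma aboveS g j b : lab b = j -> above g j.+1 = above g j :\ g b.
Proof.
move=> bj; apply/setP=> y; rewrite !inE -[y](permKV g) permK (inj_eq perm_inj).
by rewrite ltn_neqAle -bj -(inj_eq lab_inj) eq_sym.
Qed.

Lemma agree_trans j g h w : agree j g h -> agree j h w -> agree j g w.
Proof. by move=> gh hw a aj; rewrite gh ?hw. Qed.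

Lemma agree_tperm j g a b : j <= lab a -> j <= lab b -> agree j g (tperm a b * g).
Proof.
by move=> ja jb c cj; rewrite permM tpermD //; apply: contraTneq cj => <-; rewrite -leqNgt.
Qed.

(** Steps of the token [j] to any neighbouring vertex can be chained along a path. *)
Lemma steer j b g y : lab b = j -> j <= m ->
  (forall g z, e (g b) z -> z \in above g j -> exists h, [/\ agree j g h, R g h & h b = z]) ->
  y \in above g j -> exists h, [/\ agree j g h, R g h & h b = y].
Proof.
move=> bj jm step yD; have gbD : g b \in above g j by rewrite mem_above bj.
have /connectP[p pp ->] := conn_above0 jm gbD yD.
elim: p g pp {yD gbD} => [|z p IH] g /=; first by move=> _; exists g.
case/andP=> /and3P[_ zD ez] pz; have [h [agr Rh hz]] := step g z ez zD.
have [|w [agr' Rw wl]] := IH h; first by rewrite -(above_agree agr) hz.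
by exists w; split; [apply: agree_trans agr agr' | apply: R_trans Rh Rw | rewrite -hz].
Qed.

(** Before each step of the token [j], the token [j + 1] is steered in front of it, in the still
    connected graph from which the vertex of the token [j] is removed. *)
Lemma bring_token d j g b y : d + j = m -> lab b = j -> y \in above g j ->
  exists h, [/\ agree j g h, R g h & h b = y].
Proof.
elim: d j g b y => [|d IH] j g b y dj bj yD; have jm : j <= m by lia.
all: apply: steer yD => // {y}g z ez zD.
- have za : z = g (g^-1 z) by rewrite permKV.
  have ja : m <= lab (g^-1 z) by move: zD; rewrite inE -dj.
  move: za ja; move: (g^-1 z) => a za ja; rewrite za in ez.
  have ab : lab a != m.
    apply: contraTneq ez => am; have -> : a = b by apply: lab_inj; rewrite am -dj.
    by rewrite e_irr.
  have xba : x b a by apply: x_star; [lia | rewrite ltn_neqAle eq_sym ab].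
  exists (tperm b a * g); split; first by apply: agree_tperm; lia.
    by apply/R_move/moveI.
  by rewrite permM tpermL.
have [|b' b'j] := lab_onto (i := j.+1); first by lia.
have [|||h [agr Rh hb']] := IH j.+1 g b' z; rewrite ?addnS //.
  by rewrite (aboveS _ bj) in_setD1 zD andbT; apply: contraTneq ez => ->; rewrite e_irr.
have hb : h b = g b by rewrite agr // bj.
exists (tperm b b' * h); split.
- apply: (@agree_trans _ _ h) => [a aj|]; first by apply: agr; apply: leqW.
  by apply: agree_tperm; lia.
- apply: R_trans Rh _; apply/R_move/moveI; last by rewrite hb hb'.
  by apply: x_path; lia.
- by rewrite permM tpermL.
Qed.

(** The token [j] is parked, for both configurations, on a vertex whose deletion preserves the
    hypotheses; then [j + 1] tokens are frozen. The hypothesis [base] treats the star formed by the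
    centre, the token [m - 1] and the leaves, all other tokens being frozen. The flag [nb] tells
    whether the graph is required not to be bipartite. *)
Lemma equivalence_by_levels (nb : bool) :
    (forall g h, agree m.-1 g h -> ~ exceptional_on e (above g m.-1) ->
      (nb -> ~ bipartite_on e (above g m.-1)) -> R g h) ->
  forall d j g h, d + j = m.-1 -> agree j g h ->
    (d = 0 -> ~ exceptional_on e (above g j)) ->
    (nb -> ~ bipartite_on e (above g j)) -> R g h.
Proof.
move=> base; elim=> [|d IH] j g h dj agr nexc nbip.
  by move: base; rewrite -dj => base; apply: base => //; apply: nexc.
have D4 : 3 < #|above g j| by have := above_gt g j; lia.
have D3c (S : {set T}) : #|S| <= 2 -> conn_in e (above g j :\: S).
  by move=> S2; apply: conn_above; lia.
have [y [yD nexcy nby]] := good_vertex e_sym e_irr D4 D3c.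
have [|b bj] := lab_onto (i := j); first by lia.
have djm : (m - j) + j = m by lia.
have [g' [agr1 Rg' g'b]] := bring_token djm bj yD.
have yDh : y \in above h j by rewrite -(above_agree agr).
have [h' [agr2 Rh' h'b]] := bring_token djm bj yDh.
have ag1 : above g' j.+1 = above g j :\ y by rewrite (aboveS _ bj) -(above_agree agr1) g'b.
apply: R_trans Rg' _; apply: R_trans _ (R_sym Rh'); apply: (IH j.+1) => //.
- by rewrite addnS.
- move=> a; rewrite ltnS leq_eqVlt => /predU1P[aj|aj].
    have -> : a = b by apply: lab_inj; rewrite bj.
    by rewrite g'b h'b.
  by rewrite -agr1 // -agr2 // agr.
- by rewrite ag1.
- by rewrite ag1 => /nbip.
Qed.

Lemma move_walk c g h : lab c = m -> walk e (above g m.-1) (g c) h -> R g (g * h).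
Proof.
move=> cm wh; have cD : g c \in above g m.-1 by rewrite mem_above cm leq_pred.
have xc a : g a \in above g m.-1 -> a != c -> x c a.
  rewrite mem_above => am ac; have [lt|gt|E] := ltngtP m (lab a); first exact: x_star.
    by rewrite x_sym; apply: x_path; lia.
  by case/eqP: ac; apply: lab_inj; rewrite cm.
case/connectP: (star_walk e_sym e_irr xc cD wh) => p.
move: [set _ | _] => A + ->; elim: p g {xc cD wh} => [|h' p IH] g //=.
by case/andP=> /and3P[_ _ /R_move Rh] pp; apply: R_trans Rh _; apply: IH.
Qed.

Lemma align_center c g h : lab c = m -> agree m.-1 g h ->
  exists g', [/\ agree m.-1 g g', R g g' & g' c = h c].
Proof.
move=> cm agr; have cD : g c \in above g m.-1 by rewrite mem_above cm leq_pred.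
have hcD : h c \in above g m.-1 by rewrite (above_agree agr) mem_above cm leq_pred.
have [w ww wc] := walk_connect (conn_above0 (leq_pred m) cD hcD).
exists (g * w); split; [|exact: move_walk ww|by rewrite permM].
by move=> a am; rewrite permM (walk_out ww) // mem_above -ltnNge.
Qed.

(** Wilson's theorem, for the tokens that are not frozen. *)
Lemma star_equivalence c g h : lab c = m -> agree m.-1 g h -> g c = h c ->
    ~ exceptional_on e (above g m.-1) ->
    ~~ odd_perm (g^-1 * h) \/ ~ bipartite_on e (above g m.-1) ->
  R g h.
Proof.
move=> cm agr gc nexc evn; set D := above g m.-1 in nexc evn.
have bD : biconn_in e D.
  split; first exact: conn_above0 (leq_pred m).
  by move=> y; apply: conn_above; rewrite cards1; lia.
have cD : g c \in D by rewrite mem_above cm leq_pred.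
have kD : perm_on (D :\ g c) (g^-1 * h).
  apply/subsetP=> y; rewrite inE; apply: contraR.
  rewrite -[y](permKV g) !inE permK (inj_eq perm_inj) negb_and negbK permM permK.
  by case/orP=> [/eqP->|]; [rewrite gc | rewrite -ltnNge => /agr->].
suff : g^-1 * h \in loops e D (g c).
  by case/loopsP=> wk _; have := move_walk cm wk; rewrite mulKVg.
by case: evn => ?; [apply: wilson_even | apply: wilson_all].
Qed.

End Levels.

Section Equivalence.
Local Open Scope group_scope.
Variables (T : finType) (x e : rel T) (m k : nat) (lab : T -> nat).
Hypotheses (e_sym : symmetric e) (e_irr : irreflexive e) (x_sym : symmetric x).
Hypotheses (lab_inj : injective lab) (lab_onto : forall i, i < m + k -> exists a, lab a = i).
Hypotheses (cardT : #|T| = (m + k)%N) (m_gt0 : 0 < m) (k_gt1 : (1 < k)%N).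
Hypothesis x_path : forall a b, (lab a).+1 = lab b -> lab b <= m -> x a b.
Hypothesis x_star : forall a b, lab a = m -> m < lab b -> x a b.
Hypothesis e_conn : forall S : {set T}, #|S| <= m -> conn_in e (~: S).
Hypothesis e_nexc : m = 1%N -> ~ exceptional_on e [set: T].
Implicit Types (a b c y z : T) (g h w : {perm T}).

Let reach := connect (move x e).

Let reach_sym g h : reach g h -> reach h g.
Proof. by rewrite /reach (sym_connect_sym (move_sym x e_sym)). Qed.

Let reach_move g h : move x e g h -> reach g h.
Proof. exact: connect1. Qed.

Let reach_refl g : reach g g.
Proof. exact: connect0. Qed.

Let reach_trans g h w : reach g h -> reach h w -> reach g w.
Proof. exact: connect_trans. Qed.

Let above0 g : above lab g 0 = [set: T].
Proof. by apply/setP=> y; rewrite !inE. Qed.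

Let align c g h : lab c = m -> agree lab m.-1 g h ->
  exists g', [/\ agree lab m.-1 g g', reach g g' & g' c = h c].
Proof. by move=> cm; apply: (align_center e_sym e_irr x_sym lab_inj cardT m_gt0 k_gt1 x_path
  x_star e_conn (R := fun g h => reach g h)). Qed.

Let star c g h : lab c = m -> agree lab m.-1 g h -> g c = h c ->
    ~ exceptional_on e (above lab g m.-1) ->
    ~~ odd_perm (g^-1 * h) \/ ~ bipartite_on e (above lab g m.-1) ->
  reach g h.
Proof. by move=> cm; apply: (star_equivalence e_sym e_irr x_sym lab_inj cardT m_gt0 k_gt1
  x_path x_star e_conn (R := fun g h => reach g h)). Qed.

Lemma nonbipartite_reach g h : ~ bipartite_on e [set: T] -> reach g h.
Proof.
move=> nbip; have [|c cm] := lab_onto (i := m); first by lia.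
apply: (equivalence_by_levels e_sym e_irr lab_inj lab_onto cardT m_gt0 k_gt1 x_path x_star
  e_conn (R := fun g h => reach g h) reach_refl reach_sym reach_trans reach_move (nb := true) _
  (d := m.-1) (j := 0)) => //; rewrite ?addn0 ?above0 //; last by move=> m1; apply: e_nexc; lia.
move=> g1 h1 agr nexc nb.
have [g2 [agr2 R2 g2c]] := align cm agr.
apply: reach_trans R2 _; apply: (star cm) => //.
- by move=> a am; rewrite -agr2 // agr.
- by rewrite -(above_agree agr2).
- by right; rewrite -(above_agree agr2); apply: nb.
Qed.

(** Without an odd closed walk, configurations that differ by an odd permutation are connected
    after swapping [a] and [b]. Connectedness up to this swap is an equivalence, because the swap
    is a symmetry, and so the argument by levels applies to it. *)
Lemma two_classes_reach a b g h : m < lab a -> m < lab b -> a != b ->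
    (forall u v, x (tperm a b u) (tperm a b v) = x u v) ->
  reach g h \/ reach (tperm a b * g) h.
Proof.
move=> ma mb ab xab; pose t := tperm a b.
have tt w : t * (t * w) = w by rewrite mulgA tperm2 mul1g.
have reach_t w1 w2 : reach w1 w2 -> reach (t * w1) (t * w2) by exact: reach_tperm.
pose R g h := reach g h \/ reach (t * g) h.
have Rsym w1 w2 : R w1 w2 -> R w2 w1.
  case=> H; first by left; apply: reach_sym.
  by right; apply: reach_sym; rewrite -[w1]tt; apply: reach_t.
have Rtrans w1 w2 w3 : R w1 w2 -> R w2 w3 -> R w1 w3.
  case=> H1 [H2|H2].
  - by left; apply: reach_trans H1 H2.
  - by right; apply: reach_trans (reach_t _ _ H1) H2.
  - by right; apply: reach_trans H1 H2.
  - by left; have := reach_t _ _ H1; rewrite tt => H3; apply: reach_trans H3 H2.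
have Rreach w1 w2 : reach w1 w2 -> R w1 w2 by left.
have [|c cm] := lab_onto (i := m); first by lia.
have [ca cb] : a != c /\ b != c.
  by split; apply: contraTneq (ma) => E; move: ma mb; rewrite E cm ltnn.
suff : R g h by [].
have Rrefl w : R w w by left.
have Rmove w1 w2 : move x e w1 w2 -> R w1 w2 by move=> mv; left; apply: reach_move.
apply: (equivalence_by_levels e_sym e_irr lab_inj lab_onto cardT m_gt0 k_gt1 x_path x_star
  e_conn Rrefl Rsym Rtrans Rmove (nb := false) _ (d := m.-1) (j := 0)) => //;
  rewrite ?addn0 ?above0 //; last by move=> m1; apply: e_nexc; lia.
move=> g1 h1 agr nexc _.
have [g2 [agr2 R2 g2c]] := align cm agr.
apply: Rtrans (Rreach _ _ R2) _.
have agr3 : agree lab m.-1 g2 h1 by move=> z zm; rewrite -agr2 // agr.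
have nexc2 : ~ exceptional_on e (above lab g2 m.-1) by rewrite -(above_agree agr2).
case: (boolP (odd_perm (g2^-1 * h1))) => od; last by left; apply: (star cm) => //; left.
right.
have agr4 : agree lab m.-1 g2 (t * g2) by apply: agree_tperm; lia.
apply: (star cm).
- by move=> z zm; rewrite -agr4 // agr3.
- by rewrite permM tpermD.
- by rewrite -(above_agree agr4).
- left; move: od; rewrite !odd_permM !odd_permV odd_permM odd_tperm ab.
  by case: odd_perm; case: odd_perm.
Qed.

End Equivalence.

(** * Reconnecting the neighbours of a deleted configuration *)

(** A path through the deleted vertex can be rerouted between the two neighbours it uses there. *)
Lemma conn_in_without_vertex (T : finType) (r : rel T) : symmetric r ->
    (forall a b, connect r a b) ->
    (forall v a b, r v a -> r v b -> connect (restr r (~: [set v])) a b) ->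
  forall v, conn_in r (~: [set v]).
Proof.
move=> rs rc loc v a b; rewrite !inE => av bv.
pose C := [set z | (z != v) && connect (restr r (~: [set v])) a z].
have aC : a \in C by rewrite inE av connect0.
have out x y : x \in C -> r x y -> y != v -> y \in C.
  rewrite !inE => /andP[xv ax] rxy yv; rewrite yv (connect_trans ax) //.
  by apply: connect1; rewrite /restr /= !inE xv yv.
suff : b \in C by rewrite inE => /andP[].
have vC : v \notin C by rewrite inE eqxx.
have [x [y [xC yC rxy]]] := connect_exit (rc a v) aC vC.
have yv : y = v by apply: contraNeq yC => yv; apply: out xC rxy yv.
rewrite yv in rxy; apply: contraT => bC.
have aK : a \in v |: C by rewrite in_setU1 aC orbT.
have bK : b \notin v |: C by rewrite in_setU1 negb_or bv.
have [s [t [sK tK rst]]] := connect_exit (rc a b) aK bK.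
move: tK; rewrite in_setU1 negb_or => /andP[tv tC].
case/setU1P: sK => [sv|sC]; last by rewrite (out s t) in tC.
rewrite sv in rst; case/negP: tC; rewrite inE tv /=.
have /andP[_ ax] : (x != v) && connect (restr r (~: [set v])) a x by rewrite inE in xC.
by apply: connect_trans ax (loc v x t _ rst); rewrite rs.
Qed.

Section NoCutVertex.
Local Open Scope group_scope.
Variables (T : finType) (x e : rel T) (c : T) (D : {set T}) (g0 : {perm T}).
Hypotheses (e_sym : symmetric e) (e_irr : irreflexive e).
Hypotheses (x_sym : symmetric x) (x_irr : irreflexive x).
Hypotheses (bD : biconn_in e D) (D3 : 2 < #|D|) (cD : g0 c \in D).
Hypothesis xcE : forall a, a != c -> x c a = (g0 a \in D).
Implicit Types (a b p q : T) (g h w : {perm T}).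

Let r := restr (move x e) (~: [set g0]).

Let r_move g h : move x e g h -> g != g0 -> h != g0 -> r g h.
Proof. by move=> mv gg hg; rewrite /r /restr /= !inE gg hg. Qed.

Let p0 := g0 c.

(** Take a path [w] from [q1] to [q2] in [D :\ p0]. The centre turns around the cycle formed by
    [p0] and this path; between two visits to [p0] the configuration differs from [g0]. The turns are
    repeated until [g0] is met again, arriving from [q2]. *)
Lemma centre_moves_connected q1 q2 : q1 \in D -> q2 \in D -> e p0 q1 -> e p0 q2 ->
  connect r (g0 * tperm p0 q1) (g0 * tperm p0 q2).
Proof.
move=> q1D q2D e1 e2.
have q1p : q1 != p0 by apply: contraTneq e1 => ->; rewrite e_irr.
have q2p : q2 != p0 by apply: contraTneq e2 => ->; rewrite e_irr.
have [w ww wq] : exists2 w, walk e (D :\ p0) q1 w & w q1 = q2.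
  by apply: walk_connect; apply: bD.2; rewrite !inE ?q1p ?q2p.
pose rho := tperm p0 q1 * w * tperm q2 p0.
have wp : w p0 = p0 by apply: walk_out ww _; rewrite !inE eqxx.
have rp : rho p0 = p0 by rewrite !permM tpermL wq tpermL.
have rD y : (rho y \in D) = (y \in D).
  have tD q z : q \in D -> (tperm p0 q z \in D) = (z \in D).
    by move=> qD; case: tpermP => // ->; rewrite qD cD.
  rewrite !permM [tperm q2 _]tpermC tD // -[RHS](tD q1) //; move: (tperm p0 q1 y) => z.
  by rewrite (walk_stable e_sym z (walk_sub (subsetDl _ _) ww)).
pose A i := g0 * rho ^+ i.
have Ap i : (rho ^+ i) p0 = p0 by elim: i => [|i IH]; rewrite ?perm1 // expgSr permM IH rp.
have AD i y : ((rho ^+ i) y \in D) = (y \in D).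
  by elim: i => [|i IH]; rewrite ?perm1 // expgSr permM rD.
have xcA i a : A i a \in D -> a != c -> x c a.
  by rewrite permM AD => aD ac; rewrite xcE.
have step i q : q \in D -> e p0 q -> move x e (A i) (A i * tperm p0 q).
  move=> qD ep; have [a qa] : exists a, q = A i a by exists ((A i)^-1 q); rewrite permKV.
  have Ac : A i c = p0 by rewrite permM Ap.
  have ac : a != c by apply: contraTneq ep => ac; rewrite qa ac Ac e_irr.
  have -> : A i * tperm p0 q = tperm c a * A i by rewrite tperm_mulC Ac qa.
  by apply: moveI; [apply: (xcA i) => //; rewrite -qa | rewrite Ac -qa].
have off i q : q != p0 -> A i * tperm p0 q != g0.
  move=> qp; apply: contraNneq qp => E.
  have <- : (A i * tperm p0 q) c = q by rewrite !permM Ap tpermL.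
  by rewrite E.
have around i : connect r (A i * tperm p0 q1) (A i.+1 * tperm p0 q2).
  have -> : A i.+1 * tperm p0 q2 = A i * tperm p0 q1 * w.
    have tt u : u * tperm q2 p0 * tperm p0 q2 = u by rewrite [tperm q2 _]tpermC -mulgA tperm2 mulg1.
    by rewrite /A expgSr /rho !mulgA tt.
  have gc : (A i * tperm p0 q1) c = q1 by rewrite !permM Ap tpermL.
  have xc a : (A i * tperm p0 q1) a \in D :\ p0 -> a != c -> x c a.
    rewrite permM in_setD1 => /andP[_ aD] ac; apply: (xcA i) => //.
    by move: aD; case: tpermP => [->|->|].
  have := @star_walk _ x e c (A i * tperm p0 q1) w (D :\ p0) e_sym e_irr xc.
  rewrite gc !inE q1p q1D => /(_ isT ww); apply: connect_sub => g h.
  case/and3P; rewrite !inE => /andP[gp _] /andP[hp _] mv; apply/connect1/r_move => //.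
    by apply: contraNneq gp => ->.
  by apply: contraNneq hp => ->.
have key i : connect r (A 0 * tperm p0 q1) (g0 * tperm p0 q2) \/
    connect r (A 0 * tperm p0 q1) (A i.+1 * tperm p0 q2).
  elim: i => [|i [IH|IH]]; [by right; apply: around | by left |].
  have [Ag|nA] := eqVneq (A i.+1) g0; first by left; rewrite Ag in IH.
  right; apply: connect_trans IH _; apply: connect_trans (around i.+1).
  apply: (@connect_trans _ _ (A i.+1)).
    by apply/connect1/r_move => //; [rewrite (move_sym x e_sym); apply: step | apply: off].
  by apply/connect1/r_move => //; [apply: step | apply: off].
have A0 : A 0 = g0 by rewrite /A expg0 mulg1.
have AN : A #[rho] = g0 by rewrite /A expg_order mulg1.
by case: (key #[rho].-1); rewrite ?prednK ?order_gt0 // A0 ?AN.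
Qed.

(** Compare an exchange of [a] and [b] with a step of the centre to [q]. If [q] carries neither [a]
    nor [b], the two exchanges commute and complete a 4-cycle. If all neighbours of the centre carry
    [a] or [b], the three tokens are pairwise adjacent on three pairwise adjacent vertices, and
    both neighbours are adjacent to the configuration obtained by a rotation of the three. *)
Lemma neighbours_connected h1 h2 : move x e g0 h1 -> move x e g0 h2 -> connect r h1 h2.
Proof.
have [q0 q0D e0] : exists2 q, q \in D & e p0 q.
  have [z zD zp] : exists2 z, z \in D & z \notin [set p0].
    by apply/subsetPn; apply: contraTN D3 => /subset_leq_card; rewrite cards1; lia.
  have [s [t [+ _ /and3P[_ tD est]]]] := connect_exit (bD.1 _ _ cD zD) (set11 p0) zp.
  by rewrite inE => /eqP sp; exists t => //; rewrite -sp.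
have rsym : symmetric r by apply/restr_sym/move_sym.
have csym := sym_connect_sym rsym.
suff H h : move x e g0 h -> connect r h (g0 * tperm p0 q0).
  by move=> /H H1 /H H2; apply: connect_trans H1 _; rewrite csym.
case/moveP=> a [b [xab eab ->]].
wlog ac : a b xab eab / b != c => [IH|].
  have [bc|bc] := eqVneq b c; last exact: IH.
  rewrite tpermC; apply: IH; rewrite 1?x_sym 1?e_sym // -bc.
  by apply: contraTneq xab => ->; rewrite x_irr.
have [aE|a_c] := eqVneq a c.
  rewrite aE in xab eab *; rewrite tperm_mulC; apply: centre_moves_connected => //.
  by rewrite -xcE.
have ab : a != b by apply: contraTneq xab => ->; rewrite x_irr.
have neq u v : u != v -> tperm u v * g0 != g0.
  move=> uv; rewrite -[X in _ != X]mul1g (inj_eq (mulIg g0)); apply: contraNneq uv => E.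
  by rewrite -(tpermL u v) E perm1.
case: (boolP [exists q in D, [&& e p0 q, q != g0 a & q != g0 b]]) => [/exists_inP[q qD]|nq].
  case/and3P=> eq qa qb; apply: connect_trans (centre_moves_connected qD q0D eq e0).
  have [d qd] : exists d, q = g0 d by exists (g0^-1 q); rewrite permKV.
  rewrite qd !(inj_eq perm_inj) in qa qb eq qD *.
  have dc : d != c by apply: contraTneq eq => ->; rewrite e_irr.
  have u : uniq [:: c; d; a; b].
    by rewrite /= !inE !negb_or ![c == _]eq_sym dc a_c ac qa qb ab.
  rewrite /p0 -tperm_mulC.
  have nm : tperm c d * (tperm a b * g0) != g0.
    rewrite mulgA -[X in _ != X]mul1g (inj_eq (mulIg g0)); apply: contraNneq dc => E.
    have := congr1 (fun s : {perm T} => s c) E; rewrite permM tpermL perm1 tpermD 1?eq_sym //.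
    by move=> ->.
  apply: (@connect_trans _ _ (tperm c d * (tperm a b * g0))); apply: connect1.
    apply: r_move => //; last exact: neq.
    apply: moveI; first by rewrite xcE.
    by rewrite !permM !tpermD // eq_sym.
  rewrite rsym; apply: r_move => //; last by apply: neq; rewrite eq_sym.
  rewrite !mulgA tperm_disjC // -mulgA; apply: moveI => //.
  by rewrite !permM !tpermD // eq_sym.
have nq' q : q \in D -> e p0 q -> q = g0 a \/ q = g0 b.
  move=> qD eq; have [|qa] := eqVneq q (g0 a); first by left.
  have [|qb] := eqVneq q (g0 b); first by right.
  by case/negP: nq; apply/exists_inP; exists q => //; rewrite eq qa qb.
have [q1 q1D [e1 q10]] : exists2 q, q \in D & e p0 q /\ q != q0.
  have q0p : p0 != q0 by apply: contraTneq e0 => <-; rewrite e_irr.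
  have [z zD zp] : exists2 z, z \in D & z \notin [set p0; q0].
    by apply/subsetPn; apply: contraTN D3 => /subset_leq_card; rewrite cards2; case: eqP; lia.
  move: zp; rewrite !inE negb_or => /andP[zp zq].
  have zD' : z \in D :\ q0 by rewrite !inE zq.
  have pD' : p0 \in D :\ q0 by rewrite !inE q0p.
  have zp' : z \notin [set p0] by rewrite inE.
  have [s [t [+ _ /and3P[_ + est]]]] := connect_exit (bD.2 q0 _ _ pD' zD') (set11 p0) zp'.
  by rewrite !inE => /eqP sp /andP[tq tD]; exists t; rewrite // -sp.
have both : [/\ g0 a \in D, g0 b \in D, e p0 (g0 a) & e p0 (g0 b)].
  by case: (nq' _ q0D e0) (nq' _ q1D e1) => E0 [E1|E1]; rewrite -?E0 -?E1; split=> //;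
    rewrite E0 E1 eqxx in q10.
case: both => aD bD' ea eb.
apply: connect_trans (centre_moves_connected aD q0D ea e0).
rewrite /p0 -tperm_mulC.
have E3 : tperm c b * (tperm a b * g0) = tperm a b * (tperm c a * g0).
  by rewrite !mulgA tperm_mulC tpermR tpermD.
have nm : tperm c b * (tperm a b * g0) != g0.
  rewrite mulgA -[X in _ != X]mul1g (inj_eq (mulIg g0)); apply: contraNneq a_c => E.
  have := congr1 (fun s : {perm T} => s c) E; rewrite permM tpermL perm1 tpermR.
  by move=> ->.
apply: (@connect_trans _ _ (tperm c b * (tperm a b * g0))); apply: connect1.
  apply: r_move => //; last exact: neq.
  apply: moveI; first by rewrite xcE.
  by rewrite !permM tpermR tpermD.
rewrite rsym E3; apply: r_move; last by rewrite -E3.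
  apply: moveI => //; rewrite !permM tpermR tpermD // eq_sym //.
by apply: neq; rewrite eq_sym.
Qed.

End NoCutVertex.

(** * Friends-and-strangers graphs as graphs on permutations *)

Lemma connect_homo (A B : finType) (r : rel A) (s : rel B) (f : A -> B) a b :
  (forall u v, r u v -> s (f u) (f v)) -> connect r a b -> connect s (f a) (f b).
Proof.
move=> rs /connectP[p pp ->]; elim: p a pp => [|u p IH] a /=; first by rewrite connect0.
by case/andP=> /rs/connect1 ab /IH; apply: connect_trans.
Qed.

Lemma del_vertices_connected (G : sgraph) (S : {set G}) :
  connected (del_vertices S) <-> conn_in edge (~: S).
Proof.
split=> [cd u v|ci u v].
  rewrite !inE => uS vS; pose su : del_vertices S := Sub u uS; pose sv : del_vertices S := Sub v vS.
  apply: (@connect_homo _ _ (@edge (del_vertices S)) _ val su sv) (cd su sv).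
  by move=> a b eab; rewrite /restr /= !inE (valP a) (valP b).
have uS : val u \in ~: S by rewrite inE (valP u).
have vS : val v \in ~: S by rewrite inE (valP v).
have /connectP[p pp lp] := ci _ _ uS vS.
elim: p u pp lp {uS} => [|w p IH] u /=; first by move=> _ /val_inj->; apply: connect0.
case/andP=> /and3P[_ + ew] pw lw; rewrite inE => wS.
by apply: connect_trans (IH (Sub w wS) pw lw); apply: connect1.
Qed.

(** Deleting fewer vertices: complete the deleted set, away from the two vertices to connect. *)
Lemma s_connected_le (G : sgraph) m (S : {set G}) :
  s_connected m.+1 G -> #|S| <= m -> conn_in edge (~: S).
Proof.
case=> Gm conn Sm u v uS vS.
have [S' [sS mS uS' vS']] : exists S' : {set G},
    [/\ S \subset S', #|S'| = m, u \in ~: S' & v \in ~: S'].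
  have [d Ed] : exists d, #|S| + d = m by exists (m - #|S|); rewrite subnKC.
  elim: d S Ed uS vS {Sm} => [|d IH] S Ed uS vS; first by exists S; rewrite -Ed addn0.
  have [w _ wS] : exists2 w, w \in [set: G] & w \notin S :|: [set u; v].
    apply/subsetPn; apply: contraTN Gm => /subset_leq_card; rewrite cardsT.
    have [+ _] := leq_card_setU S [set u; v]; rewrite cards2; case: eqP => _; clear -Ed; lia.
  move: wS; rewrite !inE !negb_or => /and3P[wS wu wv].
  have [|||S' [sS mS uS' vS']] := IH (w |: S).
  - by rewrite cardsU1 wS; lia.
  - by rewrite !inE negb_or eq_sym wu -in_setC.
  - by rewrite !inE negb_or eq_sym wv -in_setC.
  by exists S'; split=> //; apply: subset_trans sS; apply: subsetUr.
have : connected (del_vertices S') by apply: conn; rewrite mS.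
move/del_vertices_connected/(_ u v uS' vS'); apply: connect_restr_sub.
by rewrite setCS.
Qed.

Lemma s_connected2_connected (G : sgraph) : s_connected 2 G -> connected G.
Proof.
move=> c2 u v; have c0 : #|@set0 G| <= 1 by rewrite cards0.
have := s_connected_le c2 c0; rewrite setC0 => /(_ u v (in_setT _) (in_setT _)).
by apply: connect_sub => a b /and3P[_ _] /connect1.
Qed.

Section Bridge.
Local Open Scope group_scope.
Variables (X Y : sgraph) (t : X -> Y) (t' : Y -> X).
Hypotheses (tK : cancel t t') (t'K : cancel t' t).

Definition pulled_edge : rel Y := [rel a b | edge (t' a) (t' b)].

(** The token [u] is renamed [t u], so that a bijection becomes a permutation of [Y]. *)
Lemma FS_perm : exists F : {perm Y} -> FS X Y,
  bijective F /\ forall g h, edge (F g) (F h) = move pulled_edge edge g h.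
Proof.
have bijP (g : {perm Y}) :
    injectiveb [ffun u => g (t u)] && [forall y, y \in codom [ffun u => g (t u)]].
  apply/andP; split.
    by apply/injectiveP=> u v; rewrite !ffunE => /perm_inj/(can_inj tK).
  apply/forallP=> y; apply/codomP; exists (t' (g^-1 y)).
  by rewrite ffunE t'K permKV.
pose F (g : {perm Y}) : FS X Y := Sub [ffun u => g (t u)] (bijP g).
have sinj (s : FS X Y) : injective (val s \o t').
  have /andP[/injectiveP si _] := valP s.
  by apply: inj_comp si (can_inj t'K).
exists F; split.
  exists (fun s => perm (@sinj s)) => [g|s].
    by apply/permP=> y; rewrite permE /= ffunE t'K.
  by apply/val_inj/ffunP=> u; rewrite /= ffunE permE /= tK.
move=> g h; apply/idP/idP.
  case/existsP=> a /existsP[b /and5P[ab xab eab ha /andP[hb /forallP hc]]].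
  move: eab ha hb; rewrite /= !ffunE => eab /eqP ha /eqP hb.
  apply/moveP; exists (t a), (t b); split=> //; first by rewrite /pulled_edge /= !tK.
  apply/permP=> y; rewrite permM; case: tpermP => [->|->|ya yb]; rewrite ?ha ?hb //.
  have := hc (t' y); rewrite !inE /= !ffunE t'K negb_or.
  have -> : t' y != a by apply/eqP=> E; apply: ya; rewrite -E t'K.
  have -> : t' y != b by apply/eqP=> E; apply: yb; rewrite -E t'K.
  by move=> /eqP.
case/moveP=> a [b [xab eab ->]]; rewrite /pulled_edge /= in xab.
apply/existsP; exists (t' a); apply/existsP; exists (t' b); rewrite /= !ffunE !t'K.
rewrite !permM tpermL tpermR !eqxx eab xab ?andbT /=.
have -> /= : t' a != t' b.
  by apply: contraTneq xab => E; rewrite E edge_irrefl.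
apply/forallP=> u; apply/implyP; rewrite !inE negb_or => /andP[ua ub].
rewrite !ffunE permM tpermD //.
  by apply: contraNneq ua => ->; rewrite tK.
by apply: contraNneq ub => ->; rewrite tK.
Qed.

Lemma FS_connected : connected (FS X Y) <-> forall g h, connect (move pulled_edge edge) g h.
Proof.
have [F [[F' FK F'K] FE]] := FS_perm; split=> [c g h|c s u].
  rewrite -[g]FK -[h]FK; apply: connect_homo (c _ _) => a b.
  by rewrite -{1}[a]F'K -{1}[b]F'K FE.
rewrite -[s]F'K -[u]F'K; apply: connect_homo (c _ _) => a b.
by rewrite -FE.
Qed.

Lemma FS_biconnected : 2 < #|FS X Y| ->
  (forall g, conn_in (move pulled_edge edge) (~: [set g])) -> s_connected 2 (FS X Y).
Proof.
have [F [[F' FK F'K] FE]] := FS_perm => c2 ci; split=> // S S1.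
have [s ->] : exists s, S = [set s] by apply/cards1P/eqP; case: S1.
apply/del_vertices_connected => u v; rewrite !inE => us vs.
rewrite -[u]F'K -[v]F'K; apply: (@connect_homo _ _ (restr (move pulled_edge edge) (~: [set F' s]))).
  move=> a b /and3P[]; rewrite !inE => as_ bs mv; apply/and3P; rewrite FE mv !inE; split=> //.
    by apply: contraNneq as_ => <-; rewrite FK.
  by apply: contraNneq bs => <-; rewrite FK.
by apply: ci; rewrite !inE (can_eq F'K).
Qed.

Lemma card_FS : #|FS X Y| = #|Y|`!.
Proof.
have [F [Fbij _]] := FS_perm.
rewrite -(bij_eq_card Fbij) -[in RHS]cardsT -card_perm.
by apply: eq_card => g; apply/esym/subsetP=> y _; rewrite inE.
Qed.

End Bridge.

(** * Invariants of the reachable configurations *)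

Lemma reach_invariant (T : finType) (r : rel T) (P : T -> Prop) u v :
  (forall a b, r a b -> P a -> P b) -> connect r u v -> P u -> P v.
Proof. by move=> rP /connectP[p pp ->]; elim: p u pp => //= w p IH u /andP[/rP uw /IH H] /uw. Qed.

Section Separation.
Local Open Scope group_scope.
Variables (T : finType) (x e : rel T) (m : nat) (lab : T -> nat).
Hypotheses (e_sym : symmetric e) (x_sym : symmetric x).
Hypotheses (lab_inj : injective lab) (lab_onto : forall i, i <= m -> exists a, lab a = i).
Hypothesis x_lol : forall a b, x a b -> lab a < lab b ->
  lab b = (lab a).+1 /\ lab b <= m \/ m <= lab a.

(** A token 0 placed in a component [A] of the complement of [S] never reaches another component.
    To let it out, the tokens of the path would have to enter [S] one after the other: for some
    [j], the tokens before [j] are on [S] and the token [j] is on [A]. For [j = m] the set [S] is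
    full, and the token [m] is stuck in [A]. *)
Lemma conn_in_of_reach : (forall g h : {perm T}, connect (move x e) g h) ->
  forall S : {set T}, #|S| = m -> conn_in e (~: S).
Proof.
move=> reach S Sm u w; rewrite !inE => uS wS; apply: contraT => nuw.
pose A := [set z | connect (restr e (~: S)) u z].
have AS z : z \in A -> z \notin S.
  by rewrite inE => /connect_restr_in; rewrite !inE; apply.
have Aout y z : y \in A -> e y z -> z \notin S -> z \in A.
  move=> yA eyz zS; have yS := AS y yA; move: yA; rewrite !inE => /connect_trans; apply.
  by apply: connect1; rewrite /restr /= !inE yS zS.
have [tok tokE] : exists tok : nat -> T, forall i, i <= m -> lab (tok i) = i.
  have [t0 _] := lab_onto (leq0n m).
  exists (fun i => odflt t0 [pick a | lab a == i]) => i /lab_onto[a aE].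
  by case: pickP => [b /eqP //|/(_ a)]; rewrite aE eqxx.
pose I (g : {perm T}) := exists j, [/\ j <= m, forall a, lab a < j -> g a \in S
  & forall a, lab a = j -> g a \in A].
have Imove g h : move x e g h -> I g -> I h.
  case/moveP=> a [b [xab eab ->]] [j [jm jS jA]] {h}.
  wlog ltab : a b xab eab / lab a < lab b => [IH|].
    have [lt|gt|E] := ltngtP (lab a) (lab b); first exact: IH.
      by rewrite tpermC; apply: IH; rewrite 1?x_sym 1?e_sym.
    by rewrite (lab_inj E) tperm1 mul1g; exists j.
  have hz z : z != a -> z != b -> (tperm a b * g) z = g z.
    by move=> za zb; rewrite permM tpermD // eq_sym.
  have ha : (tperm a b * g) a = g b by rewrite permM tpermL.
  have hb : (tperm a b * g) b = g a by rewrite permM tpermR.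
  have labN z i : lab z != i -> forall y, lab y = i -> y != z.
    by move=> zi y yi; apply: contraNneq zi => <-; rewrite yi.
  have [bj|jb|bj] := ltngtP (lab b) j.
  - exists j; split=> // [z zj|z zj]; last first.
      by rewrite hz ?jA //; apply: labN zj; lia.
    have [->|za] := eqVneq z a; first by rewrite ha jS.
    by have [->|zb] := eqVneq z b; [rewrite hb jS //; lia | rewrite hz ?jS].
  - have [aj|ja|aj] := ltngtP (lab a) j.
    + by have := x_lol xab ltab; lia.
    + exists j; split=> // [z zj|z zj]; rewrite hz ?jS ?jA //; try by apply: labN zj; lia.
        by apply: contraTneq zj => ->; lia.
      by apply: contraTneq zj => ->; lia.
    + have gaA := jA a aj.
      have [gbS|gbS] := boolP (g b \in S); last first.
        exists j; split=> // [z zj|z zj].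
          by rewrite hz ?jS //; apply: contraTneq zj => ->; lia.
        have -> : z = a by apply: lab_inj; rewrite zj.
        by rewrite ha; apply: Aout gaA eab gbS.
      have [jlt|jge] := ltnP j m; last first.
        have jE : j = m by lia.
        have tokI (i : 'I_m) : lab (tok (val i)) = val i by apply/tokE/ltnW/ltn_ord.
        pose B := [set g (tok (val i)) | i : 'I_m].
        have BS : B = S.
          apply/eqP; rewrite eqEcard Sm card_imset ?card_ord ?leqnn ?andbT.
            apply/subsetP=> _ /imsetP[i _ ->]; apply: jS; rewrite tokI jE.
            exact: ltn_ord.
          by move=> i i' /perm_inj/(congr1 lab); rewrite !tokI => /val_inj.
        move: gbS; rewrite -BS => /imsetP[i _ /perm_inj bE].
        by move: jb; rewrite bE tokI jE ltnNge (ltnW (ltn_ord i)).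
      have bE : lab b = j.+1 by have := x_lol xab ltab; lia.
      exists j.+1; split=> // [z zj|z zj].
        have [->|za] := eqVneq z a; first by rewrite ha.
        have zb : z != b by apply: contraTneq zj => ->; lia.
        have zla : lab z != lab a by rewrite (inj_eq lab_inj).
        by rewrite hz // jS //; lia.
      have -> : z = b by apply: lab_inj; rewrite zj.
      by rewrite hb.
  - have aE : lab a = j.-1 by have := x_lol xab ltab; lia.
    exists j.-1; split=> [|z zj|z zj]; first by lia.
      by rewrite hz ?jS //; [lia | |]; apply: contraTneq zj => ->; lia.
    have -> : z = a by apply: lab_inj; rewrite zj.
    by rewrite ha jA.
have t0 : lab (tok 0) = 0 by rewrite tokE.
pose put z : {perm T} := tperm (tok 0) z.
have putE z : put z (tok 0) = z by rewrite tpermL.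
have Iu : I (put u).
  exists 0; split=> // a a0; have -> : a = tok 0 by apply: lab_inj; rewrite t0.
  by rewrite putE inE connect0.
have [j [jm jS jA]] := reach_invariant Imove (reach (put u) (put w)) Iu.
case: j jm jS jA => [|j] jm jS jA.
  by have := jA _ t0; rewrite putE inE (negbTE nuw).
by have := jS (tok 0); rewrite t0 putE (negbTE wS) => /(_ isT).
Qed.

End Separation.

Section Parity.
Local Open Scope group_scope.
Variables (T : finType) (x e : rel T) (cx ce : T -> bool).
Hypotheses (x_bip : forall a b, x a b -> cx a != cx b) (e_bip : forall a b, e a b -> ce a != ce b).

(** The sign of a configuration plus the number of tokens of one colour on vertices of one
    colour; each move changes both. *)
Definition parity (g : {perm T}) :=
  odd_perm g (+) \big[addb/false]_a (cx a && ce (g a)).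

Lemma parity_move g h : move x e g h -> parity h = parity g.
Proof.
case/moveP=> a [b [xab eab ->]]; have cab := x_bip xab; have eab' := e_bip eab.
have ab : b != a by apply: contraNneq cab => ->.
have split (f : T -> bool) : \big[addb/false]_z f z =
    f a (+) (f b (+) \big[addb/false]_(z | (z != a) && (z != b)) f z).
  by rewrite (bigD1 a) //= (bigD1 b).
have rest : \big[addb/false]_(z | (z != a) && (z != b)) (cx z && ce ((tperm a b * g) z)) =
    \big[addb/false]_(z | (z != a) && (z != b)) (cx z && ce (g z)).
  by apply: eq_bigr => z /andP[za zb]; rewrite permM tpermD // eq_sym.
rewrite /parity odd_permM odd_tperm eq_sym ab [in LHS]split [in RHS]split rest.
rewrite !permM tpermL tpermR; move: (\big[_/_]_(_ | _) _) => s.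
by move: cab eab'; case: (odd_perm g) (cx a) (cx b) (ce (g a)) (ce (g b)) s => [] [] [] [] [] [].
Qed.

Lemma parity_not_reach a b : a != b -> cx a = cx b ->
  ~ (forall g h : {perm T}, connect (move x e) g h).
Proof.
move=> ab cab reach.
have inv : parity 1 = parity (tperm a b).
  have H g h : move x e g h -> parity 1 = parity g -> parity 1 = parity h.
    by move=> /parity_move->.
  exact: (reach_invariant (P := fun g => parity 1 = parity g) H (reach 1 (tperm a b))).
move: inv; rewrite /parity odd_perm1 odd_tperm ab /=.
have -> : \big[addb/false]_z (cx z && ce (tperm a b z)) =
    \big[addb/false]_z (cx z && ce ((1 : {perm T}) z)).
  rewrite (reindex_inj (@perm_inj _ (tperm a b))) /=; apply: eq_bigr => z _.
  by rewrite tpermK perm1; case: tpermP => // ->; rewrite cab.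
by case: (\big[addb/false]_z _).
Qed.

End Parity.

Section ConstantRelation.
Local Open Scope group_scope.
Variables (T : finType) (x e : rel T) (c : T) (F : T -> T -> T -> T -> T -> bool).
Hypothesis x_star : forall a b, x a b -> a = c \/ b = c.
Hypothesis F_step : forall p q y1 y2 y3 y4, e p q ->
  y1 != p -> y2 != p -> y3 != p -> y4 != p ->
  F p y1 y2 y3 y4 = F q (tperm p q y1) (tperm p q y2) (tperm p q y3) (tperm p q y4).
Hypothesis e_sym : symmetric e.

(** A relation on the vertices other than the one of the centre, carried along its moves, holds
    of the same tokens in all reachable configurations. *)
Lemma constant_relation_not_reach (p : T) (k : {perm T}) y1 y2 y3 y4 : k p = p ->
  y1 != p -> y2 != p -> y3 != p -> y4 != p ->
  F p y1 y2 y3 y4 != F p (k y1) (k y2) (k y3) (k y4) ->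
  ~ (forall g h : {perm T}, connect (move x e) g h).
Proof.
move=> kp n1 n2 n3 n4 neq reach.
pose g := tperm c p; have gc : g c = p by rewrite tpermL.
have gK y : g (g y) = y by rewrite tpermK.
pose P (h : {perm T}) := F (h c) (h (g y1)) (h (g y2)) (h (g y3)) (h (g y4)) = F p y1 y2 y3 y4.
have nc y : y != p -> g y != c by move=> yp; rewrite -[c]gK gc (inj_eq perm_inj).
have Pmove h h' : move x e h h' -> P h -> P h'.
  case/moveP=> a [b [xab eab ->]]; rewrite /P => <-.
  have [u [huv ->]] : exists u, e (h c) (h u) /\ tperm a b = tperm c u.
    case: (x_star xab) => E; rewrite E in eab *; first by exists b.
    by exists a; rewrite e_sym tpermC.
  by rewrite tperm_mulC !permM tpermL [RHS](F_step huv) ?(inj_eq perm_inj) ?nc.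
have := reach_invariant Pmove (reach g (g * k)); rewrite /P !permM gc !gK kp => /(_ erefl) E.
by rewrite E eqxx in neq.
Qed.

End ConstantRelation.

(** * The two exceptional graphs *)

(** The relation [F p] concerns the vertices other than the position [p] of the centre; it is enough
    that it is carried along the edges of [G] but not preserved by the transposition of [a]
    and [b]. *)
Lemma iso_relation_not_reach (Y G : sgraph) (x : rel Y) (c : Y)
    (F : G -> G -> G -> G -> G -> bool) :
    iso Y G -> (forall a b, x a b -> a = c \/ b = c) ->
    (forall p q y1 y2 y3 y4 : G, edge p q -> y1 != p -> y2 != p -> y3 != p -> y4 != p ->
      F p y1 y2 y3 y4 = F q (tperm p q y1) (tperm p q y2) (tperm p q y3) (tperm p q y4)) ->
  forall (p a b y1 y2 y3 y4 : G), a != p -> b != p ->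
    y1 != p -> y2 != p -> y3 != p -> y4 != p ->
    F p y1 y2 y3 y4 != F p (tperm a b y1) (tperm a b y2) (tperm a b y3) (tperm a b y4) ->
  ~ (forall g h : {perm Y}, connect (move x edge) g h).
Proof.
case=> f [[f' fK f'K] fE] xc step p a b y1 y2 y3 y4 ap bp n1 n2 n3 n4 neq.
have fi := can_inj fK; have f'i := can_inj f'K.
pose FY p y1 y2 y3 y4 := F (f p) (f y1) (f y2) (f y3) (f y4).
apply: (@constant_relation_not_reach Y x edge c FY xc _ (@edge_sym Y) (f' p)
  (tperm (f' a) (f' b)) (f' y1) (f' y2) (f' y3) (f' y4)); rewrite ?(inj_eq f'i) //.
- move=> p1 q1 z1 z2 z3 z4 epq m1 m2 m3 m4; rewrite /FY !(inj_tperm _ _ _ fi).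
  by apply: step; rewrite ?fE ?(inj_eq fi).
- by rewrite tpermD ?(inj_eq f'i).
- by rewrite /FY !(inj_tperm _ _ _ fi) !f'K.
Qed.

(** The cyclic order of the tokens other than the centre. *)
Lemma cycle_not_reach (Y : sgraph) n (x : rel Y) (c : Y) : 3 < n -> iso Y (cycle_graph n) ->
  (forall a b, x a b -> a = c \/ b = c) -> ~ (forall g h : {perm Y}, connect (move x edge) g h).
Proof.
move=> n4 iY xc.
have h0 : 0 < n by lia. have h1 : 1 < n by lia. have h2 : 2 < n by lia.
pose F (p y1 y2 _ _ : 'I_n) :=
  y2 == (if y1.+1 %% n == p then p.+1 %% n else y1.+1 %% n) :> nat.
apply: (@iso_relation_not_reach Y (cycle_graph n) x c F iY xc _ (Ordinal h0) (Ordinal h2)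
  (Ordinal n4) (Ordinal h1) (Ordinal h2) (Ordinal h1) (Ordinal h2)) => //; last first.
  by rewrite /F /= tpermL tpermD //= !modn_small.
have tE (p q y : 'I_n) : y != p -> tperm p q y = (if y == q :> nat then p : nat else y : nat) :> nat.
  move=> yp; case: tpermP => [E|->|/eqP _ /eqP/negbTE E]; [by rewrite E eqxx in yp | by rewrite eqxx |].
  by case: ifP => // /eqP/val_inj Eq; rewrite Eq eqxx in E.
move=> p q y1 y2 y3 y4; rewrite cycle_edgeE => epq n1 n2 _ _; rewrite /F !tE //.
move: p q y1 y2 epq n1 n2 => [p pn] [q qn] [y1 y1n] [y2 y2n]; rewrite -!val_eqE /=.
rewrite [p.+1 %% n]modS // [q.+1 %% n]modS // [y1.+1 %% n]modS //.
case: (eqVneq y1 q) => E1; case: (eqVneq y2 q) => E2; rewrite /= ?modS //;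
  move=> epq n1 n2; move: epq n1 n2 E1 E2; clear -n4 pn qn y1n y2n; do ?case: ifP; lia.
Qed.

(** The order in which the six vertices other than [p] play the points of a fixed 1-factorization of
    the complete graph on six vertices. *)
Definition theta0_points (p : nat) :=
  if p == 6 then [:: 0; 1; 2; 4; 5; 3] else rem p (iota 0 7).

(** The factor containing the pair of [y] and [z], with 0 on the diagonal. Moving the centre along an
    edge of [theta0] permutes the five factors. *)
Definition theta0_colour (p y z : nat) : nat :=
  nth 0 (nth [::] [:: [:: 0; 1; 2; 3; 4; 5]; [:: 1; 0; 3; 4; 5; 2]; [:: 2; 3; 0; 5; 1; 4];
                      [:: 3; 4; 5; 0; 2; 1]; [:: 4; 5; 1; 2; 0; 3]; [:: 5; 2; 4; 1; 3; 0]]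
    (index y (theta0_points p))) (index z (theta0_points p)).

Definition theta0_step_ok :=
  all (fun pq : nat * nat => let: (p, q) := pq in
    let t y := if y == p then q else if y == q then p else y in
    let V := rem p (iota 0 7) in
    all (fun y1 => all (fun y2 => all (fun y3 => all (fun y4 =>
      (theta0_colour p y1 y2 == theta0_colour p y3 y4) ==
      (theta0_colour q (t y1) (t y2) == theta0_colour q (t y3) (t y4))) V) V) V) V)
  [:: (0, 1); (1, 2); (2, 3); (3, 4); (4, 5); (5, 0); (6, 0); (6, 3);
      (1, 0); (2, 1); (3, 2); (4, 3); (5, 4); (0, 5); (0, 6); (3, 6)].

Lemma theta0_step : theta0_step_ok.
Proof. by vm_compute. Qed.

(** Two pairs of tokens have the same colour or not throughout; exchanging the tokens of 1 and 2
    would change this for the pairs of 1 and 3 and of 2 and 4. *)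
Lemma theta0_not_reach (Y : sgraph) (x : rel Y) (c : Y) : iso Y theta0 ->
  (forall a b, x a b -> a = c \/ b = c) -> ~ (forall g h : {perm Y}, connect (move x edge) g h).
Proof.
move=> iY xc; pose F (p y1 y2 y3 y4 : 'I_7) := theta0_colour p y1 y2 == theta0_colour p y3 y4.
pose o i (h : i < 7) : theta0 := Ordinal h.
apply: (@iso_relation_not_reach Y theta0 x c F iY xc _ (o 0 isT) (o 1 isT) (o 2 isT)
  (o 1 isT) (o 3 isT) (o 2 isT) (o 4 isT)) => //; last first.
  by rewrite /F tpermL tpermR !tpermD.
have tE (p q y : 'I_7) : tperm p q y =
    (if y == p :> nat then q : nat else if y == q :> nat then p : nat else y : nat) :> nat.
  case: tpermP => [->|->|/eqP E1 /eqP E2]; rewrite ?eqxx //; first by case: eqP => // ->.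
  case: ifP => [/eqP/val_inj Eq|_]; first by rewrite Eq eqxx in E1.
  by case: ifP => // /eqP/val_inj Eq; rewrite Eq eqxx in E2.
move=> p q y1 y2 y3 y4 epq n1 n2 n3 n4; rewrite /F !tE.
have memV (y : 'I_7) : y != p -> (y : nat) \in rem (p : nat) (iota 0 7).
  by move=> yp; rewrite mem_rem_uniq ?iota_uniq // inE mem_iota /= ltn_ord andbT.
have pqE : ((p : nat), (q : nat)) \in
  [:: (0, 1); (1, 2); (2, 3); (3, 4); (4, 5); (5, 0); (6, 0); (6, 3);
      (1, 0); (2, 1); (3, 2); (4, 3); (5, 4); (0, 5); (0, 6); (3, 6)].
  by move: epq; clear; case: p q => [[|[|[|[|[|[|[|p]]]]]]] // ?] [[|[|[|[|[|[|[|q]]]]]]] // ?].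
move/allP: theta0_step => /(_ _ pqE) /allP/(_ _ (memV _ n1)) /allP/(_ _ (memV _ n2)).
by move=> /allP/(_ _ (memV _ n3)) /allP/(_ _ (memV _ n4))/eqP.
Qed.

(** * Graphs between the dandelion and the lollipop *)

Section Labelling.
Variables m k : nat.
Hypotheses (m_gt0 : 0 < m) (k_gt1 : 1 < k).
Implicit Types i j : 'I_(m + k).

Lemma dandelion_edgeE i j : edge (i : dandelion m k) j =
  (i != j :> nat) && [|| (j <= m) && (j == i.+1 :> nat), (i == m :> nat) && (m < j),
                        (i <= m) && (i == j.+1 :> nat) | (j == m :> nat) && (m < i)].
Proof. by rewrite /edge /= /rel_edge /= -orbA. Qed.

Lemma lollipop_edgeE i j : edge (i : lollipop m k) j =
  (i != j :> nat) && [|| (j <= m) && (j == i.+1 :> nat), (m <= i) && (m <= j)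
                       | (i <= m) && (i == j.+1 :> nat)].
Proof.
rewrite /edge /= /rel_edge /= -val_eqE /=; congr (_ && _).
set a := (j <= m) && _; set b := (i <= m) && _; set c := (m <= i) && _.
by rewrite [(m <= j) && _]andbC -/c; case: a; case: b; case: c.
Qed.

Lemma card_geq_ord n a : #|[set j : 'I_n | a <= j]| = n - a.
Proof.
rewrite -sum1dep_card; have /= <- := @big_geq_mkord nat 0 addn a n xpredT (fun=> 1).
by rewrite sum_nat_const_nat muln1.
Qed.

Let ltm : m < m + k. Proof. by lia. Qed.
Let M : 'I_(m + k) := Ordinal ltm.

Lemma dandelion_connected i j : connect (@edge (dandelion m k)) i j.
Proof.
have csym : connect_sym (@edge (dandelion m k)) by apply/sym_connect_sym/edge_sym.
suff H (v : 'I_(m + k)) : connect (@edge (dandelion m k)) v M.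
  by apply: connect_trans (H i) _; rewrite csym.
have [vm|mv] := leqP v m; last first.
  by apply: connect1; rewrite dandelion_edgeE /= mv; lia.
have [d] := ubnP (m - v); elim: d v vm => // d IH v vm lt.
have [E|nE] := eqVneq (v : nat) m; first by have -> : v = M by apply: val_inj.
have sv : v.+1 < m + k by lia.
have e1 : edge (v : dandelion m k) (Ordinal sv) by rewrite dandelion_edgeE /=; lia.
by apply: connect_trans (connect1 e1) _; apply: IH => /=; lia.
Qed.

(** If [k > 2] the centre of the dandelion is the only vertex of the lollipop of large enough
    degree; an edge of the path is the only edge between the two sides of the lollipop. *)
Lemma DL_labelling (X : sgraph) : DL m k X -> exists f : X -> 'I_(m + k),
  [/\ bijective f, forall u v, edge u v -> edge (f u : lollipop m k) (f v)
    & forall u v, edge (f u : dandelion m k) (f v) -> edge u v].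
Proof.
case=> [[f [[f' fK f'K] fE]] [d [[d' dK d'K] dE]]].
exists f; split=> //; first by exists f'.
pose x' : rel 'I_(m + k) := [rel u v | edge (f' u) (f' v)].
have x'sym : symmetric x' by move=> u v; rewrite /x' /= edge_sym.
have x'lol (u v : 'I_(m + k)) : x' u v -> edge (u : lollipop m k) v by move=> /fE; rewrite !f'K.
pose h (i : 'I_(m + k)) : 'I_(m + k) := f (d i).
have hx' i j : edge (i : dandelion m k) j -> x' (h i) (h j) by move=> /dE; rewrite /x' /h /= !fK.
have hi : injective h by move=> i j /(can_inj fK)/(can_inj dK).
have x'c u v : connect x' u v.
  have hK w : h (d' (f' w)) = w by rewrite /h d'K f'K.
  rewrite -[u]hK -[v]hK; apply: connect_homo (dandelion_connected _ _) => i j.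
  exact: hx'.
have cross (i j : 'I_(m + k)) : j = i.+1 :> nat ->
    (forall u v : 'I_(m + k), u <= i -> i < v -> edge (u : lollipop m k) v -> u = i /\ v = j) ->
    x' i j.
  move=> ji uniq_edge; have iK : i \in [set u : 'I_(m + k) | u <= i] by rewrite inE.
  have jK : j \notin [set u : 'I_(m + k) | u <= i] by rewrite inE ji ltnn.
  have [u [v [+ + uv]]] := connect_exit (x'c i j) iK jK.
  rewrite !inE -ltnNge => ui iv; have [<- <-] := uniq_edge u v ui iv (x'lol _ _ uv).
  by [].
have path_edge (i j : 'I_(m + k)) : j = i.+1 :> nat -> j <= m -> x' i j.
  move=> ji jm; apply: cross => // u v ui iv; rewrite lollipop_edgeE => uv.
  by split; apply: val_inj => /=; lia.
have star_edge (j : 'I_(m + k)) : m < j -> x' M j.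
  move=> mj; have [k2|k3] := leqP k 2.
    apply: cross => [|u v]; rewrite [nat_of_ord M]/=; first by have := ltn_ord j; lia.
    move=> um mv; rewrite lollipop_edgeE => uv; have := ltn_ord j; have := ltn_ord v => v_lt j_lt.
    by split; apply: val_inj => /=; lia.
  pose N := [set i : 'I_(m + k) | (m.-1 <= i) && (i != M)].
  have cN : #|N| = k.
    have -> : N = [set i : 'I_(m + k) | m.-1 <= i] :\ M.
      by apply/setP=> i; rewrite !inE andbC.
    have := cardsD1 M [set i : 'I_(m + k) | m.-1 <= i].
    by rewrite card_geq_ord inE /= leq_pred; lia.
  have ME i : (i != M) = (i != m :> nat) by rewrite -val_eqE.
  have NM i : i \in N -> x' (h M) (h i).
    rewrite inE ME => /andP[i1 i2]; apply: hx'; rewrite dandelion_edgeE /=; lia.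
  have hM : h M = M.
    apply/eqP; apply: contraT => hMn; rewrite ME in hMn.
    pose B := [set v : 'I_(m + k) | edge (h M : lollipop m k) v].
    have : #|h @: N| <= #|B|.
      by apply/subset_leq_card/subsetP=> _ /imsetP[i iN ->]; rewrite inE; apply/x'lol/NM.
    rewrite (card_imset _ hi) cN; have [lt|gt|/eqP] := ltngtP (h M) m; last by rewrite (negbTE hMn).
      pose W := [set v : 'I_(m + k) | (h M).-1 <= v] :\: [set v : 'I_(m + k) | (h M).+2 <= v].
      have cB : #|B| <= #|W :\ h M|.
        by apply/subset_leq_card/subsetP=> v; rewrite !inE lollipop_edgeE -val_eqE /=; lia.
      have s2 : [set v : 'I_(m + k) | (h M).+2 <= v] \subset [set v : 'I_(m + k) | (h M).-1 <= v].
        by apply/subsetP=> v; rewrite !inE; lia.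
      have cW : #|W| <= 3 by rewrite cardsD (setIidPr s2) !card_geq_ord; lia.
      have hW : h M \in W by rewrite !inE; lia.
      by move: cB cW; rewrite (cardsD1 (h M) W) hW; lia.
    have cB : #|B| <= #|[set v : 'I_(m + k) | m <= v] :\ h M|.
      apply/subset_leq_card/subsetP=> v; rewrite !inE lollipop_edgeE -val_eqE /=; lia.
    have := cardsD1 (h M) [set v : 'I_(m + k) | m <= v].
    by rewrite card_geq_ord inE ltnW //; lia.
  have hN : h @: N = N.
    apply/eqP; rewrite eqEcard card_imset // leqnn andbT; apply/subsetP=> _ /imsetP[i iN ->].
    have := x'lol _ _ (NM i iN); rewrite hM lollipop_edgeE inE ME /=; lia.
  have : j \in N by rewrite inE ME; lia.
  by rewrite -hN => /imsetP[i iN ->]; rewrite -hM; apply: NM.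
suff H i j : edge (i : dandelion m k) j -> x' i j.
  by move=> u v /H; rewrite /x' /= !fK.
rewrite dandelion_edgeE => /andP[_ /or4P[]] /andP[].
- by move=> jm /eqP ji; apply: path_edge.
- by move=> /eqP im mj; have -> : i = M by [apply: val_inj]; apply: star_edge.
- by move=> im /eqP ij; rewrite x'sym; apply: path_edge.
- by move=> /eqP jm mi; rewrite x'sym; have -> : j = M by [apply: val_inj]; apply: star_edge.
Qed.

End Labelling.

(** * The friends-and-strangers graph of a labelled graph *)

Lemma bipartite_onT (Y : sgraph) : bipartite_on edge [set: Y] <-> bipartite Y.
Proof.
split=> [[c pc]|[c pc]]; exists c => u v; last by move=> _ _; apply: pc.
by apply: pc; rewrite inE.
Qed.

Lemma exceptional_onT (Y : sgraph) : exceptional_on edge [set: Y] -> exceptional #|Y| Y.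
Proof.
have copy_iso (G : sgraph) : is_copy edge G [set: Y] -> iso Y G.
  case=> f [fi fs fE]; have sur y : exists u, f u == y.
    by have [u <-] : exists u, f u = y by [apply/fs]; exists u.
  pose f' y := xchoose (sur y).
  have f'K : cancel f' f by move=> y; apply/eqP/(xchooseP (sur y)).
  have fK : cancel f f' by move=> u; apply: fi; rewrite f'K.
  by exists f'; split=> [|u v]; [exists f | rewrite -fE !f'K].
by rewrite /exceptional_on cardsT => -[[Y4 /copy_iso]|/copy_iso]; [left | right].
Qed.

Lemma bijection_of_card (A B : finType) : #|A| = #|B| ->
  exists (t : A -> B) (t' : B -> A), cancel t t' /\ cancel t' t.
Proof.
move=> E; exists (fun a => enum_val (cast_ord E (enum_rank a))),
  (fun b => enum_val (cast_ord (esym E) (enum_rank b))).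
by split=> a; rewrite enum_valK ?cast_ordK ?cast_ordKV enum_rankK.
Qed.

Section LabelledGraph.
Variables (m k : nat) (X Y : sgraph) (f : X -> 'I_(m + k)).
Hypotheses (m_gt0 : 0 < m) (k_gt1 : 1 < k) (cardY : #|Y| = m + k) (f_bij : bijective f).
Hypothesis f_lol : forall u v, edge u v -> edge (f u : lollipop m k) (f v).
Hypothesis f_dand : forall u v, edge (f u : dandelion m k) (f v) -> edge u v.

Definition only_dandelion_edges := forall u v, edge u v -> edge (f u : dandelion m k) (f v).

Variables (t : X -> Y) (t' : Y -> X).
Hypotheses (tK : cancel t t') (t'K : cancel t' t).

Let lab (y : Y) : nat := f (t' y).
Let x : rel Y := pulled_edge t'.
Let x0 : rel Y := [rel a b | edge (f (t' a) : dandelion m k) (f (t' b))].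

Let e_sym := @edge_sym Y.
Let e_irr := @edge_irrefl Y.

Let x_sym : symmetric x. Proof. by move=> a b; apply: edge_sym. Qed.
Let x_irr : irreflexive x. Proof. by move=> a; apply: edge_irrefl. Qed.
Let x0_sym : symmetric x0. Proof. by move=> a b; apply: edge_sym. Qed.
Let x0x : subrel x0 x. Proof. by move=> a b; apply: f_dand. Qed.

Let lab_inj : injective lab.
Proof. by move=> a b /val_inj/(bij_inj f_bij)/(can_inj t'K). Qed.

Let lab_onto i : i < m + k -> exists a, lab a = i.
Proof.
move=> lt; have [f' fK f'K] := f_bij; exists (t (f' (Ordinal lt))).
by rewrite /lab tK f'K.
Qed.

Let x0E a b : x0 a b = (lab a != lab b) &&
  [|| (lab b <= m) && (lab b == (lab a).+1), (lab a == m) && (m < lab b),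
      (lab a <= m) && (lab a == (lab b).+1) | (lab b == m) && (m < lab a)].
Proof. exact: dandelion_edgeE. Qed.

Let xE a b : x a b -> (lab a != lab b) &&
  [|| (lab b <= m) && (lab b == (lab a).+1), (m <= lab a) && (m <= lab b)
    | (lab a <= m) && (lab a == (lab b).+1)].
Proof. by move=> /f_lol; rewrite lollipop_edgeE. Qed.

Let x0_path a b : (lab a).+1 = lab b -> lab b <= m -> x0 a b.
Proof. by move=> ab bm; rewrite x0E; lia. Qed.

Let x0_star a b : lab a = m -> m < lab b -> x0 a b.
Proof. by move=> am mb; rewrite x0E; lia. Qed.

Let conn_le (S : {set Y}) : s_connected m.+1 Y -> #|S| <= m -> conn_in edge (~: S).
Proof. exact: s_connected_le. Qed.

Let nexcT : (m = 1 -> ~ exceptional (m + k) Y) -> m = 1 -> ~ exceptional_on edge [set: Y].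
Proof. by move=> ne /ne nexc /exceptional_onT; rewrite cardY. Qed.

Lemma FS_connected_nonbipartite : s_connected m.+1 Y -> ~ bipartite Y ->
  (m = 1 -> ~ exceptional (m + k) Y) -> connected (FS X Y).
Proof.
move=> sc nb ne; apply/(FS_connected tK t'K) => g h.
have nbT : ~ bipartite_on edge [set: Y] by move/bipartite_onT.
apply: connect_sub (nonbipartite_reach e_sym e_irr x0_sym lab_inj lab_onto cardY m_gt0 k_gt1
  x0_path x0_star (fun S => @conn_le S sc) (nexcT ne) g h nbT).
by move=> g1 h1 /(move_subrel x0x); apply: connect1.
Qed.

(** An edge of the lollipop outside the dandelion joins two leaves, and the dandelion is symmetric
    under their exchange. *)
Lemma FS_connected_extra_edge : s_connected m.+1 Y ->
  (m = 1 -> ~ exceptional (m + k) Y) -> ~ only_dandelion_edges -> connected (FS X Y).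
Proof.
move=> sc ne extra; apply/(FS_connected tK t'K) => g h.
case: (boolP [exists a, exists b, x a b && ~~ x0 a b]) => [/existsP[a /existsP[b /andP[xab x0ab]]]|];
    last first.
  rewrite negb_exists => /forallP none; case: extra => u v uv.
  have := none (t u); rewrite negb_exists => /forallP/(_ (t v)).
  by rewrite /x /x0 /pulled_edge /= !tK uv /= negbK.
have [ma mb ab] : [/\ m < lab a, m < lab b & lab a != lab b].
  by have := xE xab; move: x0ab; rewrite x0E; split; lia.
have neq : a != b by apply: contraNneq ab => ->.
have inv u v : x0 (tperm a b u) (tperm a b v) = x0 u v.
  by rewrite !x0E; do 2!case: tpermP => [->|->|_ _]; apply/idP/idP; lia.
have two g1 h1 := two_classes_reach e_sym e_irr x0_sym lab_inj lab_onto cardY m_gt0 k_gt1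
  x0_path x0_star (fun S => @conn_le S sc) (nexcT ne) g1 h1 ma mb neq inv.
have [p [q epq]] : exists p q : Y, edge p q.
  have c0 : #|@set0 Y| <= m by rewrite cards0.
  have := conn_le sc c0; rewrite setC0 => cY.
  have bn : b \notin [set a] by rewrite inE eq_sym.
  have [p [q [_ _ /and3P[_ _ epq]]]] := connect_exit (cY a b (in_setT _) (in_setT _)) (set11 a) bn.
  by exists p, q.
have pq : p != q by apply: contraTneq epq => ->; rewrite edge_irrefl.
exact: (reach_extra_edge g h e_sym x0x xab neq epq pq inv two).
Qed.

Lemma s_connected_of_FS : connected (FS X Y) -> s_connected m.+1 Y.
Proof.
move/(FS_connected tK t'K) => reach; split=> [|S [Sm]]; first by rewrite cardY; lia.
apply/del_vertices_connected; apply: (conn_in_of_reach (m := m) e_sym x_sym lab_inj _ _ reach Sm).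
  by move=> i im; apply: lab_onto; lia.
by move=> a b /xE; lia.
Qed.

(** The dandelion is bipartite: the colour is the parity of the label on the path, and all leaves
    are coloured like [m + 1]. The tokens [m - 1] and [m + 1] have the same colour. *)
Lemma nonbipartite_of_FS : only_dandelion_edges -> connected (FS X Y) -> ~ bipartite Y.
Proof.
move=> only /(FS_connected tK t'K) reach [ce pce].
have [|a aE] := lab_onto (i := m.-1); first by lia.
have [|b bE] := lab_onto (i := m.+1); first by lia.
pose cx a := odd (minn (lab a) m.+1).
apply: (@parity_not_reach _ x edge cx ce _ pce a b _ _ reach).
- move=> u v /only; rewrite -[edge _ _]/(x0 u v) x0E /cx => uv.
  have [|] : minn (lab u) m.+1 = (minn (lab v) m.+1).+1 \/
    minn (lab v) m.+1 = (minn (lab u) m.+1).+1.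
  + by lia.
  + by move=> ->; rewrite /=; case: odd.
  + by move=> ->; rewrite /=; case: odd.
- by apply/eqP=> ab; move: bE; rewrite -ab aE; lia.
- rewrite /cx aE bE minnn (minn_idPl _); last by lia.
  by case: (m) m_gt0 => //= m' _; rewrite negbK.
Qed.

Lemma nonexceptional_of_FS : m = 1 -> only_dandelion_edges -> connected (FS X Y) ->
  ~ exceptional (m + k) Y.
Proof.
move=> m1 only /(FS_connected tK t'K) reach ex.
have [|c cE] := lab_onto (i := m); first by lia.
have xc a b : x a b -> a = c \/ b = c.
  move=> /only; rewrite -[edge _ _]/(x0 a b) x0E => ab.
  have [am|bm] : lab a = m \/ lab b = m by lia.
    by left; apply: lab_inj; rewrite am.
  by right; apply: lab_inj; rewrite bm.
case: ex => [[n4 iY]|iY]; first exact: (cycle_not_reach n4 iY xc reach).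
exact: (theta0_not_reach iY xc reach).
Qed.

Lemma FS_biconnected_of_connected : connected (FS X Y) -> s_connected 2 (FS X Y).
Proof.
move=> cFS; have sc := s_connected_of_FS cFS.
apply: (FS_biconnected tK t'K).
  rewrite (card_FS tK t'K) cardY; apply: leq_trans (fact_geq _); lia.
move/(FS_connected tK t'K) in cFS.
apply: conn_in_without_vertex => // [|g h1 h2]; first exact: move_sym.
have [|c cE] := lab_onto (i := m); first by lia.
pose D := above lab g m.-1.
have bD : biconn_in edge D.
  split=> [|y]; first by apply: (conn_above0 lab_inj (fun S => @conn_le S sc)); apply: leq_pred.
  by apply: (conn_above lab_inj (fun S => @conn_le S sc)); rewrite cards1; lia.
have D_gt : m + k - m.-1 <= #|D| by apply: above_gt.
have D3 : 2 < #|D| by lia.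
have cD : g c \in D by rewrite mem_above cE leq_pred.
apply: (neighbours_connected e_sym e_irr x_sym x_irr bD D3 cD) => a ac.
rewrite mem_above; apply/idP/idP => [/xE|am]; first by lia.
have am' : lab a != m by rewrite -cE (inj_eq lab_inj).
by apply: x0x; rewrite x0E; lia.
Qed.

End LabelledGraph.

(** * The theorem *)

(** The smaller colour class has at most [m] vertices; deleting it isolates the other one. *)
Lemma nonbipartite_of_s_connected (Y : sgraph) m k : 1 < k -> k <= m.+1 -> #|Y| = m + k ->
  s_connected m.+1 Y -> ~ bipartite Y.
Proof.
move=> k2 km cY sc [c0 pc0].
have [c pc cm] : exists2 c : Y -> bool, (forall u v, edge u v -> c u != c v) & #|[set u | c u]| <= m.
  have cc := cardsC [set u | c0 u]; rewrite cY in cc.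
  have [le|gt] := leqP #|[set u | c0 u]| m; first by exists c0.
  exists (fun u => ~~ c0 u) => [u v /pc0|]; first by case: (c0 u); case: (c0 v).
  have -> : [set u | ~~ c0 u] = ~: [set u | c0 u] by apply/setP=> u; rewrite !inE.
  by lia.
have : 1 < #|~: [set u | c u]| by have := cardsC [set u | c u]; rewrite cY; lia.
case/card_gt1P=> u [v [uc vc uv]].
have vu : v \notin [set u] by rewrite inE eq_sym.
have [a [b [_ _ /and3P[+ + ab]]]] := connect_exit (s_connected_le sc cm uc vc) (set11 u) vu.
by rewrite !inE; have := pc a b ab; case: (c a); case: (c b).
Qed.

Theorem theorem4p1 (n k : nat) (X Y : sgraph)
  (hn : 2 <= n) (hk : 2 <= k) (hkn : k + 1 <= n)
  (hX : DL (n - k) k X) (hY : #|Y| = n) :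
  (* (i) *)
  (n = k + 1 -> iso X (dandelion 1 (n - 1)) ->
     (connected (FS X Y) <->
      [/\ s_connected 2 Y, ~ bipartite Y & ~ exceptional n Y])) /\
  (* (ii) *)
  (n = k + 1 -> ~ iso X (dandelion 1 (n - 1)) -> ~ exceptional n Y ->
     (connected (FS X Y) <-> s_connected 2 Y)) /\
  (* (iii) *)
  (k + 2 <= n <= 2 * k - 2 -> iso X (dandelion (n - k) k) ->
     (connected (FS X Y) <-> ~ bipartite Y /\ s_connected (n - k + 1) Y)) /\
  (* (iv) *)
  (k + 2 <= n <= 2 * k - 2 -> ~ iso X (dandelion (n - k) k) ->
     (connected (FS X Y) <-> s_connected (n - k + 1) Y)) /\
  (* (v) *)
  (2 * k - 1 <= n -> n <> k + 1 ->
     (connected (FS X Y) <-> s_connected (n - k + 1) Y)) /\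
  (* (vi) *)
  (connected (FS X Y) <-> s_connected 2 (FS X Y)).
Proof.
have [m En] : exists m, n = m + k by exists (n - k); lia.
move: hn hkn hX hY; rewrite {n}En addnK (addn1 m) => hn hkn hX hY.
have m0 : 0 < m by lia.
have [f [fb fl fd]] := DL_labelling m0 hk hX.
have [t [t' [tK t'K]]] : exists (t : X -> Y) (t' : Y -> X), cancel t t' /\ cancel t' t.
  by apply: bijection_of_card; rewrite hY (bij_eq_card fb) card_ord.
have sep := s_connected_of_FS m0 hk hY fb fl tK t'K.
have nonbip := FS_connected_nonbipartite m0 hk hY fb fd tK t'K.
have extra := FS_connected_extra_edge m0 hk hY fb fl fd tK t'K.
have not_only : ~ iso X (dandelion m k) -> ~ only_dandelion_edges f.
  move=> ni only; apply: ni; exists f; split=> // u v.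
  by apply/idP/idP; [apply: fd | apply: only].
have dand : iso X (dandelion m k) -> connected (FS X Y) ->
    ~ bipartite Y /\ (m = 1 -> ~ exceptional (m + k) Y).
  case=> f1 [f1b f1E] cFS.
  have only : only_dandelion_edges f1 by move=> u v; rewrite f1E.
  split; first exact: (nonbipartite_of_FS m0 hk hY f1b tK t'K only cFS).
  by move=> m1; apply: (nonexceptional_of_FS m0 hk hY f1b tK t'K m1 only cFS).
have dandE : m + k = k + 1 -> m = 1 /\ m + k - 1 = k by lia.
split=> [/dandE[m1 ->] isoX|].
  rewrite -m1 in isoX; split=> [cFS|[s2 nb ne]]; last by apply: nonbip => //; rewrite m1.
  have [nb ne] := dand isoX cFS; split=> //; last exact: ne.
  by have := sep cFS; rewrite m1.
split=> [/dandE[m1 ->] nisoX ne|].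
  rewrite -m1 in nisoX; split=> [/sep|s2]; first by rewrite m1.
  by apply: extra; [rewrite m1 | | exact: not_only].
split=> [/andP[km _] isoX|].
  split=> [cFS|[nb sm]]; last by apply: nonbip => // m1; lia.
  by have [nb _] := dand isoX cFS; split=> //; apply: sep.
split=> [/andP[km _] nisoX|].
  by split=> [/sep//|sm]; apply: extra => //; [lia | exact: not_only].
split=> [km m1|].
  split=> [/sep//|sm]; apply: nonbip => //; last by lia.
  by apply: (nonbipartite_of_s_connected hk _ hY sm); lia.
split; last exact: s_connected2_connected.
exact: (FS_biconnected_of_connected m0 hk hY fb fl fd tK t'K).
Qed.
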